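(* Let $U$ be a symmetric real random variable with a continuous probability density function $\rho_U$ on $\mathbb{R}$ such that, for some real numbers $0<a<1<b$, the function $x\mapsto x^{z-1}\rho_U(x)$, $x\geq 0$, is integrable on $[0,\infty)$ for every $z\in\mathbb{C}$ in the strip $a<\Re(z)<b$. Suppose that for some $\alpha\in(0,1)$ $$|U|\overset{\mathcal{L}}{=}|U|^{\alpha}X_{\alpha},$$ where $X_\alpha$ is a positive random variable, independent of $U$, with density function $$\rho_{X_{\alpha}}(t)=2^{(1+\alpha)/2}\,W_{-\alpha,(1-\alpha)/2}\left(-2^{\alpha-1}t^{2}\right),\quad t>0.$$ Then $U\overset{\mathcal{L}}{=}\mathcal{N}(0,1)$.
   Context: $\overset{\mathcal{L}}{=}$ denotes equality in law, and $\mathcal{N}(0,1)$ is the standard normal distribution. ''Symmetric'' means $U\overset{\mathcal{L}}{=}-U$. For $\lambda>-1$ and $\mu\in\mathbb{C}$, the Wright function is the entire function $$W_{\lambda,\mu}(z):=\sum_{n=0}^{\infty}\frac{z^{n}}{n!\,\Gamma(\lambda n+\mu)},$$ with the convention $1/\Gamma(x)=0$ when $x\in\{0,-1,-2,\dots\}$. For $\alpha\in(0,1)$, the function $\rho_{X_\alpha}$ in the statement is a probability density on $(0,\infty)$. *)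

(* Defs.v *)
From HB Require Import structures.
From mathcomp Require Import all_boot all_order all_algebra.
From mathcomp Require Import complex.
From mathcomp Require Import all_classical all_reals all_analysis.

Set Implicit Arguments.
Unset Strict Implicit.
Unset Printing Implicit Defensive.

Import Order.TTheory GRing.Theory Num.Theory.
Import numFieldNormedType.Exports.

Local Open Scope classical_set_scope.
Local Open Scope ring_scope.
Local Open Scope ereal_scope.

Section laws.
Context {R : realType}.

(* Set functions such as [pushforward P X] carry no information outside the
   Borel sets, so laws are compared on Borel sets only. *)
Definition eq_law (m1 m2 : set R -> \bar R) : Prop :=
  forall B : set R, measurable B -> m1 B = m2 B.

Context {d : measure_display} {T : measurableType d} (P : probability T R).

Definition symmetric_rv (U : {RV P >-> R}) : Prop :=
  eq_law (pushforward P U) (pushforward P (fun w => - U w)%R).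

Definition independent_rv (U X : {RV P >-> R}) : Prop :=
  forall A B : set R, measurable A -> measurable B ->
    P (U @^-1` A `&` X @^-1` B) = P (U @^-1` A) * P (X @^-1` B).

Definition has_density (U : {RV P >-> R}) (f : R -> R) : Prop :=
  [/\ measurable_fun [set: R] f,
      forall x, (0 <= f x)%R &
      eq_law (pushforward P U)
             (fun B => \int[lebesgue_measure]_(x in B) (f x)%:E)].

End laws.

Local Close Scope ereal_scope.

Section complex_integrability.
Context {R : realType}.

(* x^z = exp (z ln x) for x > 0 and z complex; the value at x <= 0 is a
   convention without significance for integrals over [0, +oo[. *)
Definition cpower (x : R) (z : R[i]) : R[i] :=
  ((expR (complex.Re z * ln x) * cos (complex.Im z * ln x)) +i*
   (expR (complex.Re z * ln x) * sin (complex.Im z * ln x)))%C.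

Definition cintegrable (D : set R) (f : R -> R[i]) : Prop :=
  lebesgue_measure.-integrable D (EFin \o (fun x => complex.Re (f x))) /\
  lebesgue_measure.-integrable D (EFin \o (fun x => complex.Im (f x))).

End complex_integrability.

Section wright.
Context {R : realType}.

(* Euler's integral, convergent for x > 0. *)
Definition euler_integral (x : R) : R :=
  \int[lebesgue_measure]_(t in `]0%R, +oo[) (t `^ (x - 1) * expR (- t)).

(* The real Gamma function, extended to x <= 0 through
     Gamma x = Gamma (x + n) / (x (x + 1) ... (x + n - 1)),
   with n the least natural number such that x + n > 0.  At the poles
   0, -1, -2, ... one factor of the product vanishes, so that Gamma x = 0 and
   (Gamma x)^-1 = 0, which is the usual convention for 1 / Gamma. *)
Definition Gamma (x : R) : R :=
  let n := if 0 < x then 0%N else (Num.truncn (- x)).+1 in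
  euler_integral (x + n%:R) / \prod_(i < n) (x + i%:R).

(* The Wright function for a real parameter mu and a real argument z. *)
Definition wright (lambda mu z : R) : R :=
  limn (series (fun n : nat =>
    z ^+ n * (n`!%:R)^-1 * (Gamma (lambda * n%:R + mu))^-1)).

Definition rhoX (alpha t : R) : R :=
  if 0 < t then
    2 `^ ((1 + alpha) / 2) *
    wright (- alpha) ((1 - alpha) / 2) (- (2 `^ (alpha - 1) * t ^+ 2))
  else 0.

End wright.

(* Main.v *)
Require Import Defs.
From HB Require Import structures.
From mathcomp Require Import all_boot all_order all_algebra.
From mathcomp Require Import complex.
From mathcomp Require Import all_classical all_reals all_analysis measurable_realfun.
From mathcomp Require Import ring lra.

(** Let V = ln |U|.  The hypothesis says that V has the law of alpha V + ln X, with
    X independent of V.  As [0 < alpha < 1], this determines the law of V: if g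
    is Lipschitz with values between 0 and 1, then so is
      (A g)(v) = E g(alpha v + ln X),
    the means of g(V) and (A g)(V) are equal, and A multiplies the Lipschitz
    constant by alpha.  Hence the iterates of A flatten g, and their values at 0
    converge to the mean of g(V), which thus depends only on alpha and on the law
    of X ([affine_step_unique]).  Such test functions determine the law
    ([lipschitz01_determining]), and as U is symmetric, the law of U follows from
    that of V ([symmetric_ln_abs]).

    It remains to see that V = ln |N|, for N standard normal, satisfies the same
    equation.  For densities this is a convolution equation
    ([ln_abs_normal_pdf_fixed]) which amounts to the Laplace identity
    (a = alpha, m = (1 - a) / 2 and x >= 0)
      int_0^oo y^(m - 1) exp (- y) W_{-a,m}(- x y^(-a)) dy = exp (- x)
    ([laplace_wright], with y = exp s).  To prove it, W is written as an integral
    of Hankel type along the ray of angle phi = pi / (1 + a) ([wright_integralE]),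
    by expanding in powers of the argument, rotating the integral for Gamma
    ([Gamma_pos_rotated]) and using the reflection formula ([Gamma_inv]).  After an
    exchange of integrals the integral over y is elementary, and there remains
    the integral along the line Im w = phi of
      Im (exp (k w - x exp (a w)) / (2 sinh (w / 2))),    k = 1 / 2 - m.
    By Cauchy's theorem ([strip_integral_const]) the line may be lowered to the
    real axis, where the quotient is real, so that only half the residue at the
    pole w = 0 remains, that is - pi exp (- x) ([residue_integral]).  The case
    a = x = 0, phi = pi of the same formula is the reflection formula. *)

Set Implicit Arguments.
Unset Strict Implicit.
Unset Printing Implicit Defensive.

Import Order.TTheory GRing.Theory Num.Theory.
Import numFieldNormedType.Exports.

Local Open Scope classical_set_scope.
Local Open Scope ring_scope.
Local Open Scope complex_scope.

(** * Measures with a density *)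

Section density.
Local Open Scope ereal_scope.
Import HBNNSimple.

(** Monotone convergence reduces the identity to indicators.  The density is
    given by the equation [nuE], so that the lemma also applies to an image
    measure whose density has been computed separately. *)
Lemma ge0_integral_density d (T : measurableType d) (R : realType)
    (mu nu : {measure set T -> \bar R}) (g : T -> R)
    (mg : measurable_fun setT g) (g0 : forall x, (0 <= g x)%R)
    (nuE : forall A, measurable A -> nu A = \int[mu]_(x in A) (g x)%:E)
    (f : T -> \bar R) (mf : measurable_fun setT f) (f0 : forall x, 0 <= f x) :
  \int[nu]_x f x = \int[mu]_x (f x * (g x)%:E).
Proof.
pose h := nnsfun_approx (@measurableT _ T) mf.
have mgE : measurable_fun setT (EFin \o g) by exact/measurable_EFinP.
have -> : \int[nu]_x f x = limn (fun n => \int[nu]_x (h n x)%:E).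
  rewrite -monotone_convergence//=.
  - by apply: eq_integral => x _; apply/esym/cvg_lim => //; exact: cvg_nnsfun_approx.
  - by move=> n; exact/measurable_EFinP/measurable_funP.
  - by move=> n x _; rewrite lee_fin.
  - by move=> x _ a b ab; rewrite lee_fin; exact/lefP/nd_nnsfun_approx.
have -> : \int[mu]_x (f x * (g x)%:E) =
    limn (fun n => \int[mu]_x ((h n x)%:E * (g x)%:E)).
  rewrite -monotone_convergence//=.
  - apply: eq_integral => x _; apply/esym/cvg_lim => //.
    by apply: cvgeZr => //; exact: cvg_nnsfun_approx.
  - move=> n; apply: emeasurable_funM => //.
    exact/measurable_EFinP/measurable_funP.
  - by move=> n x _; rewrite mule_ge0// lee_fin.
  - by move=> x _ a b ab; rewrite lee_wpmul2r ?lee_fin//; exact/lefP/nd_nnsfun_approx.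
congr (limn _); apply/funext => n.
under eq_integral do rewrite fimfunE -fsumEFin//.
rewrite ge0_integral_fsum//; last 2 first.
  - by move=> y; apply/measurable_EFinP; exact: measurable_funM.
  - by move=> m y Ey; exact: nnfun_muleindic_ge0.
under [RHS]eq_integral => x _.
  rewrite fimfunE -fsumEFin// ge0_mule_fsuml; last by move=> y; exact: nnfun_muleindic_ge0.
  over.
rewrite ge0_integral_fsum//; last 2 first.
  - move=> y; apply: emeasurable_funM => //.
    by apply/measurable_EFinP; exact: measurable_funM.
  - by move=> m y Ey; rewrite mule_ge0 ?lee_fin// -lee_fin; exact: nnfun_muleindic_ge0.
apply: eq_fsbigr => r rhn.
under eq_integral do rewrite EFinM.
rewrite integralZl_indic_nnsfun => //.
under [RHS]eq_integral do rewrite EFinM -muleA.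
have r0 : (0 <= r)%R.
  by move: rhn; rewrite inE => -[x _ <-].
rewrite ge0_integralZl//=; last 2 first.
- by apply: emeasurable_funM => //; exact/measurable_EFinP.
- by move=> x _; rewrite mule_ge0 ?lee_fin.
congr (_ * _); rewrite integral_indic// setIT nuE//.
rewrite integral_mkcond/=; apply: eq_integral => x _.
by rewrite epatch_indic/= muleC.
Qed.

End density.

(** * Differentiation and integration on the real line *)

Section pointwise_derivatives.
Context {R : realType}.
Implicit Types (f g : R -> R) (x a b : R).

(** Rules of differentiation for functions given pointwise, with the value of
    the derivative as an argument, so that it can be found by unification. *)
Lemma isd_eq f x a b : is_derive x 1 f a -> a = b -> is_derive x 1 f b.
Proof. by move=> h <-. Qed.

Lemma isd_id x : is_derive x 1 (fun t : R => t) (1 : R).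
Proof. exact: is_derive_id. Qed.

Lemma isd_cst c x : is_derive x 1 (fun _ : R => c) (0 : R).
Proof. exact: is_derive_cst. Qed.

Lemma isdD f g x a b : is_derive x 1 f a -> is_derive x 1 g b ->
  is_derive x 1 (fun t => f t + g t) (a + b).
Proof. by move=> hf hg; exact: is_deriveD. Qed.

Lemma isdN f x a : is_derive x 1 f a -> is_derive x 1 (fun t => - f t) (- a).
Proof. by move=> hf; exact: is_deriveN. Qed.

Lemma isdM f g x a b : is_derive x 1 f a -> is_derive x 1 g b ->
  is_derive x 1 (fun t => f t * g t) (a * g x + f x * b).
Proof.
move=> hf hg; have h : is_derive x 1 (f * g) (f x *: b + g x *: a).
  exact: is_deriveM.
by apply: is_derive_eq h _; rewrite addrC mulrC.
Qed.

Lemma isd_comp f g x a b : is_derive (g x) 1 f a -> is_derive x 1 g b ->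
  is_derive x 1 (fun t => f (g t)) (a * b).
Proof.
by move=> hf hg; have := is_derive1_comp hf hg.
Qed.

Lemma isdV f x a : f x != 0 -> is_derive x 1 f a ->
  is_derive x 1 (fun t => (f t)^-1) (- a / f x ^+ 2).
Proof.
move=> fx0 hf; apply: is_derive_eq (is_deriveV fx0 hf) _.
by rewrite /GRing.scale/= mulNr mulNr mulrC.
Qed.

Lemma isd_continuous f x a : is_derive x 1 f a -> {for x, continuous f}.
Proof.
by move=> [df _]; apply: differentiable_continuous; exact/derivable1_diffP.
Qed.

End pointwise_derivatives.

Ltac isd_rules := repeat first
  [ eassumption | notypeclasses refine (isd_cst _ _)
  | notypeclasses refine (isd_id _) | notypeclasses refine (isdD _ _)
  | notypeclasses refine (isdN _) | notypeclasses refine (isdM _ _)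
  | notypeclasses refine (isd_comp (f := expR) (is_derive_expR _) _)
  | notypeclasses refine (isd_comp (f := sin) (is_derive_sin _) _)
  | notypeclasses refine (isd_comp (f := cos) (is_derive_cos _) _)
  | notypeclasses refine (isd_comp (f := atan) (is_derive1_atan _) _) ].

(** Synthesizes the derivative of an explicit formula and leaves only its
    comparison with the expected value. *)
Ltac isd := notypeclasses refine (isd_eq _ _); [isd_rules|cbv beta].

(** The null set [N] makes room for the single point [t = 0] at which the
    integrand of [residue_integral] does not converge. *)
Lemma dominated_cvg_Rintegral d (T : measurableType d) (R : realType)
    (mu : {measure set T -> \bar R}) (N : set T) (f_ : nat -> T -> R)
    (f g : T -> R) :
  measurable N -> mu N = 0%E ->
  (forall n, measurable_fun setT (f_ n)) -> measurable_fun setT f ->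
  (forall x, ~ N x -> f_ ^~ x @ \oo --> f x) ->
  mu.-integrable setT (EFin \o g) -> (forall n x, `|f_ n x| <= g x) ->
  (fun n => \int[mu]_x f_ n x) @ \oo --> \int[mu]_x f x.
Proof.
move=> mN N0 mf_ mf f_f intg fg.
have ff : {ae mu, forall x, setT x ->
    (fun n => (EFin \o f_ n) x) @ \oo --> (EFin \o f) x}.
  exists N; split => // x /= /not_implyP[_ fx]; apply: contrapT => Nx.
  by apply: fx; apply: cvg_EFin; [exact: nearW|exact: f_f].
have mfE n : measurable_fun setT (EFin \o f_ n) by exact/measurable_EFinP.
have mE : measurable_fun setT (EFin \o f) by exact/measurable_EFinP.
have gE : {ae mu, forall x n, setT x -> (`|(EFin \o f_ n) x| <= (EFin \o g) x)%E}.
  by apply: aeW => x n _; rewrite lee_fin.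
have [intf _ h] := dominated_convergence measurableT mfE mE ff intg gE.
by apply: fine_cvg; rewrite fineK//; exact: integrable_fin_num.
Qed.

Section real_line.
Context {R : realType}.
Notation mu := (@lebesgue_measure R).

Lemma integrable_expR_norm (e : R) : 0 < e ->
  mu.-integrable setT (EFin \o (fun t : R => expR (- (e * `|t|)))).
Proof.
move=> e0.
have cf : continuous (fun t : R => expR (- (e * `|t|))).
  move=> t; apply: continuous_comp; last exact: continuous_expR.
  apply: continuousN; apply: continuousM; first exact: cst_continuous.
  exact: norm_continuous.
apply/integrableP; split; first by apply/measurable_EFinP; exact: continuous_measurable_fun.
under eq_integral do rewrite /= gtr0_norm ?expR_gt0//.
rewrite ge0_symfun_integralT//=; last by move=> x /=; rewrite normrN.
rewrite (_ : [set x : R | 0 <= x] = `[0, +oo[%classic); last first.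
  by apply/seteqP; split => x /=; rewrite in_itv/= andbT.
under eq_integral => x.
  rewrite inE/= in_itv/= andbT => x0; rewrite (ger0_norm x0).
  over.
have dF (x : R) : is_derive x 1 (fun t : R => - (e^-1 * expR (- (e * t)))) (expR (- (e * x))).
  by isd; field; rewrite gt_eqF.
rewrite (@ge0_continuous_FTC2y _ _ (fun t => - (e^-1 * expR (- (e * t)))) _ 0).
- by rewrite -EFinB lte_mul_pinfty ?lee_fin ?ltry.
- by move=> x _; rewrite expR_ge0.
- apply: continuous_subspaceT => t; apply: isd_continuous; isd_rules.
- rewrite -oppr0; apply: cvgN; rewrite -[X in _ --> X](mulr0 e^-1).
  apply: cvgMl_tmp.
  apply: (cvg_comp (fun t => e * t) (fun x => expR (- x)) _ (@cvgr_expR R)).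
  by apply: gt0_cvgMry => //; exact: cvg_id.
- by move=> x _; have [] := dF x.
- by apply: cvg_at_right_filter; exact: isd_continuous (dF _).
- by move=> x _; rewrite derive1E; apply: derive_val.
Qed.

Lemma integrable_le_expR (f : R -> R) (M e : R) : 0 < e ->
  measurable_fun setT f -> (forall t, `|f t| <= M * expR (- (e * `|t|))) ->
  mu.-integrable setT (EFin \o f).
Proof.
move=> e0 mf fM.
have := integrableZl measurableT M (integrable_expR_norm e0).
apply: le_integrable => //; first exact/measurable_EFinP.
by move=> t _; rewrite /= lee_fin (le_trans (fM t))// ler_norm.
Qed.

Lemma cvgy_natS : (fun n : nat => n.+1%:R : R) @ \oo --> +oo.
Proof.
apply/cvgryPge => A; exists (Num.truncn A) => // n /= h.
by apply: (@le_trans _ _ (Num.truncn A).+1%:R); [exact/ltW/truncnS_gt|rewrite ler_nat].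
Qed.

Lemma cvg_integral_itv (f : R -> R) : mu.-integrable setT (EFin \o f) ->
  (fun n : nat => \int[mu]_(x in `[- n.+1%:R, n.+1%:R]) f x) @ \oo --> \int[mu]_x f x.
Proof.
move=> intf; have mf : measurable_fun setT f by apply/measurable_EFinP; exact: (measurable_int mu).
under eq_fun do rewrite Rintegral_mkcond.
apply: (@dominated_cvg_Rintegral _ _ _ mu set0
  (fun n : nat => f \_ `[- n.+1%:R, n.+1%:R]) f (fun x => `|f x|)) => //.
- by move=> n; apply/measurable_restrict => //; exact: measurable_funTS.
- move=> x _; apply: cvg_near_cst; near=> n.
  rewrite patchE mem_set//= in_itv/= -ler_norml.
  near: n; exists (Num.truncn `|x|) => // n /= h.
  by rewrite (le_trans (ltW (truncnS_gt _)))// ?ler_nat.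
- by move/integrable_norm : intf.
- by move=> n x; rewrite patchE; case: ifP => // _; rewrite normr0.
Unshelve. all: end_near. Qed.

(** The fundamental theorem of calculus on the intervals [-n, n], and
    dominated convergence. *)
Lemma integral_derive (F f : R -> R) (l1 l2 : R) :
  (forall t : R, is_derive t 1 F (f t)) -> continuous f ->
  mu.-integrable setT (EFin \o f) ->
  F t @[t --> -oo] --> l1 -> F t @[t --> +oo] --> l2 ->
  \int[mu]_t f t = l2 - l1.
Proof.
move=> dF cf intf F1 F2.
have := cvg_integral_itv intf => /cvg_unique; apply => //.
rewrite (_ : (fun n : nat => _) = (fun n : nat => F n.+1%:R - F (- n.+1%:R))); last first.
  apply/funext => n; rewrite /Rintegral (@continuous_FTC2 _ _ F).
  - by rewrite -EFinB.
  - by rewrite -subr_gt0 opprK addr_gt0// ltr0Sn.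
  - exact: continuous_subspaceT.
  - split.
    + by move=> x _; have [] := dF x.
    + by apply: cvg_at_right_filter; exact: isd_continuous (dF _).
    + by apply: cvg_at_left_filter; exact: isd_continuous (dF _).
  - by move=> x _; rewrite derive1E; have h := dF x; apply: derive_val.
apply: cvgB.
  apply: (cvg_comp (fun n : nat => n.+1%:R) F _ F2).
  exact: cvgy_natS.
apply: (cvg_comp (fun n : nat => - n.+1%:R) F _ F1).
by apply: (cvgNrNy (fun n : nat => n.+1%:R : R)).2; exact: cvgy_natS.
Qed.

End real_line.

(** * Change of variables *)

Section density_measure.
Context d {T : measurableType d} {R : realType} (mu : {measure set T -> \bar R}).
Local Open Scope ereal_scope.

(** Taking the proofs as arguments lets the measure structure be attached to
    this constant, which uniqueness theorems for measures require. *)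
Definition density_measure (g : T -> R) of measurable_fun setT g &
  (forall x, (0 <= g x)%R) := fun A : set T => \int[mu]_(x in A) (g x)%:E.

Variables (g : T -> R) (mg : measurable_fun setT g) (g0 : forall x, (0 <= g x)%R).
Local Notation nu := (density_measure mg g0).

Let nu0 : nu set0 = 0.
Proof. by rewrite /density_measure integral_set0. Qed.

Let nu_ge0 A : 0 <= nu A.
Proof. by apply: integral_ge0 => x _; rewrite lee_fin. Qed.

Let nu_sigma_additive : semi_sigma_additive nu.
Proof.
move=> /= F mF tF mUF; rewrite /density_measure; apply: cvg_toP.
  apply: ereal_nondecreasing_is_cvgn => m n mn.
  apply: lee_sum_nneg_natr => // k _ _.
  by apply: integral_ge0 => /= x Fkx; rewrite lee_fin.
rewrite ge0_integral_bigcup//=.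
- exact/measurable_funTS/measurable_EFinP.
- by move=> x _; rewrite lee_fin.
Qed.

HB.instance Definition _ := isMeasure.Build _ _ _ nu nu0 nu_ge0 nu_sigma_additive.

End density_measure.

Section change_of_variables.
Context {R : realType}.
Notation mu := (@lebesgue_measure R).

Section increasing_substitution.
Variables (phi dphi psi : R -> R) (J : set R).
Hypothesis mJ : measurable J.
Hypothesis mpsi : measurable_fun setT psi.
Hypothesis phiJ : forall t, J (phi t).
Hypothesis psiK : forall x, J x -> phi (psi x) = x.
Hypothesis Jconvex : forall x y z, J x -> J z -> x < y -> y <= z -> J y.
Hypothesis phi_lt : forall s t, s < t -> phi s < phi t.
Hypothesis dphiE : forall t : R, is_derive t 1 phi (dphi t).
Hypothesis cdphi : continuous dphi.
Hypothesis dphi0 : forall t, 0 <= dphi t.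

Let mdphi : measurable_fun setT dphi.
Proof. exact: continuous_measurable_fun. Qed.

(** The image under [psi] of Lebesgue measure on [J] and the measure with
    density [dphi] both give the mass [phi t - phi s] to the interval from [s]
    to [t], hence are equal. *)
Lemma ge0_change_of_variables (f : R -> \bar R) :
  measurable_fun setT f -> (forall x, 0 <= f x)%E ->
  (\int[mu]_(x in J) f x = \int[mu]_t (f (phi t) * (dphi t)%:E))%E.
Proof.
move=> mf f0.
have phi_le s t : (phi s <= phi t) = (s <= t).
  case: (leP s t) => [|/phi_lt h]; last by rewrite leNgt h.
  by rewrite le_eqVlt => /predU1P[->|/phi_lt/ltW]; rewrite ?lexx.
have phi_ltE s t : (phi s < phi t) = (s < t) by rewrite !ltNge phi_le.
have mphi : measurable_fun setT phi.
  by apply: continuous_measurable_fun => t; exact: isd_continuous (dphiE t).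
have mpsi' : measurable_fun [set: measurableTypeR R] (psi : _ -> measurableTypeR R).
  exact: mpsi.
have nuE A : measurable A -> pushforward (mrestr mu mJ) psi A = density_measure mu mdphi dphi0 A.
  have mcov : \bigcup_n `](- n.+1%:R : R), n.+1%:R]%classic = setT.
    rewrite -subTset => x _ /=; exists (Num.truncn `|x|) => //=.
    rewrite in_itv/=; have := truncnS_gt `|x|; rewrite ltr_norml => /andP[-> /ltW ->].
    by [].
  have hint a b : a < b -> pushforward (mrestr mu mJ) psi `]a, b]%classic = (phi b - phi a)%:E.
    move=> ab; rewrite /pushforward /mrestr.
    rewrite (_ : _ `&` _ = `]phi a, phi b]%classic); last first.
      apply/seteqP; split => [x [/= xab Jx]|x /=].
        by move: xab; rewrite !in_itv/= -phi_ltE -phi_le (psiK Jx).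
      rewrite in_itv/= => /andP[ax xb].
      have Jx : J x by exact: (Jconvex (phiJ a) (phiJ b)).
      by split => //; rewrite in_itv/= -phi_le -phi_ltE psiK// ax xb.
    by rewrite lebesgue_measure_itv/= lte_fin phi_ltE ab EFinB.
  have hint' a b : a < b -> density_measure mu mdphi dphi0 `]a, b]%classic = (phi b - phi a)%:E.
    move=> ab; rewrite /density_measure.
    rewrite integral_itv_obnd_cbnd; last by apply/measurable_EFinP; exact: measurable_funTS.
    rewrite (@continuous_FTC2 _ _ phi) ?EFinB//.
    - exact: continuous_subspaceT.
    - split.
      + by move=> x _; have [] := dphiE x.
      + by apply: cvg_at_right_filter; exact: isd_continuous (dphiE _).
      + by apply: cvg_at_left_filter; exact: isd_continuous (dphiE _).
    - by move=> x _; rewrite derive1E; have h := dphiE x; apply: derive_val.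
  have noc (m : set R -> \bar R) (a b : R) : m set0 = 0%E -> b <= a -> m `]a, b]%classic = 0%E.
    by move=> m0 ba; rewrite set_itv_ge// bnd_simp -leNgt.
  pose m1 : {measure set (measurableTypeR R) -> \bar R} :=
    (measure_function_pushforward__canonical__measure_function_Measure
       (mrestr mu mJ) mpsi').
  pose m2 : {measure set (measurableTypeR R) -> \bar R} := density_measure mu mdphi dphi0.
  move=> mA; change (m1 A = m2 A); move: mA.
  apply: (@measure_unique _ R (measurableTypeR R) (@ocitv R)
    (fun n => `](- n.+1%:R : R), n.+1%:R]%classic) _ _ _ _ m1 m2) => //.
  - exact: ocitvI.
  - by move=> n; exists (- n.+1%:R, n.+1%:R).
  - move=> _ [[a b] _ <-]/=.
    have [ba|ab] := leP b a; last by rewrite [LHS]hint// [RHS]hint'.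
    by rewrite [LHS]noc ?[RHS]noc ?measure0.
  - move=> n; apply: (@le_lt_trans _ _ (phi n.+1%:R - phi (- n.+1%:R))%:E); last exact: ltry.
    by rewrite le_eqVlt; apply/orP; left; apply/eqP; apply: hint; rewrite -subr_gt0 opprK addr_gt0.
have restrE : (\int[mu]_(x in J) f x = \int[mrestr mu mJ]_x (f \o phi \o psi) x)%E.
  rewrite (@ge0_integral_density _ (measurableTypeR R) R mu (mrestr mu mJ) (\1_J)).
  - rewrite [LHS]integral_mkcond; apply: eq_integral => x _; rewrite epatch_indic/= indicE.
    by case: (boolP (x \in J)) => [/set_mem Jx|_] /=; [rewrite psiK|rewrite mulr0n !mule0].
  - exact: measurable_indic.
  - by move=> x; rewrite indicE.
  - by move=> A mA; rewrite /mrestr integral_indic// setIC.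
  - by apply: measurableT_comp => //; exact: measurableT_comp.
  - by move=> x /=.
have mfphi : measurable_fun setT (f \o phi) by exact: measurableT_comp.
have := @ge0_integral_pushforward _ _ (measurableTypeR R) (measurableTypeR R) R
  psi mpsi' (mrestr mu mJ) setT (f \o phi) measurableT mfphi (fun x _ => f0 _).
rewrite preimage_setT -restrE => <-.
rewrite (@eq_measure_integral _ _ _ _ (density_measure mu mdphi dphi0)); last first.
  by move=> A mA _; exact: nuE.
rewrite (@ge0_integral_density _ (measurableTypeR R) R mu _ dphi)// => x; exact: f0.
Qed.

End increasing_substitution.

(** This substitution brings every integral over the half line to the real
    line, where multiplicative convolutions become additive ones. *)
Lemma ge0_integral_expR (f : R -> \bar R) :
  measurable_fun setT f -> (forall x, 0 <= f x)%E ->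
  (\int[mu]_(x in `]0%R, +oo[) f x = \int[mu]_t (f (expR t) * (expR t)%:E))%E.
Proof.
move=> mf f0.
apply: (@ge0_change_of_variables expR expR (fun x => ln x)) => //.
- exact: measurable_ln.
- by move=> t /=; rewrite in_itv/= andbT expR_gt0.
- by move=> x /=; rewrite in_itv/= andbT => x0; rewrite lnK.
- move=> x y z /=; rewrite !in_itv/= !andbT => x0 z0 xy yz; exact: lt_trans xy.
- by move=> s t; rewrite ltr_expR.
- exact: continuous_expR.
Qed.

Lemma ge0_integral_affine (c e : R) (f : R -> \bar R) : 0 < c ->
  measurable_fun setT f -> (forall x, 0 <= f x)%E ->
  (\int[mu]_x f x = \int[mu]_t (f (c * t + e)%R * c%:E))%E.
Proof.
move=> c0 mf f0.
apply: (@ge0_change_of_variables (fun t => c * t + e) (cst c) (fun x => (x - e) / c)) => //.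
- by apply: measurable_funM => //; exact: measurable_funB.
- by move=> x _ /=; field; rewrite gt_eqF.
- by move=> s t st; rewrite ltrD2r ltr_pM2l.
- by move=> t; isd; rewrite mul0r add0r mulr1 addr0.
- by move=> x; exact: cst_continuous.
- by move=> x /=; exact: ltW.
Qed.

Lemma ge0_integral_shift (e : R) (f : R -> \bar R) :
  measurable_fun setT f -> (forall x, 0 <= f x)%E ->
  (\int[mu]_x f x = \int[mu]_t f (t + e)%R)%E.
Proof.
move=> mf f0; rewrite (@ge0_integral_affine 1 e)//; apply: eq_integral => t _.
by rewrite mule1 mul1r.
Qed.

Lemma integral_shift (e : R) (f : R -> R) : measurable_fun setT f ->
  \int[mu]_x f x = \int[mu]_t f (t + e).
Proof.
move=> mf; rewrite /Rintegral; congr fine.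
have mfE : measurable_fun setT (fun x => (f x)%:E) by exact/measurable_EFinP.
rewrite integralE [RHS]integralE; congr (_ - _)%E.
  rewrite [LHS](@ge0_integral_shift e)//.
    by apply: eq_integral => t _; rewrite !funeposE.
  exact: (@measurable_funepos _ _ _ setT).
rewrite [LHS](@ge0_integral_shift e)//.
  by apply: eq_integral => t _; rewrite !funenegE.
exact: (@measurable_funeneg _ _ _ setT).
Qed.

End change_of_variables.

(** * Complex-valued functions *)

Section complex_calculus.
Context {R : realType}.
Local Notation C := R[i].
Local Notation Re := (@complex.Re R).
Local Notation Im := (@complex.Im R).
Local Notation normc := (@ComplexField.Normc.normc R).
Implicit Types (x y z v w : C) (f g : C -> C) (c h : R -> C).

Lemma ReD x y : Re (x + y) = Re x + Re y. Proof. by case: x y => [? ?] []. Qed.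
Lemma ImD x y : Im (x + y) = Im x + Im y. Proof. by case: x y => [? ?] []. Qed.
Lemma ReN x : Re (- x) = - Re x. Proof. by case: x. Qed.
Lemma ImN x : Im (- x) = - Im x. Proof. by case: x. Qed.
Lemma ReM x y : Re (x * y) = Re x * Re y - Im x * Im y.
Proof. by case: x y => [? ?] []. Qed.
Lemma ImM x y : Im (x * y) = Re x * Im y + Im x * Re y.
Proof. by case: x y => [? ?] []. Qed.

Lemma complex_eq x y : Re x = Re y -> Im x = Im y -> x = y.
Proof. by case: x y => [? ?] [? ?] /= -> ->. Qed.

Definition cexp z : C := (expR (Re z) * cos (Im z)) +i* (expR (Re z) * sin (Im z)).

Lemma cexpD x y : cexp (x + y) = cexp x * cexp y.
Proof.
apply: complex_eq; rewrite ?(ReM, ImM) /= ReD ImD expRD ?cosD ?sinD; ring.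
Qed.

Lemma cexp0 : cexp 0 = 1.
Proof. by rewrite /cexp /= expR0 cos0 sin0 mulr1 mulr0. Qed.

Lemma cexp_neq0 x : cexp x != 0.
Proof.
apply/eqP => h; have := cexpD x (- x); rewrite subrr cexp0 h mul0r.
by apply/eqP; rewrite oner_eq0.
Qed.

Lemma cexpN x : cexp (- x) = (cexp x)^-1.
Proof.
apply: (mulfI (cexp_neq0 x)).
by rewrite -cexpD subrr cexp0 divff// cexp_neq0.
Qed.

Lemma normc_cexp z : normc (cexp z) = expR (Re z).
Proof.
rewrite /cexp /= !exprMn -mulrDr cos2Dsin2 mulr1 sqrtr_sqr.
by rewrite ger0_norm// expR_ge0.
Qed.

Lemma normr_Re z : `|Re z| <= normc z.
Proof.
case: z => a b /=; rewrite -sqrtr_sqr ler_wsqrtr// lerDl; exact: sqr_ge0.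
Qed.

Lemma normr_Im z : `|Im z| <= normc z.
Proof.
case: z => a b /=; rewrite -sqrtr_sqr ler_wsqrtr// lerDr; exact: sqr_ge0.
Qed.

Lemma normc_le z : normc z <= `|Re z| + `|Im z|.
Proof.
case: z => a b /=; rewrite -[leRHS]ger0_norm ?addr_ge0// -sqrtr_sqr ler_wsqrtr//.
rewrite sqrrD !real_normK ?num_real// -addrA lerD2l lerDr mulrn_wge0//.
Qed.

Lemma normc_ge0 z : 0 <= normc z.
Proof. by case: z => a b /=; exact: sqrtr_ge0. Qed.

Lemma normc_sqr z : normc z ^+ 2 = Re z ^+ 2 + Im z ^+ 2.
Proof. by case: z => a b /=; rewrite sqr_sqrtr// addr_ge0// sqr_ge0. Qed.

Definition curve_derive c (t : R) v : Prop :=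
  is_derive t 1 (fun s => Re (c s)) (Re v) /\ is_derive t 1 (fun s => Im (c s)) (Im v).

Lemma curve_derive_cst z t : curve_derive (fun=> z) t 0.
Proof. by split; exact: isd_cst. Qed.

Lemma curve_deriveD c h t v w : curve_derive c t v -> curve_derive h t w ->
  curve_derive (fun s => c s + h s) t (v + w).
Proof.
move=> [cr ci] [hr hi]; split.
  by under eq_fun do rewrite ReD; rewrite ReD; exact: isdD.
by under eq_fun do rewrite ImD; rewrite ImD; exact: isdD.
Qed.

Lemma curve_deriveN c t v : curve_derive c t v ->
  curve_derive (fun s => - c s) t (- v).
Proof.
move=> [cr ci]; split.
  by under eq_fun do rewrite ReN; rewrite ReN; exact: isdN.
by under eq_fun do rewrite ImN; rewrite ImN; exact: isdN.
Qed.

Lemma curve_deriveM c h t v w : curve_derive c t v -> curve_derive h t w ->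
  curve_derive (fun s => c s * h s) t (v * h t + c t * w).
Proof.
move=> [cr ci] [hr hi]; split.
  under eq_fun do rewrite ReM.
  by isd; rewrite ReD !ReM; ring.
under eq_fun do rewrite ImM.
by isd; rewrite ImD !ImM; ring.
Qed.

Lemma curve_derive_exp c t v : curve_derive c t v ->
  curve_derive (fun s => cexp (c s)) t (v * cexp (c t)).
Proof.
move=> [cr ci]; split; rewrite ?(ReM, ImM) /=.
  by isd; ring.
by isd; ring.
Qed.

Lemma curve_deriveV c t v : c t != 0 -> curve_derive c t v ->
  curve_derive (fun s => (c s)^-1) t (- v / c t ^+ 2).
Proof.
move=> ct0 [cr ci].
have ReV x : Re x^-1 = Re x / (Re x ^+ 2 + Im x ^+ 2) by case: x.
have ImV x : Im x^-1 = - Im x / (Re x ^+ 2 + Im x ^+ 2).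
  by case: x => a b /=; rewrite mulNr.
have n0 : Re (c t) ^+ 2 + Im (c t) ^+ 2 != 0.
  apply: contra ct0; rewrite paddr_eq0 ?sqr_ge0// !sqrf_eq0 => /andP[/eqP a /eqP b].
  by apply/eqP/complex_eq.
have dn : is_derive t 1 (fun s => (Re (c s) ^+ 2 + Im (c s) ^+ 2)^-1)
    (- (2 * Re (c t) * Re v + 2 * Im (c t) * Im v) / (Re (c t) ^+ 2 + Im (c t) ^+ 2) ^+ 2).
  apply: isdV => //; under eq_fun do rewrite !expr2; by isd; ring.
set a := Re (c t) in n0 dn *; set b := Im (c t) in n0 dn *.
have zE : c t ^+ 2 = (a ^+ 2 - b ^+ 2) +i* (2 * a * b).
  by rewrite expr2; apply: complex_eq; rewrite ?(ReM, ImM) /=; ring.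
have invE : (c t ^+ 2)^-1 = ((a ^+ 2 - b ^+ 2) / (a ^+ 2 + b ^+ 2) ^+ 2) +i*
    (- (2 * a * b) / (a ^+ 2 + b ^+ 2) ^+ 2).
  apply: (mulfI (_ : c t ^+ 2 != 0)); first by rewrite sqrf_eq0.
  rewrite divff ?sqrf_eq0// zE; apply: complex_eq; rewrite ?(ReM, ImM) /=; field.
    exact: n0.
  exact: n0.
rewrite invE; split.
  under eq_fun do rewrite ReV.
  isd; rewrite ReM ReN ImN /=; rewrite -/a -/b; field; exact: n0.
under eq_fun do rewrite ImV.
isd; rewrite ImM ReN ImN /=; rewrite -/a -/b; field; exact: n0.
Qed.

(** Complex differentiability in the form of the chain rule along curves: on
    the coordinate curves of a strip it gives both partial derivatives, with
    the Cauchy-Riemann equations built in. *)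
Definition cdiff f z d : Prop :=
  forall c t v, c t = z -> curve_derive c t v -> curve_derive (fun s => f (c s)) t (d * v).

Lemma cdiff_eq f z d d' : cdiff f z d -> d = d' -> cdiff f z d'.
Proof. by move=> + <-. Qed.

Lemma cdiff_cst x z : cdiff (fun=> x) z 0.
Proof. by move=> c t v _ _; rewrite mul0r; exact: curve_derive_cst. Qed.

Lemma cdiff_id z : cdiff (fun w => w) z 1.
Proof. by move=> c t v _; rewrite mul1r. Qed.

Lemma cdiffD f g z a b : cdiff f z a -> cdiff g z b ->
  cdiff (fun w => f w + g w) z (a + b).
Proof. by move=> hf hg c t v ct h; rewrite mulrDl; apply: curve_deriveD; [exact: hf|exact: hg]. Qed.

Lemma cdiffN f z a : cdiff f z a -> cdiff (fun w => - f w) z (- a).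
Proof. by move=> hf c t v ct h; rewrite mulNr; apply: curve_deriveN; exact: hf. Qed.

Lemma cdiffM f g z a b : cdiff f z a -> cdiff g z b ->
  cdiff (fun w => f w * g w) z (a * g z + f z * b).
Proof.
move=> hf hg c t v ct h; have := curve_deriveM (hf _ _ _ ct h) (hg _ _ _ ct h).
by rewrite ct (_ : a * v * g z + f z * (b * v) = (a * g z + f z * b) * v)//; ring.
Qed.

Lemma cdiff_exp f z a : cdiff f z a -> cdiff (fun w => cexp (f w)) z (a * cexp (f z)).
Proof.
move=> hf c t v ct h; have := curve_derive_exp (hf _ _ _ ct h).
by rewrite ct mulrAC.
Qed.

Lemma cdiffV f z a : f z != 0 -> cdiff f z a ->
  cdiff (fun w => (f w)^-1) z (- a / f z ^+ 2).
Proof.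
move=> fz0 hf c t v ct h.
have fz0' : f (c t) != 0 by rewrite ct.
have := curve_deriveV fz0' (hf _ _ _ ct h).
by rewrite ct mulrAC mulNr mulNr mulNr.
Qed.

Definition pt (t u : R) : C := t +i* u.

Lemma curve_pt_l u t : curve_derive (fun s => pt s u) t 1.
Proof. by split; [exact: isd_id|exact: isd_cst]. Qed.

Lemma curve_pt_r t u : curve_derive (fun s => pt t s) u 'i%C.
Proof. by split; [exact: isd_cst|exact: isd_id]. Qed.

End complex_calculus.

(** * Moving the line of integration in a strip *)

Section strip.
Context {R : realType}.
Local Notation C := R[i].
Local Notation Re := (@complex.Re R).
Local Notation Im := (@complex.Im R).
Local Notation normc := (@ComplexField.Normc.normc R).
Notation mu := (@lebesgue_measure R).

Lemma expR_norm_cvg0 (e : R) : 0 < e ->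
  expR (- (e * `|t|)) @[t --> +oo] --> 0 /\ expR (- (e * `|t|)) @[t --> -oo] --> 0.
Proof.
move=> e0.
have H : expR (- (e * t)) @[t --> +oo] --> 0.
  apply: (cvg_comp (fun t => e * t) (fun x => expR (- x)) _ (@cvgr_expR R)).
  by apply: gt0_cvgMry => //; exact: cvg_id.
have H1 : expR (- (e * `|t|)) @[t --> +oo] --> 0.
  apply: cvg_trans H; apply: near_eq_cvg; near=> t.
  by rewrite ger0_norm.
split => //.
apply/cvgNy_compNP; apply: cvg_trans H1; apply: near_eq_cvg; near=> t.
by rewrite /= normrN.
Unshelve. all: end_near. Qed.

Lemma cvg0_le_expR (g : R -> R) (M e : R) : 0 < e ->
  (forall t, `|g t| <= M * expR (- (e * `|t|))) ->
  g t @[t --> +oo] --> 0 /\ g t @[t --> -oo] --> 0.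
Proof.
move=> e0 gM; have [h1 h2] := expR_norm_cvg0 e0.
have aux (F : set_system R) : Filter F -> expR (- (e * `|t|)) @[t --> F] --> 0 ->
    g t @[t --> F] --> 0.
  move=> FF h; apply: norm_cvg0.
  apply: (squeeze_cvgr (f := cst 0) (h := fun t => M * expR (- (e * `|t|)))).
  - by near=> t; rewrite normr_ge0/= gM.
  - exact: cvg_cst.
  - by rewrite -[X in _ --> X](mulr0 M); exact: cvgMl_tmp.
by split; apply: aux.
Unshelve. all: end_near. Qed.

(** Cauchy's theorem for a strip.  By the Cauchy-Riemann equations the
    derivative in [s] of the integral of [Im f] along the line of height [s] is
    the integral of [Re f'], which is the increment of [Re f] between the two
    ends of the line, hence 0. *)
Lemma strip_integral_const (f f' : C -> C) (u v M e : R) : 0 < e ->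
  (forall t s, u < s -> s < v -> cdiff f (pt t s) (f' (pt t s))) ->
  (forall t s, u < s -> s < v -> normc (f (pt t s)) <= M * expR (- (e * `|t|))) ->
  (forall t s, u < s -> s < v -> normc (f' (pt t s)) <= M * expR (- (e * `|t|))) ->
  (forall s, u < s -> s < v -> continuous (fun t => Re (f' (pt t s)))) ->
  forall s1 s2, u < s1 -> s1 < v -> u < s2 -> s2 < v ->
  \int[mu]_t Im (f (pt t s1)) = \int[mu]_t Im (f (pt t s2)).
Proof.
move=> e0 df fM f'M cf' s1 s2 us1 s1v us2 s2v.
have dl t s (us : u < s) (sv : s < v) :
    curve_derive (fun t => f (pt t s)) t (f' (pt t s)).
  have := df t s us sv (fun t => pt t s) t 1 erefl (curve_pt_l _ _).
  by rewrite mulr1.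
have dr t s (us : u < s) (sv : s < v) :
    is_derive s 1 (fun s => Im (f (pt t s))) (Re (f' (pt t s))).
  have [_] := df t s us sv (fun s => pt t s) s 'i erefl (curve_pt_r _ _).
  by rewrite ImM /= mulr0 mulr1 addr0.
have cIm s (us : u < s) (sv : s < v) : continuous (fun t => Im (f (pt t s))).
  by move=> t; have [_] := dl t s us sv; exact: isd_continuous.
pose G := fun t : R => `|M| * expR (- (e * `|t|)).
have MG t : M * expR (- (e * `|t|)) <= G t.
  by rewrite ler_wpM2r ?expR_ge0// ler_norm.
have G0 t : 0 <= G t by rewrite mulr_ge0// expR_ge0.
have mG : measurable_fun setT G.
  apply: measurable_funM => //; apply: measurableT_comp => //.
  apply: measurable_funN => //; apply: measurable_funM => //; exact: measurable_normr.
have intG : mu.-integrable setT (EFin \o G).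
  by apply: (@integrable_le_expR _ _ `|M| e) => // t; rewrite ger0_norm.
pose J s := \int[mu]_t Im (f (pt t s)).
have intf s (us : u < s) (sv : s < v) : mu.-integrable setT (EFin \o (fun t => Im (f (pt t s)))).
  apply: (@integrable_le_expR _ _ M e) => //.
    by apply: continuous_measurable_fun; exact: cIm.
  by move=> t; apply: le_trans (fM t s us sv); exact: normr_Im.
have int0 s (us : u < s) (sv : s < v) : \int[mu]_t Re (f' (pt t s)) = 0.
  have [h1 h2] := @cvg0_le_expR (fun t => Re (f (pt t s))) M e e0
    (fun t => le_trans (normr_Re _) (fM t s us sv)).
  rewrite -[RHS](subrr 0); refine (integral_derive (fun t => (dl t s us sv).1) _ _ h2 h1).
    exact: cf'.
  apply: (@integrable_le_expR _ _ M e) => //.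
    by apply: continuous_measurable_fun; exact: cf'.
  by move=> t; apply: le_trans (f'M t s us sv); exact: normr_Re.
have dJ s (us : u < s) (sv : s < v) : is_derive s 1 J 0.
  have Is : `]u, v[%classic s by rewrite /= in_itv/= us sv.
  have h1 : forall x, `]u, v[%classic x -> mu.-integrable setT (EFin \o (fun t => Im (f (pt t x)))).
    by move=> x /=; rewrite in_itv/= => /andP[ux xv]; exact: intf.
  have h2 : forall x y, `]u, v[%classic x -> [set: R] y -> derivable ((fun x y => Im (f (pt y x))) ^~ y) x 1.
    by move=> x y /=; rewrite in_itv/= => /andP[ux xv] _; have [] := dr y x ux xv.
  have h3 : forall x y, `]u, v[%classic x -> [set: R] y ->
      `|partial1of2 (fun x y => Im (f (pt y x))) x y| <= G y.
    move=> x y /=; rewrite in_itv/= => /andP[ux xv] _; rewrite /partial1of2 derive1E.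
    rewrite (_ : 'D_1 _ x = Re (f' (pt y x))); last first.
      by have h := dr y x ux xv; apply: derive_val.
    by apply: le_trans (MG y); apply: le_trans (f'M y x ux xv); exact: normr_Re.
  have D := @derivable_under_integral _ _ _ mu (fun x y => Im (f (pt y x))) setT
    measurableT s u v Is h1 h2 G G0 intG h3.
  have DE := @differentiation_under_integral _ _ _ mu (fun x y => Im (f (pt y x))) setT
    measurableT s u v Is h1 h2 G G0 intG h3.
  split => //; rewrite -derive1E DE -(int0 s us sv); apply: eq_Rintegral => t _.
  rewrite /partial1of2 derive1E; by have h := dr t s us sv; apply: derive_val.
wlog le12 : s1 s2 us1 s1v us2 s2v / s1 <= s2.
  move=> W; have [h|/ltW h] := leP s1 s2; first exact: W.
  by apply/esym; exact: W.
have dJ12 x : x \in `]s1, s2[ -> is_derive x 1 J (cst 0 x : R).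
  rewrite in_itv/= => /andP[h1 h2].
  by apply: dJ; [exact: lt_trans h1|exact: lt_trans s2v].
have cJ12 : {within `[s1, s2], continuous J}.
  apply: derivable_within_continuous => x; rewrite in_itv/= => /andP[h1 h2].
  by have [] := dJ x (lt_le_trans us1 h1) (le_lt_trans h2 s2v).
have [c _] := MVT_segment le12 dJ12 cJ12.
by rewrite /= mul0r => /eqP; rewrite subr_eq0 => /eqP.
Qed.

End strip.

(** * The functions exp (k w - x exp (a w)) and 2 sinh (w / 2) *)

Section double_exponential.
Context {R : realType}.
Local Notation C := R[i].
Local Notation Re := (@complex.Re R).
Local Notation Im := (@complex.Im R).
Local Notation normc := (@ComplexField.Normc.normc R).
Implicit Types (k a x t s : R) (w : C).

Definition dexp k a x w : C := cexp (k%:C * w - x%:C * cexp (a%:C * w)).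
Definition dexp' k a x w : C := (k%:C - x%:C * (a%:C * cexp (a%:C * w))) * dexp k a x w.
(** This is 2 sinh (w / 2). *)
Definition twosinh w : C := cexp ((2^-1)%:C * w) - cexp (- ((2^-1)%:C * w)).
Definition twosinh' w : C := (2^-1)%:C * (cexp ((2^-1)%:C * w) + cexp (- ((2^-1)%:C * w))).

Lemma cdiff_scale (c : C) w : cdiff (fun z => c * z) w c.
Proof.
apply: cdiff_eq; first by apply: cdiffM; [exact: cdiff_cst|exact: cdiff_id].
by rewrite mul0r add0r mulr1.
Qed.

Lemma cdiff_dexp k a x w : cdiff (dexp k a x) w (dexp' k a x w).
Proof.
apply: cdiff_eq; first apply: cdiff_exp.
  apply: cdiffD; first exact: cdiff_scale.
  apply/cdiffN/cdiffM; first exact: cdiff_cst.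
  apply: cdiff_exp; exact: cdiff_scale.
by rewrite mul0r add0r.
Qed.

Lemma cdiff_dexp' k a x w : exists d, cdiff (dexp' k a x) w d.
Proof.
eexists; apply: cdiffM; last exact: cdiff_dexp.
apply: cdiffD; first exact: cdiff_cst.
apply/cdiffN/cdiffM; first exact: cdiff_cst.
apply: cdiffM; first exact: cdiff_cst.
apply: cdiff_exp; exact: cdiff_scale.
Qed.

Lemma cdiff_twosinh w : cdiff twosinh w (twosinh' w).
Proof.
apply: cdiff_eq.
  apply: cdiffD; first by apply: cdiff_exp; exact: cdiff_scale.
  by apply/cdiffN/cdiff_exp/cdiffN; exact: cdiff_scale.
by rewrite /twosinh'; ring.
Qed.

Lemma cdiff_twosinh' w : exists d, cdiff twosinh' w d.
Proof.
eexists; apply: cdiffM; first exact: cdiff_cst.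
apply: cdiffD; first by apply: cdiff_exp; exact: cdiff_scale.
by apply/cdiff_exp/cdiffN; exact: cdiff_scale.
Qed.

Lemma Re_scale (c : R) w : Re (c%:C * w) = c * Re w.
Proof. by rewrite ReM /= mul0r subr0. Qed.

Lemma Im_scale (c : R) w : Im (c%:C * w) = c * Im w.
Proof. by rewrite ImM /= mul0r addr0. Qed.

Lemma normc_scale (c : R) w : normc (c%:C * w) = `|c| * normc w.
Proof. by rewrite ComplexField.Normc.normcM /= expr0n/= addr0 sqrtr_sqr. Qed.

Lemma normcD_le (z w : C) : normc (z + w) <= normc z + normc w.
Proof. exact: (@le_normcD R). Qed.

Lemma normcNE w : normc (- w) = normc w. Proof. exact: (@normcN R). Qed.

Lemma Re_cexp w : Re (cexp w) = expR (Re w) * cos (Im w). Proof. by []. Qed.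
Lemma Im_cexp w : Im (cexp w) = expR (Re w) * sin (Im w). Proof. by []. Qed.
Lemma Re_pt t s : Re (pt t s) = t. Proof. by []. Qed.
Lemma Im_pt t s : Im (pt t s) = s. Proof. by []. Qed.
Definition cE := (@ReD R, @ImD R, @ReN R, @ImN R, Re_scale, Im_scale, Re_cexp, Im_cexp, Re_pt, Im_pt).

Lemma normc_dexp k a x t s :
  normc (dexp k a x (pt t s)) = expR (k * t - x * (expR (a * t) * cos (a * s))).
Proof. by rewrite normc_cexp !cE. Qed.

Lemma normc_dexp_le k a x t s : 0 <= x -> 0 <= cos (a * s) ->
  normc (dexp k a x (pt t s)) <= expR (k * t).
Proof.
move=> x0 c0; rewrite normc_dexp ler_expR gerDl oppr_le0.
by rewrite !mulr_ge0// expR_ge0.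
Qed.

(** The factor exp (a t) produced by differentiation is absorbed by
    exp (- x c exp (a t)), because y exp (- y) is bounded. *)
Lemma normc_dexp'_le k a x t s c : 0 <= x -> 0 <= a -> 0 < c -> c <= cos (a * s) ->
  normc (dexp' k a x (pt t s)) <= (`|k| + a / c) * expR (k * t).
Proof.
move=> x0 a0 c0 cc; have cos0 : 0 <= cos (a * s) by exact: le_trans (ltW c0) cc.
rewrite /dexp' mulrDl (le_trans (normcD_le _ _))// mulrDl lerD//.
  by rewrite normc_scale ler_wpM2l// normc_dexp_le.
rewrite mulNr normcNE -mulrA normc_scale -mulrA normc_scale.
rewrite ComplexField.Normc.normcM normc_cexp !cE normc_dexp !ger0_norm//.
set y := expR (a * t); have y0 : 0 < y by exact: expR_gt0.
have h : x * y * expR (- (x * (y * cos (a * s)))) <= c^-1.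
  have xy0 : 0 <= x * y by rewrite mulr_ge0// ltW.
  rewrite -[leRHS]mul1r ler_pdivlMr// expRN mulrAC ler_pdivrMr ?expR_gt0// mul1r.
  apply: (@le_trans _ _ (1 + x * y * c)); first by rewrite lerDr.
  apply: le_trans (expR_ge1Dx _) _; rewrite ler_expR mulrA.
  by rewrite ler_wpM2l.
rewrite expRD [leLHS](_ : _ = a * (x * y * expR (- (x * (y * cos (a * s))))) * expR (k * t)).
  by rewrite ler_wpM2r ?expR_ge0// ler_wpM2l.
by ring.
Qed.

Lemma normc_twosinh t s :
  normc (twosinh (pt t s)) ^+ 2 = expR t + expR (- t) - 2 * cos s.
Proof.
rewrite normc_sqr !cE.
have e2 : expR (2^-1 * t) * expR (- (2^-1 * t)) = 1 by rewrite -expRD subrr expR0.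
have e1 (r : R) : expR r = expR (2^-1 * r) ^+ 2.
  by rewrite expr2 -expRD; congr expR; field.
rewrite (e1 t) (e1 (- t)) mulrN cosN sinN.
have -> : cos s = cos (2^-1 * s) ^+ 2 - sin (2^-1 * s) ^+ 2.
  by rewrite -[in LHS](_ : 2^-1 * s + 2^-1 * s = s) ?cosD ?expr2//; field.
have c2 := cos2Dsin2 (2^-1 * s).
set E1 := expR (2^-1 * t) in e2 *; set E2 := expR (- (2^-1 * t)) in e2 *.
set c := cos _ in c2 *; set d := sin _ in c2 *.
have -> : (E1 * c - E2 * c) ^+ 2 + (E1 * d - E2 * - d) ^+ 2 =
  (E1 ^+ 2 + E2 ^+ 2) * (c ^+ 2 + d ^+ 2) - 2 * (E1 * E2) * (c ^+ 2 - d ^+ 2) by ring.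
by rewrite c2 e2 !mulr1.
Qed.

Lemma expR_add_ge_norm t : expR `|t| <= expR t + expR (- t).
Proof.
by case: (ger0P t) => _; rewrite ?lerDl ?lerDr expR_ge0.
Qed.

(** The growth exp (|t| / 2) is what makes the quotient by [twosinh] integrable
    for all exponents [k] with [|k| < 1 / 2]. *)
Lemma normc_twosinh_ge t s c : cos s <= c -> 0 <= c -> c <= 1 ->
  Num.sqrt (1 - c) * expR (2^-1 * `|t|) <= normc (twosinh (pt t s)).
Proof.
move=> sc cge0 c1; have c0 : 0 <= 1 - c by rewrite subr_ge0.
rewrite -(@ler_pXn2r _ 2) ?nnegrE ?normc_ge0 ?mulr_ge0 ?expR_ge0 ?sqrtr_ge0//.
rewrite normc_twosinh exprMn sqr_sqrtr// expr2 -expRD.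
rewrite (_ : 2^-1 * `|t| + 2^-1 * `|t| = `|t|); last by field.
have h2 : 2 <= expR t + expR (- t).
  have e2 : expR t * expR (- t) = 1 by rewrite -expRD subrr expR0.
  have := sqr_ge0 (expR t - 1); have := expR_gt0 t; have := expR_gt0 (- t).
  nra.
have h3 := expR_add_ge_norm t; have h4 := expR_ge0 `|t|.
have h5 := cos_geN1 s.
set A := expR t + _ in h2 h3 *; set B := expR `|t| in h3 h4 *.
have : (1 - c) * B <= (1 - c) * A by rewrite ler_wpM2l.
have : c * 2 <= c * A by rewrite ler_wpM2l.
by lra.
Qed.

Lemma normc_twosinh'_le t s : normc (twosinh' (pt t s)) <= expR (2^-1 * `|t|).
Proof.
rewrite normc_scale ger0_norm ?invr_ge0//.
have h : normc (cexp ((2^-1)%:C * pt t s) + cexp (- ((2^-1)%:C * pt t s))) <=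
   expR (2^-1 * `|t|) + expR (2^-1 * `|t|).
  rewrite (le_trans (normcD_le _ _))// !normc_cexp !cE.
  by rewrite lerD// ler_expR -?mulrN ler_wpM2l ?invr_ge0// ?ler_norm// -normrN ler_norm.
by move: h; lra.
Qed.

End double_exponential.

(** * Their quotient on horizontal lines *)

Section quotient.
Context {R : realType}.
Local Notation C := R[i].
Local Notation Re := (@complex.Re R).
Local Notation Im := (@complex.Im R).
Local Notation normc := (@ComplexField.Normc.normc R).
Notation mu := (@lebesgue_measure R).
Implicit Types (k a x t s : R) (w : C).

Lemma cdiff_continuous (f : C -> C) (s : R) : (forall t, exists d, cdiff f (pt t s) d) ->
  continuous (fun t => Re (f (pt t s))) /\ continuous (fun t => Im (f (pt t s))).
Proof.
move=> h; split => t; have [d hd] := h t;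
  have [h1 h2] := hd (fun t => pt t s) t 1 erefl (curve_pt_l _ _);
  [exact: isd_continuous h1|exact: isd_continuous h2].
Qed.

Lemma expR_weight k t : `|k| < 2^-1 ->
  expR (k * t) * expR (- (2^-1 * `|t|)) <= expR (- ((2^-1 - `|k|) * `|t|)).
Proof.
move=> k2; rewrite -expRD ler_expR mulrBl opprB lerD2r -normrM.
exact: ler_norm.
Qed.

Definition dexp_sinh k a x w : C := dexp k a x w * (twosinh w)^-1.

Section quotient_bounds.
Variables (k a x u v c0 c1 : R).
Hypotheses (k2 : `|k| < 2^-1) (a0 : 0 <= a) (x0 : 0 <= x)
  (c0_ge0 : 0 <= c0) (c0_lt1 : c0 < 1) (c1_gt0 : 0 < c1).
Hypothesis cosc0 : forall s, u < s -> s < v -> cos s <= c0.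
Hypothesis cosc1 : forall s, u < s -> s < v -> c1 <= cos (a * s).
Local Notation e := (2^-1 - `|k|).
Local Notation r := (Num.sqrt (1 - c0)).

Let r_gt0 : 0 < r. Proof. by rewrite sqrtr_gt0 subr_gt0. Qed.

Let S_ge t s : u < s -> s < v -> r * expR (2^-1 * `|t|) <= normc (twosinh (pt t s)).
Proof. by move=> us sv; apply: normc_twosinh_ge; [exact: cosc0| |exact: ltW]. Qed.

Let S_neq0 t s : u < s -> s < v -> twosinh (pt t s) != 0.
Proof.
move=> us sv; apply/eqP => S0; have := S_ge t us sv.
rewrite S0 ComplexField.Normc.normc0 leNgt => /negP; apply.
by rewrite mulr_gt0// expR_gt0.
Qed.

Let SV_le t s : u < s -> s < v ->
  normc (twosinh (pt t s))^-1 <= r^-1 * expR (- (2^-1 * `|t|)).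
Proof.
move=> us sv; rewrite ComplexField.Normc.normcV expRN -invfM lef_pV2 ?S_ge//.
  rewrite posrE (lt_le_trans _ (S_ge t us sv))// mulr_gt0// expR_gt0.
by rewrite posrE mulr_gt0// expR_gt0.
Qed.

Let E_le t s : u < s -> s < v -> normc (dexp k a x (pt t s)) <= expR (k * t).
Proof.
by move=> us sv; apply: normc_dexp_le => //; apply: le_trans (cosc1 us sv); exact: ltW.
Qed.

Lemma normc_dexp_sinh_le t s : u < s -> s < v ->
  normc (dexp_sinh k a x (pt t s)) <= r^-1 * expR (- (e * `|t|)).
Proof.
move=> us sv; rewrite ComplexField.Normc.normcM.
apply: le_trans (ler_pM (normc_ge0 _) (normc_ge0 _) (E_le t us sv) (SV_le t us sv)) _.
by rewrite mulrCA ler_wpM2l ?invr_ge0 ?(ltW r_gt0)// expR_weight.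
Qed.

Definition dexp_sinh' w : C := dexp' k a x w * (twosinh w)^-1 +
  dexp k a x w * (- twosinh' w / twosinh w ^+ 2).

Lemma cdiff_dexp_sinh t s : u < s -> s < v -> cdiff (dexp_sinh k a x) (pt t s) (dexp_sinh' (pt t s)).
Proof.
move=> us sv; apply: cdiffM; first exact: cdiff_dexp.
by apply: cdiffV; [exact: S_neq0|exact: cdiff_twosinh].
Qed.

Lemma cdiff_dexp_sinh' t s : u < s -> s < v -> exists d, cdiff dexp_sinh' (pt t s) d.
Proof.
move=> us sv; have [d1 h1] := cdiff_dexp' k a x (pt t s).
have [d2 h2] := cdiff_twosinh' (pt t s).
have h3 := @cdiff_twosinh R (pt t s).
have h4 := @cdiff_dexp R k a x (pt t s).
have S0 := S_neq0 t us sv.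
eexists; apply: cdiffD; first by apply: cdiffM; [exact: h1|apply: cdiffV; [|exact: h3]].
apply: cdiffM; first exact: h4.
apply: cdiffM; first by apply: cdiffN; exact: h2.
apply: cdiffV; first by rewrite sqrf_eq0.
by apply: (@cdiffM R twosinh twosinh); exact: h3.
Qed.

Definition dexp_sinh_bound := r^-1 + (`|k| + a / c1) * r^-1 + r^-1 * r^-1.

Lemma normc_dexp_sinh'_le t s : u < s -> s < v ->
  normc (dexp_sinh' (pt t s)) <= dexp_sinh_bound * expR (- (e * `|t|)).
Proof.
move=> us sv; rewrite /dexp_sinh'; apply: le_trans (normcD_le _ _) _.
have W := expR_weight t k2.
set G := expR (- (e * `|t|)) in W *.
have G0 : 0 <= G by exact: expR_ge0.
have rV0 : 0 <= r^-1 by rewrite invr_ge0 ltW.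
have b1 : normc (dexp' k a x (pt t s) * (twosinh (pt t s))^-1) <=
    (`|k| + a / c1) * r^-1 * G.
  rewrite ComplexField.Normc.normcM.
  have hh := normc_dexp'_le k t x0 a0 c1_gt0 (cosc1 us sv).
  apply: le_trans (ler_pM (normc_ge0 _) (normc_ge0 _) hh (SV_le t us sv)) _.
  rewrite mulrACA; apply: ler_wpM2l => //.
  by apply: mulr_ge0 => //; apply: addr_ge0 => //; apply: divr_ge0 => //; exact: ltW.
have b2 : normc (dexp k a x (pt t s) * (- twosinh' (pt t s) / twosinh (pt t s) ^+ 2)) <=
    r^-1 * r^-1 * G.
  rewrite expr2 invfM mulNr mulrN normcNE !ComplexField.Normc.normcM.
  have h1 : normc (twosinh' (pt t s)) * normc (twosinh (pt t s))^-1 <= r^-1.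
    apply: le_trans (ler_pM (normc_ge0 _) (normc_ge0 _)
      (normc_twosinh'_le t s) (SV_le t us sv)) _.
    by rewrite mulrCA -expRD subrr expR0 mulr1.
  have h2 := ler_pM (normc_ge0 _) (normc_ge0 _) (E_le t us sv) (SV_le t us sv).
  have h3 : expR (k * t) * (r^-1 * expR (- (2^-1 * `|t|))) <= r^-1 * G.
    by rewrite mulrCA; apply: ler_wpM2l.
  have h4 := le_trans h2 h3.
  have := ler_pM (mulr_ge0 (normc_ge0 _) (normc_ge0 _)) (mulr_ge0 (normc_ge0 _) (normc_ge0 _)) h4 h1.
  rewrite [X in _ <= X -> _](_ : _ = r^-1 * r^-1 * G); last by ring.
  move=> hh; apply: le_trans hh; rewrite le_eqVlt; apply/orP; left; apply/eqP.
  by rewrite /twosinh' ?ComplexField.Normc.normcM; ring.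
by apply: le_trans (lerD b1 b2) _; rewrite -mulrDl ler_wpM2r// /dexp_sinh_bound -addrA lerDr.
Qed.

Lemma integrable_dexp_sinh s : u < s -> s < v ->
  mu.-integrable setT (EFin \o (fun t => Im (dexp_sinh k a x (pt t s)))).
Proof.
move=> us sv; apply: (@integrable_le_expR _ _ r^-1 e); first by rewrite subr_gt0.
  apply: continuous_measurable_fun.
  by apply: (proj2 (cdiff_continuous _)) => t; eexists; exact: cdiff_dexp_sinh.
by move=> t; apply: le_trans (normr_Im _) _; exact: normc_dexp_sinh_le.
Qed.

(** Between the heights [u] and [v], [c0 < 1] keeps away from the pole at the
    origin, and [0 < c1] from the directions in which exp (- x exp (a w)) is
    unbounded. *)
Lemma dexp_sinh_integral_const s1 s2 : u < s1 -> s1 < v -> u < s2 -> s2 < v ->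
  \int[mu]_t Im (dexp_sinh k a x (pt t s1)) = \int[mu]_t Im (dexp_sinh k a x (pt t s2)).
Proof.
have e0 : 0 < e by rewrite subr_gt0.
apply: (strip_integral_const (f := dexp_sinh k a x) (f' := dexp_sinh') (u := u) (v := v)
  (M := dexp_sinh_bound) (e := e)) => //.
- by move=> t s us sv; exact: cdiff_dexp_sinh.
- move=> t s us sv; apply: le_trans (normc_dexp_sinh_le t us sv) _.
  rewrite ler_wpM2r ?expR_ge0// /dexp_sinh_bound -addrA lerDl.
  have rV0 : 0 <= r^-1 by rewrite invr_ge0 ltW.
  by rewrite addr_ge0// mulr_ge0// addr_ge0// divr_ge0// ltW.
- by move=> t s us sv; exact: normc_dexp_sinh'_le.
- by move=> s us sv; apply: (proj1 (cdiff_continuous _)) => t; exact: cdiff_dexp_sinh'.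
Qed.

End quotient_bounds.
End quotient.

(** * The half-residue at the origin *)

Section inverse_sinh.
Context {R : realType}.
Local Notation C := R[i].
Local Notation Im := (@complex.Im R).
Notation mu := (@lebesgue_measure R).
Implicit Types (k a x t s : R) (w : C).

Lemma ler_cos_pi s t : 0 <= s -> s <= t -> t <= pi -> cos t <= cos s :> R.
Proof.
move=> s0; rewrite le_eqVlt => /predU1P[->//|st] tpi.
apply/ltW; rewrite ltr_cos// in_itv/= ?s0 ?tpi ?(le_trans s0 (ltW st))//.
by rewrite (le_trans (ltW st)).
Qed.

Lemma cos_le_sym s u : 0 <= u -> u <= s -> s <= pi *+ 2 - u -> cos s <= cos u :> R.
Proof.
move=> u0 us su; case: (leP s pi) => [spi|pis]; first exact: ler_cos_pi.
rewrite (_ : cos s = cos (pi *+ 2 - s)); last by rewrite cosB cos2pi sin2pi mul1r mul0r addr0.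
apply: ler_cos_pi => //; first by move: su; lra.
by move: pis; lra.
Qed.

(** On the line of height [pi] the quotient is 1 / (2 i cosh (t / 2)), which has
    an arctangent as primitive; the other lines follow by moving the line. *)
Lemma integral_inv_twosinh s : 0 < s -> s <= pi ->
  \int[mu]_t Im (dexp_sinh 0 0 0 (pt t s)) = - pi.
Proof.
move=> s0 spi; have p0 := pi_gt0 R.
have c1 : cos (s / 2) < 1.
  have h0 : (0 : R) \in `[0, pi] by rewrite in_itv/= lexx ltW.
  have hs : s / 2 \in `[0, pi] by rewrite in_itv/=; apply/andP; split; lra.
  by rewrite -[ltRHS](cos0 R) ltr_cos//; lra.
have cge0 : 0 <= cos (s / 2).
  by apply: cos_ge0_pihalf; apply/andP; split; move: spi s0 p0; lra.
rewrite (@dexp_sinh_integral_const _ 0 0 0 (s / 2) (pi *+ 2 - s / 2) (cos (s / 2)) 1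
  _ _ _ _ _ _ _ _ s pi); rewrite ?normr0 ?invr_gt0//.
- pose A t := expR (2^-1 * t) + expR (- (2^-1 * t)).
  have A0 t : 0 < A t by rewrite addr_gt0// expR_gt0.
  have SE t : twosinh (pt t pi) = 0 +i* A t.
    apply: complex_eq; rewrite !cE /= (mulrC 2^-1 pi) ?cosN ?sinN.
      by rewrite cos_pihalf !mulr0 subrr.
    by rewrite sin_pihalf !mulr1 mulrN1 opprK.
  have qE t : Im (dexp_sinh 0 0 0 (pt t pi)) = - (A t)^-1.
    rewrite /dexp_sinh /dexp (_ : 0%:C = 0)// !mul0r subr0 cexp0 mul1r SE /=.
    by field; rewrite gt_eqF.
  under eq_Rintegral do rewrite qE.
  have dF (t : R) : is_derive t 1 (fun t => - (2 * atan (expR (2^-1 * t)))) (- (A t)^-1).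
    isd; rewrite /A expRN; field.
    have := expR_gt0 (2^-1 * t); set y := expR _ => y0.
    by apply/andP; split; rewrite gt_eqF//; nra.
  rewrite -[RHS]subr0.
  apply: (integral_derive dF).
  + move=> t; apply: (@isd_continuous _ _ _ (- (- (2^-1 * expR (2^-1 * t) - 2^-1 * expR (- (2^-1 * t))) / A t ^+ 2))).
    apply: isdN; apply: isdV; first by rewrite gt_eqF.
    by isd; ring.
  + apply: (@integrable_le_expR _ _ 1 2^-1); first by rewrite invr_gt0.
      apply: continuous_measurable_fun => t.
      apply: (@isd_continuous _ _ _ (- (- (2^-1 * expR (2^-1 * t) - 2^-1 * expR (- (2^-1 * t))) / A t ^+ 2))).
      apply: isdN; apply: isdV; first by rewrite gt_eqF.
      by isd; ring.
    move=> t; rewrite normrN ger0_norm ?invr_ge0 ?(ltW (A0 t))// mul1r expRN lef_pV2 ?posrE ?expR_gt0//.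
    rewrite /A; case: (ger0P t) => _; rewrite ?mulrN ?lerDl ?lerDr expR_ge0//.
  + rewrite -oppr0; apply: cvgN; rewrite -[X in _ --> X](mulr0 2); apply: cvgMl_tmp.
    rewrite -(@atan0 R).
    apply: (cvg_comp (fun t => expR (2^-1 * t)) atan); last exact: continuous_atan.
    apply/cvgNy_compNP.
    rewrite (_ : _ \o _ = fun t => expR (- (2^-1 * t))); last by apply/funext => t /=; rewrite mulrN.
    apply: (cvg_comp (fun t => 2^-1 * t) (fun x => expR (- x)) _ (@cvgr_expR R)).
    by apply: gt0_cvgMry => //; exact: cvg_id.
  + apply: cvgN; rewrite [X in _ --> X](_ : _ = 2 * (pi / 2)); last by field.
    apply: cvgMl_tmp.
    apply: (cvg_comp (fun t => expR (2^-1 * t)) atan _ (@cvgy_atan R)).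
    apply/cvgryPge => B; near=> t.
    apply: (@le_trans _ _ (1 + 2^-1 * t)); last exact: expR_ge1Dx.
    have : B * 2 <= t by near: t; apply: nbhs_pinfty_ge; exact: num_real.
    by lra.
- by move=> s' h1 h2; apply: cos_le_sym; [move: s0; lra|exact: ltW|exact: ltW].
- by move=> s' _ _; rewrite mul0r cos0.
- by move: s0; lra.
- by move: s0 spi; lra.
- by move: s0 spi p0; lra.
- by move: s0 spi p0; lra.
Unshelve. all: end_near. Qed.

End inverse_sinh.

Section near_the_pole.
Context {R : realType}.
Local Notation C := R[i].
Local Notation Re := (@complex.Re R).
Local Notation Im := (@complex.Im R).
Local Notation normc := (@ComplexField.Normc.normc R).
Implicit Types (k a x t s : R) (w : C).

(** The factor 2 comes from bounding the real and imaginary parts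
    separately. *)
Lemma curve_mean_value (c c' : R -> C) (p q K : R) : p <= q ->
  (forall y, curve_derive c y (c' y)) ->
  (forall y, p <= y -> y <= q -> normc (c' y) <= K) ->
  normc (c q - c p) <= 2 * K * (q - p).
Proof.
move=> pq dc cK; apply: le_trans (normc_le _) _.
have aux (g dg : R -> R) : (forall y : R, is_derive y 1 g (dg y)) ->
    (forall y, p <= y -> y <= q -> `|dg y| <= K) -> `|g q - g p| <= K * (q - p).
  move=> dgE gK.
  have cg : {within `[p, q], continuous g}.
    by apply: continuous_subspaceT => y; exact: isd_continuous (dgE y).
  have [y] := @MVT_segment _ g dg p q pq (fun y _ => dgE y) cg.
  rewrite in_itv/= => /andP[py yq] ->.
  by rewrite normrM (ger0_norm (_ : 0 <= q - p)) ?subr_ge0// ler_wpM2r ?subr_ge0// gK.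
have h1 := aux (fun y => Re (c y)) (fun y => Re (c' y)) (fun y => (dc y).1)
  (fun y py yq => le_trans (normr_Re _) (cK y py yq)).
have h2 := aux (fun y => Im (c y)) (fun y => Im (c' y)) (fun y => (dc y).2)
  (fun y py yq => le_trans (normr_Im _) (cK y py yq)).
rewrite !cE; apply: le_trans (lerD h1 h2) _.
by rewrite le_eqVlt; apply/orP; left; apply/eqP; ring.
Qed.

Lemma dexp_origin k a x : dexp k a x (pt 0 0) = (expR (- x))%:C.
Proof.
apply: complex_eq; rewrite !cE /= !(mulr0, expR0, cos0, sin0, mulr1, add0r, subr0)//.
by rewrite oppr0 cos0 mulr1.
by rewrite oppr0 sin0 mulr0.
Qed.

Section lipschitz.
Variables (k a x phi c1 : R).
Hypotheses (k2 : `|k| < 2^-1) (a0 : 0 <= a) (x0 : 0 <= x) (c1_gt0 : 0 < c1).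
Hypothesis cosc1 : forall s, 0 <= s -> s <= phi -> c1 <= cos (a * s).
Local Notation K := ((`|k| + a / c1) * expR 1).

Lemma dexp_lipschitz t s : `|t| <= 1 -> 0 <= s -> s <= phi ->
  normc (dexp k a x (pt t s) - dexp k a x (pt 0 0)) <= 2 * K * (`|t| + s).
Proof.
move=> t1 s0 sphi; have phi0 := le_trans s0 sphi.
have EK y z : `|y| <= 1 -> 0 <= z -> z <= phi -> normc (dexp' k a x (pt y z)) <= K.
  move=> y1 z0 zphi; apply: le_trans (normc_dexp'_le k y x0 a0 c1_gt0 (cosc1 z0 zphi)) _.
  rewrite ler_wpM2l ?addr_ge0 ?divr_ge0 ?(ltW c1_gt0)// ler_expR.
  apply: le_trans (ler_norm _) _; rewrite normrM.
  have : `|k| <= 1 by move: k2; lra.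
  by move=> k1; rewrite -[leRHS]mulr1 ler_pM.
have dl z y : curve_derive (fun y => dexp k a x (pt y z)) y (dexp' k a x (pt y z)).
  by have := @cdiff_dexp _ k a x (pt y z) (fun y => pt y z) y 1 erefl (curve_pt_l _ _); rewrite mulr1.
have dr y z : curve_derive (fun z => dexp k a x (pt y z)) z (dexp' k a x (pt y z) * 'i).
  exact: (@cdiff_dexp _ k a x (pt y z) (fun z => pt y z) z 'i erefl (curve_pt_r _ _)).
have h1 : normc (dexp k a x (pt t s) - dexp k a x (pt t 0)) <= 2 * K * s.
  rewrite -[X in _ * X]subr0; apply: (curve_mean_value s0 (dr t)) => z z0 zs.
  rewrite ComplexField.Normc.normcM (_ : normc 'i = 1) ?mulr1; last first.
    by rewrite /= expr0n/= expr1n add0r sqrtr1.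
  by apply: EK => //; exact: le_trans zs sphi.
have h2 : normc (dexp k a x (pt t 0) - dexp k a x (pt 0 0)) <= 2 * K * `|t|.
  case: (ger0P t) t1 => [t0|/ltW t0] t1.
    rewrite -[X in _ * X]subr0; apply: (curve_mean_value t0 (dl 0)) => y y0 yt.
    by apply: EK => //; rewrite ger0_norm// (le_trans yt).
  rewrite -normcNE opprB -[X in _ * X]add0r; apply: (curve_mean_value t0 (dl 0)) => y y0 yt.
  by apply: EK => //; rewrite ler0_norm//; move: t1 y0; lra.
rewrite mulrDr [leRHS]addrC; apply: le_trans _ (lerD h1 h2).
apply: le_trans _ (normcD_le _ _); rewrite le_eqVlt; apply/orP; left; apply/eqP.
by congr (normc _); ring.
Qed.

End lipschitz.

(** A bound below by a multiple of [|w|] near the pole: with [dexp_lipschitz] it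
    bounds the quotient, once its singular part is removed, up to the real
    axis. *)
Lemma twosinh_lower t s : `|t| <= 1 -> 0 <= s -> s <= 1 ->
  expR (- 1) * `|t| <= normc (twosinh (pt t s)) /\ cos 1 * s <= normc (twosinh (pt t s)).
Proof.
move=> t1 s0 s1; split.
  wlog t0 : t t1 / 0 <= t.
    move=> W; case: (leP 0 t) => [|/ltW t0]; first exact: W.
    have := W (- t); rewrite normrN oppr_ge0 => /(_ t1 t0) h; apply: le_trans h _.
    rewrite -(@ler_pXn2r _ 2) ?nnegrE ?normc_ge0// !normc_twosinh opprK.
    by rewrite (addrC (expR t)).
  rewrite ger0_norm// -(@ler_pXn2r _ 2) ?nnegrE ?normc_ge0 ?mulr_ge0 ?expR_ge0//.
  rewrite normc_twosinh.
  apply: (@le_trans _ _ (expR t + expR (- t) - 2)); last first.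
    by have := cos_le1 s; lra.
  have e2 : expR t * expR (- t) = 1 by rewrite -expRD subrr expR0.
  have h1 : expR (- 1) <= expR (- t) by rewrite ler_expR lerN2; move: t1; rewrite ger0_norm.
  have h2 := expR_ge1Dx t; have h3 := @expR_gt0 R (- 1).
  have h4 : expR (- t) <= 1 by rewrite expR_le1 oppr_le0.
  set u := expR (- t) in e2 h1 h4 *; set v := expR t in e2 h2 *; set w := expR (- 1) in h1 h3 *.
  rewrite (_ : v + u - 2 = u * (v - 1) ^+ 2); last first.
    rewrite (_ : u * (v - 1) ^+ 2 = (v * u) * v - 2 * (v * u) + u); last by ring.
    by rewrite e2; ring.
  have hv2 : t <= v - 1 by lra.
  have hv : 0 <= v - 1 by exact: le_trans hv2.
  have h5 : t ^+ 2 <= (v - 1) ^+ 2 by rewrite ler_pXn2r ?nnegrE.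
  have h6 : w ^+ 2 <= u by rewrite expr2; nra.
  by rewrite exprMn ler_pM ?sqr_ge0.
rewrite -(@ler_pXn2r _ 2) ?nnegrE ?normc_ge0 ?mulr_ge0 ?(ltW (cos1_gt0 R))//.
rewrite normc_twosinh.
have e2 : expR t * expR (- t) = 1 by rewrite -expRD subrr expR0.
have h2 : 2 <= expR t + expR (- t).
  by have := sqr_ge0 (expR t - 1); have := expR_gt0 t; have := expR_gt0 (- t); nra.
have h3 : 2 - 2 * cos s = 4 * sin (s / 2) ^+ 2.
  rewrite -[X in cos X](_ : s / 2 + s / 2 = s); last by field.
  rewrite cosD.
  by have := cos2Dsin2 (s / 2); rewrite !expr2; lra.
have h4 : cos 1 * (s / 2) <= sin (s / 2).
  have s20 : 0 <= s / 2 by move: s0; lra.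
  have cs : {within `[0, s / 2], continuous (@sin R)}.
    by apply: continuous_subspaceT => y; exact: continuous_sin.
  have [y] := @MVT_segment _ (@sin R) (@cos R) 0 (s / 2) s20 (fun y _ => is_derive_sin y) cs.
  rewrite sin0 !subr0 in_itv/= => /andP[y0 ys] ->.
  rewrite ler_wpM2r//; apply: ler_cos_pi => //; first by move: ys s1; lra.
  by have := pi_ge2 R; lra.
have c1 := cos1_gt0 R.
have h5 : (cos 1 * (s / 2)) ^+ 2 <= sin (s / 2) ^+ 2.
  rewrite ler_pXn2r// nnegrE; first by rewrite mulr_ge0 ?(ltW c1)// divr_ge0.
  by apply: le_trans h4; rewrite mulr_ge0 ?(ltW c1)// divr_ge0.
have -> : (cos 1 * s) ^+ 2 = 4 * (cos 1 * (s / 2)) ^+ 2 by field.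
by move: h2 h3 h5; lra.
Qed.

End near_the_pole.

Section half_residue.
Context {R : realType}.
Local Notation C := R[i].
Local Notation Im := (@complex.Im R).
Local Notation normc := (@ComplexField.Normc.normc R).
Notation mu := (@lebesgue_measure R).
Implicit Types (k a x t s : R) (w : C).

(** An open strip around the lines of heights [s] and [phi] on which all the
    estimates for the quotient are uniform. *)
Lemma strip_params a phi s : 0 <= a -> phi <= pi -> a * phi < pi / 2 ->
    0 < s -> s <= phi ->
  exists u v c0 c1, [/\ [/\ u < s, s < v, u < phi & phi < v],
    [/\ 0 <= c0, c0 < 1 & 0 < c1],
    (forall y : R, u < y -> y < v -> cos y <= c0) &
    (forall y : R, u < y -> y < v -> c1 <= cos (a * y))].
Proof.
move=> a0 phipi aphi s0 sphi; have p0 := pi_gt0 R.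
pose d := (pi / 2 - a * phi) / (a + 1).
have a1 : 0 < a + 1 by lra.
have d0 : 0 < d by rewrite divr_gt0// subr_gt0.
have phi0 : 0 < phi by exact: lt_le_trans sphi.
have aphi0 : 0 <= a * phi by rewrite mulr_ge0// ltW.
have ad : a * d + d = pi / 2 - a * phi by rewrite /d; field; rewrite gt_eqF.
have adpos : 0 <= a * d by rewrite mulr_ge0// ltW.
have av : a * (phi + d) < pi / 2 by rewrite mulrDr; lra.
have av0 : 0 <= a * (phi + d) by rewrite mulrDr addr_ge0.
exists (s / 2), (phi + d), (cos (s / 2)), (cos (a * (phi + d))); split.
- by split; lra.
- split.
  + by apply: cos_ge0_pihalf; apply/andP; split; lra.
  + have h0 : (0 : R) \in `[0, pi] by rewrite in_itv/= lexx ltW.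
    have hs : s / 2 \in `[0, pi] by rewrite in_itv/=; apply/andP; split; lra.
    by rewrite -[ltRHS](cos0 R) ltr_cos//; lra.
  + by apply: cos_gt0_pihalf; apply/andP; split; lra.
- by move=> y h1 h2; apply: cos_le_sym; lra.
- move=> y h1 h2; apply: ler_cos_pi; last by lra.
    by rewrite mulr_ge0//; lra.
  by rewrite ler_wpM2l// ltW.
Qed.

Lemma dexp_trivial w : dexp 0 0 0 w = 1.
Proof. by rewrite /dexp (_ : 0%:C = 0)// !mul0r subr0 cexp0. Qed.

Section half_residue_value.
Variables (k a x phi : R).
Hypotheses (k2 : `|k| < 2^-1) (a0 : 0 <= a) (x0 : 0 <= x) (phi0 : 0 < phi)
  (phipi : phi <= pi) (aphi : a * phi < pi / 2).

Lemma integrable_residue : mu.-integrable setT (EFin \o (fun t => Im (dexp_sinh k a x (pt t phi)))).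
Proof.
have [u [v [c0 [c1 [[us sv _ _] [p1 p2 p3] h1 h2]]]]] := strip_params a0 phipi aphi phi0 (lexx _).
exact: (integrable_dexp_sinh k2 x0 p1 p2 p3 h1 h2).
Qed.

Let e := 2^-1 - `|k|.
Let D w := (dexp k a x w - (expR (- x))%:C) * (twosinh w)^-1.
Let K := (`|k| + a / cos (a * phi)) * expR 1.
(* for 1 <= |t|, the squared norm of 2 sinh (w / 2) is at least exp |t| - 2, hence
   at least (1 - 2 / e) exp |t| *)
Let rho := Num.sqrt (1 - 2 * expR (- 1) : R).
Let bnd := 2 * rho^-1 + 2 * K * (expR 1 + (cos 1)^-1) * expR e.

Let e_gt0 : 0 < e. Proof. by rewrite subr_gt0. Qed.

Let e1_lt : 2 * expR (- 1) < 1 :> R.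
Proof.
rewrite expRN -ltr_pdivlMr ?invr_gt0 ?expR_gt0// invrK mul1r.
by have := @expR_gt1Dx R 1 (oner_neq0 R); rewrite (_ : 1 + 1 = 2 :> R)//; ring.
Qed.

Let rho_gt0 : 0 < rho. Proof. by rewrite sqrtr_gt0 subr_gt0. Qed.

Let c1_gt0 : 0 < cos (a * phi).
Proof.
have := pi_gt0 R => p0; apply: cos_gt0_pihalf; rewrite aphi andbT.
by apply: (@lt_le_trans _ _ 0); [lra|rewrite mulr_ge0// ltW].
Qed.

Let K_ge0 : 0 <= K.
Proof. by rewrite mulr_ge0 ?expR_ge0// addr_ge0// divr_ge0// ltW. Qed.

Let cosphi s : 0 <= s -> s <= phi -> cos (a * phi) <= cos (a * s).
Proof.
move=> s0 sphi; have := pi_gt0 R => p0; apply: ler_cos_pi.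
- by rewrite mulr_ge0.
- by rewrite ler_wpM2l.
- by move: aphi; lra.
Qed.

Let D_near t s : `|t| <= 1 -> 0 < s -> s <= phi -> s <= 1 ->
  normc (D (pt t s)) <= 2 * K * (expR 1 + (cos 1)^-1).
Proof.
move=> t1 s0 sphi s1.
have [h1 h2] := twosinh_lower t1 (ltW s0) s1.
have c1 := cos1_gt0 R.
have S0 : 0 < normc (twosinh (pt t s)) by apply: lt_le_trans h2; rewrite mulr_gt0.
rewrite ComplexField.Normc.normcM ComplexField.Normc.normcV.
have := dexp_lipschitz k2 a0 x0 c1_gt0 cosphi t1 (ltW s0) sphi.
rewrite dexp_origin -/K => h3.
rewrite ler_pdivrMr//; apply: le_trans h3 _.
rewrite -[leRHS]mulrA; apply: ler_wpM2l; first exact: mulr_ge0.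
rewrite mulrDl lerD//.
  by rewrite -ler_pdivrMl ?expR_gt0// -expRN.
by rewrite -ler_pdivrMl ?invr_gt0// invrK.
Qed.

Let D_far t s : 1 <= `|t| -> 0 < s -> s <= phi ->
  normc (D (pt t s)) <= 2 * rho^-1 * expR (- (e * `|t|)).
Proof.
move=> t1 s0 sphi.
have SS : rho * expR (2^-1 * `|t|) <= normc (twosinh (pt t s)).
  rewrite -(@ler_pXn2r _ 2) ?nnegrE ?normc_ge0 ?mulr_ge0 ?expR_ge0 ?(ltW rho_gt0)//.
  rewrite exprMn sqr_sqrtr; last by rewrite subr_ge0 ltW.
  rewrite normc_twosinh expr2 -expRD (_ : 2^-1 * `|t| + 2^-1 * `|t| = `|t|); last by field.
  have g1 := expR_add_ge_norm t; have g2 := cos_le1 s.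
  have g3 : 1 <= expR (- 1) * expR `|t|.
    by rewrite -expRD -[leLHS](@expR0 R) ler_expR addrC subr_ge0.
  by move: g1 g2 g3; lra.
have S0 : 0 < normc (twosinh (pt t s)).
  by apply: lt_le_trans SS; rewrite mulr_gt0 ?expR_gt0.
rewrite ComplexField.Normc.normcM ComplexField.Normc.normcV.
have SV : (normc (twosinh (pt t s)))^-1 <= rho^-1 * expR (- (2^-1 * `|t|)).
  by rewrite expRN -invfM lef_pV2// posrE mulr_gt0// expR_gt0.
have EE : normc (dexp k a x (pt t s) - (expR (- x))%:C) <= expR (k * t) + 1.
  apply: le_trans (normcD_le _ _) _; rewrite lerD//.
    apply: normc_dexp_le => //; apply: le_trans (ltW c1_gt0) _.
    by apply: cosphi => //; exact: ltW.
  rewrite normcNE /= expr0n/= addr0 sqrtr_sqr ger0_norm ?expR_ge0//.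
  by rewrite expR_le1 oppr_le0.
apply: le_trans (ler_pM (normc_ge0 _) _ EE SV) _; first by rewrite invr_ge0 normc_ge0.
rewrite [leLHS]mulrCA -(mulrA 2) [leRHS]mulrCA ler_wpM2l ?invr_ge0 ?(ltW rho_gt0)//.
rewrite mulrDl mul1r [leRHS](_ : _ = expR (- (e * `|t|)) + expR (- (e * `|t|))); last by ring.
rewrite lerD//; first exact: expR_weight.
rewrite ler_expR lerN2 ler_wpM2r// /e; have := normr_ge0 k; lra.
Qed.

Let D_le t s : 0 < s -> s <= phi -> s <= 1 ->
  normc (D (pt t s)) <= bnd * expR (- (e * `|t|)).
Proof.
move=> s0 sphi s1; have c1 := cos1_gt0 R.
have B1 : 0 <= 2 * rho^-1 by rewrite mulr_ge0// invr_ge0 ltW.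
have B2 : 0 <= 2 * K * (expR 1 + (cos 1)^-1).
  apply: mulr_ge0; first exact: mulr_ge0.
  by apply: addr_ge0; [exact: expR_ge0|rewrite invr_ge0 ltW].
rewrite /bnd mulrDl; case: (lerP `|t| 1) => [t1|/ltW t1].
  apply: le_trans (D_near t1 s0 sphi s1) _.
  rewrite -[leLHS]add0r; apply: lerD; first by rewrite mulr_ge0// expR_ge0.
  rewrite -[leLHS]mulr1 -[leRHS]mulrA; apply: ler_wpM2l => //.
  rewrite -expRD -[leLHS](@expR0 R) ler_expR subr_ge0.
  by rewrite -[leRHS]mulr1; apply: ler_wpM2l => //; exact: ltW.
apply: le_trans (D_far t1 s0 sphi) _.
by rewrite lerDl; apply: mulr_ge0; [apply: mulr_ge0 => //|]; exact: expR_ge0.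
Qed.

Let D_cvg t (s_ : nat -> R) : t != 0 -> s_ n @[n --> \oo] --> 0 ->
  Im (D (pt t (s_ n))) @[n --> \oo] --> 0.
Proof.
move=> t0 s_0.
have S0 : twosinh (pt t 0) != 0.
  apply/eqP => h; have := normc_twosinh t 0.
  rewrite h ComplexField.Normc.normc0 expr0n/= cos0 mulr1 => /esym/eqP; apply/negP.
  rewrite gt_eqF// (_ : _ - 2 = expR (- t) * (expR t - 1) ^+ 2); last first.
    have e2 : expR t * expR (- t) = 1 by rewrite -expRD subrr expR0.
    rewrite [RHS](_ : _ = (expR t * expR (- t)) * expR t - 2 * (expR t * expR (- t)) + expR (- t)).
      by rewrite e2; clear; ring.
    by clear; ring.
  rewrite mulr_gt0 ?expR_gt0// lt_def sqr_ge0 andbT sqrf_eq0 subr_eq0.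
  by apply: contra t0 => /eqP h1; apply/eqP/expR_inj; rewrite h1 expR0.
have [d dD] : exists d, cdiff D (pt t 0) d.
  eexists; apply: cdiffM.
    apply: cdiffD; first exact: cdiff_dexp.
    by apply: cdiffN; exact: cdiff_cst.
  by apply: cdiffV; [exact: S0|exact: cdiff_twosinh].
have [_ dI] := dD (fun s => pt t s) 0 'i erefl (curve_pt_r _ _).
have cI := isd_continuous dI.
have I0 : Im (D (pt t 0)) = 0.
  have ImS : Im (twosinh (pt t 0)) = 0.
    by rewrite !cE !(mulr0, oppr0, sin0, addr0).
  have ImV (z : C) : Im z = 0 -> Im z^-1 = 0.
    by case: z => p q /= ->; rewrite mul0r oppr0.
  have ImE : Im (dexp k a x (pt t 0) - (expR (- x))%:C) = 0.
    by rewrite !cE /= !(mulr0, sin0, subr0).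
  by rewrite ImM (ImV _ ImS) ImE mulr0 mul0r addr0.
have := cvg_comp s_ (fun s => Im (D (pt t s))) s_0 cI.
by rewrite I0.
Qed.

(** Subtracting exp (- x) / (2 sinh (w / 2)), which has the same residue at the
    origin, leaves a function [D] that is real on the real axis and bounded near
    it.  Its integral does not depend on the height of the line and tends to 0
    when the line is lowered to the axis, so it is 0; the subtracted term is
    evaluated by [integral_inv_twosinh]. *)
Theorem residue_integral :
  \int[mu]_t Im (dexp_sinh k a x (pt t phi)) = - (pi * expR (- x)).
Proof.
(* heights tending to 0, below phi and below the height 1 up to which the bound
   near the pole holds *)
pose m := Num.min phi 1; have m0 : 0 < m by rewrite lt_min phi0/=.
pose s_ (n : nat) : R := m * n.+1%:R^-1.
have s_gt0 n : 0 < s_ n by rewrite mulr_gt0 ?invr_gt0.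
have s_m n : s_ n <= m by rewrite ler_piMr ?(ltW m0)// invf_le1 ?ler1n.
have s_phi n : s_ n <= phi by rewrite (le_trans (s_m n))// ge_min lexx.
have s_1 n : s_ n <= 1 by rewrite (le_trans (s_m n))// ge_min lexx orbT.
have s_cvg : s_ n @[n --> \oo] --> 0.
  by rewrite -[X in _ --> X](mulr0 m); apply: cvgMl_tmp; exact: cvg_harmonic.
pose g n t := Im (D (pt t (s_ n))).
have gE n t : g n t = Im (dexp_sinh k a x (pt t (s_ n))) - expR (- x) * Im (dexp_sinh 0 0 0 (pt t (s_ n))).
  rewrite /g /D /dexp_sinh dexp_trivial mul1r mulrDl ImD mulNr ImN.
  by rewrite Im_scale.
have J n : \int[mu]_t g n t = \int[mu]_t Im (dexp_sinh k a x (pt t phi)) + pi * expR (- x).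
  have [u [v [c0 [c1 [[us sv u1 v1] [p1 p2 p3] h1 h2]]]]] :=
    strip_params a0 phipi aphi (s_gt0 n) (s_phi n).
  have k0 : `|0 : R| < 2^-1 by rewrite normr0 invr_gt0.
  have h2' : forall y : R, u < y -> y < v -> 1 <= cos (0 * y) by move=> y _ _; rewrite mul0r cos0.
  under eq_Rintegral do rewrite gE.
  rewrite RintegralB//; last 2 first.
  - exact: (integrable_dexp_sinh k2 x0 p1 p2 p3 h1 h2).
  - have h := integrable_dexp_sinh k0 (lexx 0) p1 p2 ltr01 h1 h2' us sv.
    have := integrableZl measurableT (expR (- x)) h.
    by apply: eq_integrable => // t _; rewrite /= EFinM.
  rewrite (dexp_sinh_integral_const k2 a0 x0 p1 p2 p3 h1 h2 us sv u1 v1); congr (_ + _).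
  rewrite RintegralZl//; last exact: (integrable_dexp_sinh k0 (lexx 0) p1 p2 ltr01 h1 h2' us sv).
  rewrite integral_inv_twosinh//; last by exact: le_trans phipi.
  by rewrite mulrN opprK mulrC.
have L : (fun n => \int[mu]_t g n t) @ \oo --> \int[mu]_t (cst 0 : R -> R) t.
  apply: (@dominated_cvg_Rintegral _ _ _ mu [set 0] g (cst 0)
    (fun t => bnd * expR (- (e * `|t|)))) => //.
  - exact: lebesgue_measure_set1.
  - move=> n; have [u [v [c0 [c1 [[us sv u1 v1] [p1 p2 p3] h1 h2]]]]] :=
      strip_params a0 phipi aphi (s_gt0 n) (s_phi n).
    have k0 : `|0 : R| < 2^-1 by rewrite normr0 invr_gt0.
    have h2' : forall y : R, u < y -> y < v -> 1 <= cos (0 * y) by move=> y _ _; rewrite mul0r cos0.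
    rewrite (_ : g n = (fun t => Im (dexp_sinh k a x (pt t (s_ n))) -
      expR (- x) * Im (dexp_sinh 0 0 0 (pt t (s_ n))))); last exact/funext/gE.
    have i1 := measurable_int mu (integrable_dexp_sinh k2 x0 p1 p2 p3 h1 h2 us sv).
    have i2 := measurable_int mu (integrable_dexp_sinh k0 (lexx 0) p1 p2 ltr01 h1 h2' us sv).
    apply: measurable_funB; first exact/measurable_EFinP.
    by apply: measurable_funM => //; exact/measurable_EFinP.
  - move=> t /eqP t0; exact: D_cvg.
  - have h := integrable_expR_norm e_gt0.
    have := integrableZl measurableT bnd h.
    by apply: eq_integrable => // t _; rewrite /= EFinM.
  - by move=> n t; apply: le_trans (normr_Im _) (D_le _ _ _ _).
have : \int[mu]_t Im (dexp_sinh k a x (pt t phi)) + pi * expR (- x) = 0.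
  move: L; under eq_fun do rewrite J.
  rewrite Rintegral_cst// mul0r => /cvg_lim <- //.
  by rewrite lim_cst.
by move/eqP; rewrite addr_eq0 => /eqP.
Qed.

End half_residue_value.
End half_residue.

(** * The Gamma function in logarithmic coordinates *)

Section gamma.
Context {R : realType}.
Notation mu := (@lebesgue_measure R).
Implicit Types s t x a b c z : R.

Lemma expR_linear_le1 a t : 0 <= a -> a <= 1 -> expR (a * t) <= 1 + expR t.
Proof.
move=> a0 a1; case: (leP 0 t) => [t0|/ltW t0].
  by rewrite -[leLHS]add0r lerD// ler_expR ler_piMl.
by rewrite -[leLHS]addr0 lerD ?expR_ge0// expR_le1 mulr_ge0_le0.
Qed.

(** The double exponential prevails as [t] goes to [+oo], and [s * t] as [t]
    goes to [-oo]. *)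
Lemma expR_double_le s c z a : 0 < s -> 0 < c -> 0 <= z -> 0 <= a -> a < 1 ->
  exists M e, 0 < e /\
    forall t, expR (s * t - c * expR t + z * expR (a * t)) <= M * expR (- (e * `|t|)).
Proof.
move=> s0 c0 z0 a0 a1.
have a1' : 0 < 1 - a by rewrite subr_gt0.
(* T makes z exp (a t) at most (c / 2) exp t + z exp (a T) for all t, and T' is
   the point at which (c / 2) exp t has slope s + 1 *)
pose T := 2 * z / (c * (1 - a)); pose T' := ln (2 * (s + 1) / c).
exists (expR (z * expR (a * T) + (s + 1) * `|T'|)), (Num.min s 1); split.
  by rewrite lt_min s0/=.
move=> t.
have h1 : z * expR (a * t) <= c / 2 * expR t + z * expR (a * T).
  have : expR (a * t) <= expR (- ((1 - a) * T)) * expR t + expR (a * T).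
    rewrite (_ : a * t = a * T + a * (t - T)); last by ring.
    rewrite expRD; apply: le_trans (ler_wpM2l (expR_ge0 _) (expR_linear_le1 (t - T) a0 (ltW a1))) _.
    rewrite mulrDr mulr1 addrC lerD2r -!expRD ler_expR.
    by rewrite le_eqVlt; apply/orP; left; apply/eqP; ring.
  have hT : z * expR (- ((1 - a) * T)) <= c / 2.
    rewrite expRN ler_pdivrMr ?expR_gt0//.
    have := expR_ge1Dx ((1 - a) * T).
    have -> : (1 - a) * T = 2 * z / c by rewrite /T; field; rewrite !gt_eqF.
    move=> h; have : c / 2 * (1 + 2 * z / c) <= c / 2 * expR (2 * z / c).
      by rewrite ler_wpM2l// divr_ge0// ltW.
    apply: le_trans; rewrite [leRHS](_ : _ = c / 2 + z); last by field; rewrite gt_eqF.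
    by rewrite lerDr divr_ge0// ltW.
  move=> h; apply: le_trans (ler_wpM2l z0 h) _.
  by rewrite mulrDr lerD2r mulrA ler_wpM2r// expR_ge0.
have h2 : s * t - c / 2 * expR t <= - (Num.min s 1 * `|t|) + (s + 1) * `|T'|.
  have s10 : 0 < s + 1 by rewrite addr_gt0.
  have T'0 : 0 <= (s + 1) * `|T'| by rewrite mulr_ge0// ltW.
  case: (leP 0 t) => [t0|/ltW t0].
    rewrite ger0_norm//.
    have h : (s + 1) * (1 + (t - T')) <= c / 2 * expR t.
      have -> : expR t = expR T' * expR (t - T') by rewrite -expRD; congr expR; ring.
      rewrite lnK; last by rewrite posrE divr_gt0// mulr_gt0.
      rewrite mulrA (_ : c / 2 * (2 * (s + 1) / c) = s + 1); last by field; rewrite gt_eqF.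
      by rewrite ler_wpM2l ?(ltW s10)// expR_ge1Dx.
    have h3 : Num.min s 1 * t <= t by rewrite ler_piMl// ge_min lexx orbT.
    have h4 : (s + 1) * T' <= (s + 1) * `|T'| by rewrite ler_wpM2l ?(ltW s10)// ler_norm.
    by lra.
  rewrite ler0_norm// mulrN opprK.
  have h3 : s * t <= Num.min s 1 * t by rewrite ler_wnM2r// ge_min lexx.
  have h4 : 0 <= c / 2 * expR t by rewrite mulr_ge0 ?expR_ge0// divr_ge0// ltW.
  by move: h3 h4 T'0; lra.
rewrite -expRD ler_expR; move: h1 h2.
rewrite (_ : c * expR t = c / 2 * expR t + c / 2 * expR t); last by field.
lra.
Qed.

Lemma integrable_expR_double (f : R -> R) s c z a :
  0 < s -> 0 < c -> 0 <= z -> 0 <= a -> a < 1 -> measurable_fun setT f ->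
  (forall t, `|f t| <= expR (s * t - c * expR t + z * expR (a * t))) ->
  mu.-integrable setT (EFin \o f).
Proof.
move=> s0 c0 z0 a0 a1 mf fb; have [M [e [e0 H]]] := expR_double_le s0 c0 z0 a0 a1.
by apply: (integrable_le_expR (M := M) e0 mf) => t; exact: le_trans (fb t) (H t).
Qed.

(** Euler's integral after the substitution of exp t for its variable. *)
Definition Gamma_pos s := \int[mu]_t expR (s * t - expR t).

Lemma measurable_Gamma_pos s : measurable_fun setT (fun t : R => expR (s * t - expR t)).
Proof.
apply: continuous_measurable_fun => t; apply: (@isd_continuous _ _ _ ((s - expR t) * expR (s * t - expR t))).
by isd; ring.
Qed.

Lemma integrable_Gamma_pos s : 0 < s -> mu.-integrable setT (EFin \o (fun t => expR (s * t - expR t))).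
Proof.
move=> s0; apply: (@integrable_expR_double _ s 1 0 0) => //; first exact: measurable_Gamma_pos.
by move=> t; rewrite ger0_norm ?expR_ge0// mul1r mul0r addr0.
Qed.

Lemma Gamma_posS s : 0 < s -> Gamma_pos (s + 1) = s * Gamma_pos s.
Proof.
move=> s0.
have dF (t : R) : is_derive t 1 (fun t => expR (s * t - expR t))
    (s * expR (s * t - expR t) - expR ((s + 1) * t - expR t)).
  have -> : expR ((s + 1) * t - expR t) = expR t * expR (s * t - expR t).
    by rewrite -expRD; congr expR; ring.
  by isd; ring.
have [M [e [e0 H]]] := expR_double_le s0 ltr01 (lexx 0) (lexx 0) ltr01.
have [h1 h2] : (fun t => expR (s * t - expR t)) t @[t --> +oo] --> 0 /\
    (fun t => expR (s * t - expR t)) t @[t --> -oo] --> 0.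
  apply: (cvg0_le_expR (M := M) e0) => t; rewrite ger0_norm ?expR_ge0//.
  by have := H t; rewrite mul1r mul0r addr0.
have i1 := integrable_Gamma_pos s0.
have i2 := integrable_Gamma_pos (addr_gt0 s0 ltr01).
have i3 : mu.-integrable setT (EFin \o (fun t => s * expR (s * t - expR t))).
  by have := integrableZl measurableT s i1; apply: eq_integrable => // t _; rewrite /= EFinM.
have := @integral_derive _ _ _ 0 0 dF.
rewrite subrr => /(_ _ _ h2 h1) I.
apply/esym/eqP; rewrite -subr_eq0 /Gamma_pos -RintegralZl// -RintegralB//; apply/eqP/I.
  move=> t; apply: (@isd_continuous _ _ _
    (s * ((s - expR t) * expR (s * t - expR t)) - ((s + 1) - expR t) * expR ((s + 1) * t - expR t))).
  by isd; ring.
have := integrableB measurableT i3 i2.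
by apply: eq_integrable => // t _; rewrite /= EFinB.
Qed.

(** In the variable u = exp t the integrand is exp (- A u) sin (B + D u), which
    has the primitive [G]. *)
Lemma laplace_sin (A B D : R) : 0 < A ->
  mu.-integrable setT (EFin \o (fun t => expR (t - A * expR t) * sin (B + D * expR t))) /\
  \int[mu]_t (expR (t - A * expR t) * sin (B + D * expR t)) =
    (A * sin B + D * cos B) / (A ^+ 2 + D ^+ 2).
Proof.
move=> A0; pose N := A ^+ 2 + D ^+ 2.
have N0 : 0 < N by rewrite ltr_pwDl ?sqr_ge0// exprn_gt0.
pose G u := - (expR (- (A * u)) * (A * sin (B + D * u) + D * cos (B + D * u))) / N.
have dG (u : R) : is_derive u 1 G (expR (- (A * u)) * sin (B + D * u)).
  by rewrite /G; isd; rewrite /N; field; rewrite gt_eqF.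
have cf : continuous (fun t => expR (t - A * expR t) * sin (B + D * expR t)).
  move=> t; apply: (@isd_continuous _ _ _
    ((1 - A * expR t) * expR (t - A * expR t) * sin (B + D * expR t) +
     expR (t - A * expR t) * (cos (B + D * expR t) * (D * expR t)))).
  by isd; ring.
have intf : mu.-integrable setT (EFin \o (fun t => expR (t - A * expR t) * sin (B + D * expR t))).
  apply: (@integrable_expR_double _ 1 A 0 0) => //; first exact: continuous_measurable_fun.
  move=> t; rewrite normrM ger0_norm ?expR_ge0// mul1r mul0r addr0.
  by rewrite ler_piMr ?expR_ge0// sin_max.
split => //.
have dF (t : R) : is_derive t 1 (fun t => G (expR t)) (expR (t - A * expR t) * sin (B + D * expR t)).
  have h := @isd_comp _ G expR t _ _ (dG (expR t)) (is_derive_expR t).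
  by apply: is_derive_eq h _; rewrite expRD; ring.
rewrite (integral_derive (l1 := G 0) (l2 := 0) dF)//.
- by rewrite sub0r /G !mulr0 oppr0 expR0 addr0 mul1r mulNr opprK.
- have cG : {for 0, continuous G} by exact: isd_continuous (dG 0).
  apply: (cvg_comp expR G _ cG).
  by apply/cvgNy_compNP; exact: cvgr_expR.
- apply: norm_cvg0; apply: (squeeze_cvgr (f := cst 0)
    (h := fun t => (A + `|D|) / N * expR (- (A * (1 + t))))).
  + near=> t; rewrite normr_ge0/= /G mulNr normrN !normrM normfV.
    rewrite (ger0_norm (expR_ge0 _)) (ger0_norm (ltW N0)) mulrC mulrA mulrAC.
    apply: ler_pM; rewrite ?expR_ge0// ?mulr_ge0 ?invr_ge0 ?(ltW N0)//.
      rewrite mulrC ler_wpM2r ?invr_ge0 ?(ltW N0)//.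
      rewrite (le_trans (ler_normD _ _))// lerD// normrM.
        by rewrite (ger0_norm (ltW A0)) ler_piMr ?(ltW A0)// sin_max.
      by rewrite ler_piMr// cos_max.
    by rewrite ler_expR lerN2 ler_wpM2l ?(ltW A0)// expR_ge1Dx.
  + exact: cvg_cst.
  + rewrite -[X in _ --> X](mulr0 ((A + `|D|) / N)); apply: cvgMl_tmp.
    apply: (cvg_comp (fun t => A * (1 + t)) (fun x => expR (- x)) _ (@cvgr_expR R)).
    by apply: gt0_cvgMry => //; exact: cvg_addrl.
Unshelve. all: end_near. Qed.

End gamma.

Section reflection.
Context {R : realType}.
Local Notation C := R[i].
Local Notation Im := (@complex.Im R).
Notation mu := (@lebesgue_measure R).
Implicit Types s t x a b c z : R.

Lemma laplace_exp A : 0 < A ->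
  (\int[mu]_t (expR (t - A * expR t))%:E = (A^-1)%:E)%E.
Proof.
move=> A0; have [i E] := laplace_sin (pi / 2) 0 A0.
have f t : expR (t - A * expR t) * sin (pi / 2 + 0 * expR t) = expR (t - A * expR t).
  by rewrite mul0r addr0 sin_pihalf mulr1.
have i' : mu.-integrable setT (EFin \o (fun t => expR (t - A * expR t))).
  by apply: eq_integrable i => // t _; rewrite /= f.
rewrite -[LHS]fineK; last exact: integrable_fin_num i'.
congr (_%:E); transitivity (\int[mu]_t (expR (t - A * expR t) * sin (pi / 2 + 0 * expR t))).
  by apply: eq_Rintegral => t _; rewrite f.
rewrite E sin_pihalf cos_pihalf expr0n/=; field.
by rewrite gt_eqF.
Qed.

(** Tonelli, after a translation of the first variable by the second. *)
Lemma ge0_integral_mul_shift (f g : R -> R) :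
  measurable_fun setT f -> measurable_fun setT g ->
  (forall t, 0 <= f t) -> (forall t, 0 <= g t) ->
  (\int[mu]_t (f t)%:E * \int[mu]_t (g t)%:E =
   \int[mu]_y \int[mu]_x (f (x + y)%R * g x)%:E)%E.
Proof.
move=> mf mg f0 g0.
have mfE : measurable_fun setT (fun t => (f t)%:E) by exact/measurable_EFinP.
have mgE : measurable_fun setT (fun t => (g t)%:E) by exact/measurable_EFinP.
rewrite -ge0_integralZl//; [|by move=> t _; rewrite lee_fin
  |by apply: integral_ge0 => t _; rewrite lee_fin].
pose h (p : R * R) := (f (p.1 + p.2) * g p.1)%:E.
have mh : measurable_fun setT h.
  apply/measurable_EFinP; apply: measurable_funM; apply: measurableT_comp => //.
  exact: measurable_funD.
have h0 p : (0 <= h p)%E by rewrite lee_fin mulr_ge0.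
rewrite -(@fubini_tonelli _ _ _ _ _ mu mu h)//.
apply: eq_integral => x _; rewrite muleC -ge0_integralZl ?lee_fin//; last by move=> t _; rewrite lee_fin.
have mk : measurable_fun setT (fun t => ((g x)%:E * (f t)%:E)%E).
  by under eq_fun do rewrite -EFinM; apply/measurable_EFinP; exact: measurable_funM.
rewrite (@ge0_integral_shift _ x)//; last by move=> y; rewrite mule_ge0 ?lee_fin.
by apply: eq_integral => y _; rewrite /h /= -EFinM mulrC addrC.
Qed.

Lemma Gamma_pos_mul s : 0 < s -> s < 1 ->
  Gamma_pos s * Gamma_pos (1 - s) = \int[mu]_t (expR (s * t) / (1 + expR t)).
Proof.
move=> s0 s1; have s1' : 0 < 1 - s by rewrite subr_gt0.
have fin1 := integrable_fin_num measurableT (integrable_Gamma_pos s0).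
have fin2 := integrable_fin_num measurableT (integrable_Gamma_pos s1').
rewrite /Gamma_pos /Rintegral -fineM//; congr fine.
rewrite (ge0_integral_mul_shift (measurable_Gamma_pos s) (measurable_Gamma_pos (1 - s)))//.
apply: eq_integral => y _.
have A0 : 0 < 1 + expR y by rewrite addr_gt0 ?expR_gt0.
transitivity (\int[mu]_x ((expR (s * y))%:E * (expR (x - (1 + expR y) * expR x))%:E))%E.
  apply: eq_integral => x _; rewrite -EFinM -!expRD; congr (expR _)%:E.
  by rewrite expRD; ring.
rewrite ge0_integralZl// ?lee_fin ?expR_ge0//.
  by rewrite laplace_exp// -EFinM.
apply/measurable_EFinP; apply: continuous_measurable_fun => t.
apply: (@isd_continuous _ _ _ ((1 - (1 + expR y) * expR t) * expR (t - (1 + expR y) * expR t))).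
by isd; ring.
Qed.

(** For [a = x = 0] and [k = s - 1 / 2], the imaginary part of the quotient on
    the line of height [pi] is [- sin (pi * s)] times this integrand. *)
Lemma integral_beta s : 0 < s -> s < 1 ->
  sin (pi * s) * \int[mu]_t (expR (s * t) / (1 + expR t)) = pi.
Proof.
move=> s0 s1; pose k := s - 2^-1.
have k2 : `|k| < 2^-1 by rewrite ltr_norml /k; apply/andP; split; lra.
have p0 := pi_gt0 R.
have ap : 0 * pi < pi / 2 :> R by rewrite mul0r divr_gt0.
have E := residue_integral k2 (lexx 0) (lexx 0) p0 (lexx _) ap.
have I := integrable_residue k2 (lexx 0) (lexx 0) p0 (lexx _) ap.
have qE t : Im (dexp_sinh k 0 0 (pt t pi)) = - sin (pi * s) * (expR (s * t) / (1 + expR t)).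
  pose A := expR (2^-1 * t) + expR (- (2^-1 * t)).
  have A0 : 0 < A by rewrite addr_gt0// expR_gt0.
  have SE : twosinh (pt t pi) = 0 +i* A.
    apply: complex_eq; rewrite !cE /= (mulrC 2^-1 pi) ?cosN ?sinN.
      by rewrite cos_pihalf !mulr0 subrr.
    by rewrite sin_pihalf !mulr1 mulrN1 opprK.
  have SVE : (twosinh (pt t pi))^-1 = 0 +i* - A^-1.
    by rewrite SE; apply: complex_eq; rewrite /=; field; rewrite gt_eqF.
  have Q : dexp k 0 0 (pt t pi) = cexp (k%:C * pt t pi).
    by rewrite /dexp (_ : 0%:C = 0)// !mul0r subr0.
  rewrite /dexp_sinh SVE ImM Q !cE /= mulr0 addr0.
  have -> : cos (k * pi) = sin (pi * s).
    by rewrite (_ : k * pi = pi * s - pi / 2) ?cosBpihalf// /k; field.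
  have -> : expR (k * t) = expR (s * t) * expR (- (2^-1 * t)).
    by rewrite -expRD /k; congr expR; ring.
  have e1 : expR t = expR (2^-1 * t) * expR (2^-1 * t).
    by rewrite -expRD; congr expR; field.
  rewrite e1 /A expRN; have := expR_gt0 (2^-1 * t); set y := expR (2^-1 * t) => y0.
  field; apply/andP; split; rewrite gt_eqF//; nra.
have I' : mu.-integrable setT (EFin \o (fun t => - sin (pi * s) * (expR (s * t) / (1 + expR t)))).
  by apply: eq_integrable I => // t _; rewrite /comp qE.
have sin0 : 0 < sin (pi * s).
  apply: sin_gt0_pi; apply/andP; split; first exact: mulr_gt0.
  by rewrite -[ltRHS]mulr1 ltr_pM2l.
move: E; under eq_Rintegral do rewrite qE.
rewrite RintegralZl//; last first.
  have := integrableZl measurableT (- sin (pi * s))^-1 I'.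
  apply: eq_integrable => // t _; rewrite /= -EFinM mulrA mulVf ?mul1r//.
  by rewrite oppr_eq0 gt_eqF.
by rewrite oppr0 expR0 mulr1 mulNr => /oppr_inj.
Qed.

Lemma Gamma_pos_reflection s : 0 < s -> s < 1 -> sin (pi * s) * (Gamma_pos s * Gamma_pos (1 - s)) = pi.
Proof. by move=> s0 s1; rewrite Gamma_pos_mul// integral_beta. Qed.

Lemma euler_integralE s : euler_integral s = Gamma_pos s.
Proof.
rewrite /euler_integral /Gamma_pos /Rintegral; congr fine.
rewrite (ge0_integral_expR (f := fun t => (t `^ (s - 1) * expR (- t))%:E)).
- apply: eq_integral => t _; rewrite -EFinM; congr (_%:E).
  by rewrite -expRM -!expRD; congr expR; ring.
- apply/measurable_EFinP; apply: measurable_funM; first exact: measurable_powR.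
  by apply: measurableT_comp => //; exact: measurableT_comp.
- by move=> t; rewrite lee_fin mulr_ge0 ?powR_ge0 ?expR_ge0.
Qed.

(* the expected value of 1 / Gamma (1 - s) *)
Let rg s := sin (pi * s) * Gamma_pos s / pi.

Let rgS s : 0 < s -> rg (s + 1) = - s * rg s.
Proof.
move=> s0; rewrite /rg Gamma_posS// mulrDr mulr1 sinDpi; ring.
Qed.

Let rg_prod (y : R) n : y < 1 ->
  rg (1 - (y - n%:R)) = (\prod_(i < n) (y - n%:R + i%:R)) * rg (1 - y).
Proof.
move=> y1; elim: n => [|n IH]; first by rewrite big_ord0 mul1r subr0.
rewrite big_ord_recl /= addr0.
have -> : 1 - (y - n.+1%:R) = 1 - (y - n%:R) + 1 by rewrite -natr1; ring.
rewrite rgS; last by have := ler0n R n; lra.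
rewrite IH mulrA; congr (_ * _); rewrite -(@natr1 _ n); congr (_ * _); first by ring.
by apply: eq_bigr => i _; rewrite /bump/= -natr1; ring.
Qed.

(** The functional equation reduces this to 0 < s < 1, where it is the
    reflection formula.  For an integer [s] both sides are 0: the left one
    because a factor in the denominator of [Gamma] vanishes. *)
Lemma Gamma_inv s : 0 < s -> (Gamma (1 - s))^-1 = sin (pi * s) * Gamma_pos s / pi.
Proof.
move=> s0; rewrite /Gamma; set n := (if _ then _ else _).
have [n0 n1] : 0 < 1 - s + n%:R /\ 1 - s + n%:R <= 1.
  rewrite /n; case: ifPn => [h|]; first by rewrite addr0; lra.
  rewrite -leNgt => h; have h' : 0 <= - (1 - s) by rewrite oppr_ge0.
  have /andP[t1 t2] := truncn_itv h'.
  by move: t1 t2; rewrite -natr1; lra.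
rewrite euler_integralE invfM invrK; set y := 1 - s + n%:R in n0 n1 *.
have -> : 1 - s = y - n%:R by rewrite /y addrK.
have sE : s = 1 - (y - n%:R) by rewrite /y; ring.
(* y = 1 is the case of an integer s *)
move: n1; rewrite le_eqVlt => /predU1P[y1|y1].
  have : n != 0%N by apply/eqP => n00; move: y1; rewrite /y n00 addr0; lra.
  case E : n => [//|m] _.
  rewrite (bigD1 (@ord_max m))//= y1 -natr1.
  rewrite (_ : 1 - (m%:R + 1) + m%:R = 0 :> R); last by ring.
  rewrite mul0r mulr0 (_ : sin (pi * s) = 0) ?mul0r//.
  have -> : s = n%:R by rewrite sE y1; ring.
  by rewrite mulrC mulr_natl; elim: (n) => [|j IH]; rewrite ?mulr0n ?sin0// mulrSr sinDpi IH oppr0.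
rewrite -/(rg s) [X in rg X]sE rg_prod// mulrC; congr (_ * _).
have y0' : 0 < 1 - y by rewrite subr_gt0.
have y1' : 1 - y < 1 by lra.
have := Gamma_pos_reflection y0' y1'; rewrite subKr /rg => h.
have g0 : Gamma_pos y != 0.
  apply/eqP => g0; move: h; rewrite g0 !mulr0 => /esym/eqP.
  by rewrite gt_eqF// pi_gt0.
by apply: (mulIf g0); rewrite mulVf// mulrAC -(mulrA (sin _)) h divff// gt_eqF// pi_gt0.
Qed.

End reflection.

(** * The rotated Gamma integral *)

Section rotated_gamma.
Context {R : realType}.
Local Notation C := R[i].
Local Notation Re := (@complex.Re R).
Local Notation Im := (@complex.Im R).
Local Notation normc := (@ComplexField.Normc.normc R).
Notation mu := (@lebesgue_measure R).
Implicit Types s t x a b c z : R.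

Lemma cos_ge_sym (y v : R) : `|y| <= v -> v <= pi -> cos v <= cos y.
Proof. by move=> yv vpi; rewrite -(cos_norm y); exact: ler_cos_pi. Qed.

Lemma Im_cis_cexp b w : Im ((cos b +i* sin b) * cexp w) = expR (Re w) * sin (b + Im w).
Proof. by rewrite ImM !cE /= sinD; ring. Qed.

(** Up to sign, the integrand is the imaginary part of
    exp (i b) exp (s w - exp w) on the line of height [psi]; the line is moved
    down to the real axis. *)
Lemma Gamma_pos_rotated s psi beta : 0 < s -> 0 <= psi -> psi < pi / 2 ->
  \int[mu]_t (expR (s * t - cos psi * expR t) * sin (beta + sin psi * expR t)) =
  Gamma_pos s * sin (beta + s * psi).
Proof.
move=> s0 psi0 psi2; have p0 := pi_gt0 R.
pose v := (psi + pi / 2) / 2; pose c := cos v.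
have v2 : v < pi / 2 by rewrite /v; lra.
have v0 : 0 < v by rewrite /v; lra.
have psiv : psi < v by rewrite /v; lra.
have c0 : 0 < c by apply: cos_gt0_pihalf; apply/andP; split; lra.
have cc y : - v < y -> y < v -> c <= cos y.
  move=> y1 y2; apply: cos_ge_sym; last by lra.
  by rewrite ler_norml !ltW.
pose b := - (beta + s * psi).
pose f w : C := (cos b +i* sin b) * dexp s 1 1 w.
pose f' w : C := (cos b +i* sin b) * dexp' s 1 1 w.
have nb : normc (cos b +i* sin b) = 1 by rewrite /= cos2Dsin2 sqrtr1.
have df w : cdiff f w (f' w).
  apply: cdiff_eq; first by apply: cdiffM; [exact: cdiff_cst|exact: cdiff_dexp].
  by rewrite mul0r add0r.
have df' w : exists d, cdiff f' w d.
  have [d h] := cdiff_dexp' s 1 1 w.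
  by eexists; apply: cdiffM; [exact: cdiff_cst|exact: h].
have [M1 [e1 [e10 H1]]] := expR_double_le s0 c0 (lexx 0) (lexx 0) ltr01.
have [M2 [e2 [e20 H2]]] := expR_double_le (addr_gt0 s0 ltr01) c0 (lexx 0) (lexx 0) ltr01.
have Mpos M r (y : R) : expR r <= M * expR y -> 0 <= M :> R.
  by move=> h; have := lt_le_trans (expR_gt0 r) h; rewrite pmulr_lgt0 ?expR_gt0// => /ltW.
have M10 : 0 <= M1 by exact: (Mpos M1 _ _ (H1 0)).
have M20 : 0 <= M2 by exact: (Mpos M2 _ _ (H2 0)).
pose e := Num.min e1 e2; have e0 : 0 < e by rewrite lt_min e10.
have le1 t : expR (- (e1 * `|t|)) <= expR (- (e * `|t|)).
  by rewrite ler_expR lerN2 ler_wpM2r// ge_min lexx.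
have le2 t : expR (- (e2 * `|t|)) <= expR (- (e * `|t|)).
  by rewrite ler_expR lerN2 ler_wpM2r// ge_min lexx orbT.
have Eb t y : - v < y -> y < v ->
    normc (dexp s 1 1 (pt t y)) <= expR (s * t - c * expR t).
  move=> y1 y2; rewrite normc_dexp !mul1r ler_expR lerD2l lerN2 mulrC.
  by rewrite ler_wpM2l ?expR_ge0// cc.
have b1 t : expR (s * t - c * expR t) <= M1 * expR (- (e * `|t|)).
  by have := H1 t; rewrite mul0r addr0 => h; apply: le_trans h _; rewrite ler_wpM2l.
have b2 t : expR t * expR (s * t - c * expR t) <= M2 * expR (- (e * `|t|)).
  have := H2 t; rewrite mul0r addr0 => h; rewrite -expRD (_ : t + _ = (s + 1) * t - c * expR t); last by ring.
  by apply: le_trans h _; rewrite ler_wpM2l.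
pose M := M1 + (s * M1 + M2).
have bnd t y : - v < y -> y < v -> normc (f (pt t y)) <= M * expR (- (e * `|t|)).
  move=> y1 y2; rewrite ComplexField.Normc.normcM nb mul1r.
  apply: le_trans (Eb t y y1 y2) _; apply: le_trans (b1 t) _.
  by rewrite ler_wpM2r ?expR_ge0// /M lerDl addr_ge0// mulr_ge0// ltW.
have bnd' t y : - v < y -> y < v -> normc (f' (pt t y)) <= M * expR (- (e * `|t|)).
  move=> y1 y2; rewrite ComplexField.Normc.normcM nb mul1r.
  rewrite ComplexField.Normc.normcM.
  have h1 : normc (s%:C - 1%:C * (1%:C * cexp (1%:C * pt t y))) <= s + expR t.
    apply: le_trans (normcD_le _ _) _; rewrite normcNE !normc_scale normc_cexp !cE.
    by rewrite !normr1 !mul1r lerD2r /= expr0n/= addr0 sqrtr_sqr ger0_norm// ltW.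
  apply: le_trans (ler_pM (normc_ge0 _) (normc_ge0 _) h1 (Eb t y y1 y2)) _.
  rewrite mulrDl; apply: le_trans (lerD (ler_wpM2l (ltW s0) (b1 t)) (b2 t)) _.
  by rewrite mulrA -mulrDl ler_wpM2r ?expR_ge0// /M lerDr.
have S : \int[mu]_t Im (f (pt t psi)) = \int[mu]_t Im (f (pt t 0)).
  apply: (@strip_integral_const R f f' (- v) v M e e0) => //.
  - by move=> y _ _; apply: (proj1 (cdiff_continuous _)) => t; exact: df'.
  - by lra.
  - by lra.
have fE t y : Im (f (pt t y)) =
    expR (s * t - cos y * expR t) * sin (b + (s * y - sin y * expR t)).
  by rewrite /f /dexp Im_cis_cexp !cE !mul1r (mulrC (cos y)) (mulrC (sin y)).
move: S; under eq_Rintegral do rewrite fE.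
under [RHS]eq_Rintegral do rewrite fE cos0 sin0 mul1r mul0r subr0 mulr0 addr0.
rewrite RintegralZr//; last exact: integrable_Gamma_pos.
rewrite -/(Gamma_pos s) /b sinN mulrN => /eqP; rewrite -eqr_oppLR => /eqP <-.
rewrite -mulN1r -RintegralZl//.
  apply: eq_Rintegral => t _.
  rewrite (_ : - (beta + s * psi) + _ = - (beta + sin psi * expR t)); last by ring.
  by rewrite sinN mulrN mulN1r opprK.
apply: (@integrable_expR_double R _ s (cos psi) 0 0) => //.
- by apply: cos_gt0_pihalf; apply/andP; split; lra.
- apply: continuous_measurable_fun => t.
  have := @cdiff_continuous R f psi (fun t => ex_intro _ _ (df (pt t psi))).
  by move=> [_ h]; have := h t; under eq_fun do rewrite fE.
- move=> t; rewrite normrM ger0_norm ?expR_ge0// mul0r addr0.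
  by rewrite ler_piMr ?expR_ge0// sin_max.
Qed.

End rotated_gamma.

Section wright_integral.
Context {R : realType}.
Implicit Types s t x a b c z : R.

Lemma isdX n (u : R) : is_derive u 1 (fun y : R => y ^+ n.+1) (n.+1%:R * u ^+ n).
Proof.
elim: n => [|n IH]; first by rewrite mulr1; exact: isd_id.
under eq_fun do rewrite exprS.
by isd; rewrite mul1r exprS -[n.+2%:R]natr1; ring.
Qed.

Lemma isdX_fact n (u : R) :
  is_derive u 1 (fun y : R => y ^+ n.+1 / n.+1`!%:R) (u ^+ n / n`!%:R).
Proof.
have h := isdX n u; isd; rewrite mulr0 addr0 factS natrM invfM.
by rewrite mulrACA divff ?mul1r// pnatr_eq0.
Qed.

(** Taylor expansion of the imaginary part of exp (i b + x exp (i c)).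
    Differentiating in [x] replaces [b] by [b + c], which is why the induction
    quantifies over [b]. *)
Lemma expR_sin_taylor c (x : R) n : 0 <= x -> forall b,
  `|expR (x * cos c) * sin (b + x * sin c) -
    \sum_(k < n) x ^+ k / k`!%:R * sin (b + k%:R * c)| <= expR x * (x ^+ n / n`!%:R).
Proof.
move=> x0.
pose g b y := expR (y * cos c) * sin (b + y * sin c).
pose T n b y := \sum_(k < n) y ^+ k / k`!%:R * sin (b + k%:R * c).
suff H m : forall b y, 0 <= y -> y <= x -> `|g b y - T m b y| <= expR x * (y ^+ m / m`!%:R).
  by move=> b; exact: H.
elim: m => [b y y0 yx|m IH b y y0 yx].
  rewrite /T big_ord0 subr0 expr0 fact0 divr1 mulr1 /g normrM ger0_norm ?expR_ge0//.
  rewrite -[leRHS]mulr1 ler_pM ?expR_ge0// ?sin_max// ler_expR.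
  by apply: le_trans yx; rewrite ler_piMr// cos_le1.
have dg b' (u : R) : is_derive u 1 (g b') (g (b' + c) u).
  by rewrite /g; isd; rewrite [b' + c + _]addrAC (sinD (b' + u * sin c)); ring.
have dT b' (u : R) : is_derive u 1 (T m.+1 b') (T m (b' + c) u).
  elim: m {IH} => [|m IHm].
    rewrite /T; under eq_fun do rewrite big_ord1 expr0 fact0 divr1 mul1r.
    by rewrite big_ord0; exact: isd_cst.
  have h := isdX_fact m u.
  rewrite (_ : T m.+2 b' = fun y => T m.+1 b' y + y ^+ m.+1 / m.+1`!%:R * sin (b' + m.+1%:R * c)).
    by isd; rewrite mulr0 addr0 /T big_ord_recr /= -natr1; congr (_ + _ * sin _); ring.
  by apply/funext => z; rewrite /T big_ord_recr.
have main (sg : R) : `|sg| = 1 ->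
    sg * (g b y - T m.+1 b y) <= expR x * (y ^+ m.+1 / m.+1`!%:R).
  move=> sg1.
  pose h u := expR x * (u ^+ m.+1 / m.+1`!%:R) - sg * (g b u - T m.+1 b u).
  pose dh u := expR x * (u ^+ m / m`!%:R) - sg * (g (b + c) u - T m (b + c) u).
  have dhE (u : R) : is_derive u 1 h (dh u).
    have d1 := isdX_fact m u; have d2 := dg b u; have d3 := dT b u.
    by rewrite /h; isd; rewrite /dh; ring.
  have ch : {within `[0, y], continuous h}.
    by apply: continuous_subspaceT => u; exact: isd_continuous (dhE u).
  have [u] := @MVT_segment _ h dh 0 y y0 (fun u _ => dhE u) ch.
  rewrite in_itv/= => /andP[u0 uy] E.
  have h0 : h 0 = 0.
    rewrite /h expr0n/= mul0r mulr0 /g !mul0r expR0 addr0 mul1r /T big_ord_recl big1.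
      by rewrite expr0 fact0 mul0r divr1 mul1r !addr0 subrr mulr0 subr0.
    by move=> k _; rewrite expr0n/= !mul0r.
  have : 0 <= h y.
    rewrite -[h y]subr0 -[X in _ - X]h0 E mulr_ge0 ?subr0// /dh subr_ge0.
    apply: le_trans (ler_norm _) _; rewrite normrM sg1 mul1r.
    by apply: IH => //; exact: le_trans yx.
  by rewrite /h subr_ge0.
rewrite ler_norml; apply/andP; split.
  by have := main (-1); rewrite normrN1 mulN1r => /(_ erefl); lra.
by have := main 1; rewrite normr1 mul1r => /(_ erefl).
Qed.

End wright_integral.

(** * An integral representation of the Wright function *)

Section wright_repr.
Context {R : realType}.
Notation mu := (@lebesgue_measure R).
Variables (a m : R).
Hypotheses (a_gt0 : 0 < a) (a_lt1 : a < 1) (m_lt1 : m < 1).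
Implicit Types s t z : R.

(** The angle at which the ray of Hankel's contour is placed: as
    [phi + a * phi = pi], both exp u and exp (- z u^a) decay along it. *)
Definition wright_angle : R := pi / (1 + a).
Local Notation phi := wright_angle.
(** The imaginary part of u^(1 - m) exp (u - z u^a) for u = exp (t + i phi). *)
Definition wright_integrand z t : R :=
  expR ((1 - m) * t - cos (a * phi) * expR t - z * expR (a * t) * cos (a * phi)) *
  sin ((1 - m) * phi + sin (a * phi) * expR t - z * expR (a * t) * sin (a * phi)).

Lemma wright_angle_gt0 : 0 < phi.
Proof. by rewrite divr_gt0 ?pi_gt0// addr_gt0. Qed.

Lemma wright_angle_le_pi : phi <= pi.
Proof. by rewrite ler_pdivrMr ?addr_gt0// ler_peMr ?pi_ge0// lerDl ltW. Qed.

Lemma wright_angle_add : phi + a * phi = pi.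
Proof. by rewrite /wright_angle; field; rewrite gt_eqF// addr_gt0. Qed.

Lemma mul_wright_angle_lt : a * phi < pi / 2.
Proof.
have p0 := wright_angle_gt0; have pa := wright_angle_add.
have : a * phi < phi by rewrite -[ltRHS]mul1r ltr_pM2r.
by move: pa; lra.
Qed.

Lemma mul_wright_angle_gt0 : 0 < a * phi.
Proof. by rewrite mulr_gt0// wright_angle_gt0. Qed.

Lemma cos_wright_angle_gt0 : 0 < cos (a * phi).
Proof.
have := mul_wright_angle_gt0; have := mul_wright_angle_lt; have := pi_gt0 R => ? ? ?.
by apply: cos_gt0_pihalf; apply/andP; split; lra.
Qed.

Let cs_gt0 := cos_wright_angle_gt0.

Lemma continuous_wright_integrand z : continuous (wright_integrand z).
Proof.
move=> t; rewrite /wright_integrand.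
set c := cos _; set d := sin (a * phi).
set b := (1 - m) * phi.
eapply isd_continuous.
isd_rules.
Qed.

Lemma wright_integrand_le z t : 0 <= z ->
  `|wright_integrand z t| <= expR ((1 - m) * t - cos (a * phi) * expR t).
Proof.
move=> z0; rewrite normrM ger0_norm ?expR_ge0//.
apply: (@le_trans _ _ (expR ((1 - m) * t - cos (a * phi) * expR t - z * expR (a * t) * cos (a * phi)))).
  by rewrite ler_piMr ?expR_ge0// sin_max.
by rewrite ler_expR gerDl oppr_le0 !mulr_ge0 ?expR_ge0// ltW.
Qed.

Lemma integrable_wright_integrand z : 0 <= z ->
  mu.-integrable setT (EFin \o wright_integrand z).
Proof.
move=> z0; apply: (@integrable_expR_double R _ (1 - m) (cos (a * phi)) 0 0) => //.
- by rewrite subr_gt0.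
- by apply: continuous_measurable_fun; exact: continuous_wright_integrand.
- by move=> t; rewrite mul0r addr0; exact: wright_integrand_le.
Qed.

Let W t : R := expR ((1 - m) * t - cos (a * phi) * expR t).
Let B t : R := (1 - m) * phi + sin (a * phi) * expR t.
(* the argument of - u^a for u on the ray of angle phi *)
Let g := a * phi + pi.
Let tm z n t : R := W t * ((z * expR (a * t)) ^+ n / n`!%:R * sin (B t + n%:R * g)).

Let continuous_tm z n : continuous (tm z n).
Proof.
move=> t; rewrite /tm /W /B; set c := cos _; set d := sin (a * phi).
set b := (1 - m) * phi; set k := n`!%:R^-1; set l := n%:R * g.
have dX (y : R) : is_derive y 1 (fun y : R => y ^+ n) (n%:R * y ^+ n.-1).
  case: (n) => [|j]; last exact: isdX.
  by under eq_fun do rewrite expr0; rewrite mul0r; exact: isd_cst.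
have dE : exists d', is_derive t 1 (fun t => z * expR (a * t)) d' by eexists; isd_rules.
have [d' hd] := dE.
have h := @isd_comp _ (fun y => y ^+ n) (fun t => z * expR (a * t)) t _ _ (dX _) hd.
eapply isd_continuous; isd_rules.
Qed.

Let exp_sum_le (x : R) n : 0 <= x -> \sum_(k < n) x ^+ k / k`!%:R <= expR x.
Proof.
move=> x0; have nd : nondecreasing_seq (series (exp_coeff x)).
  by apply: nondecreasing_series => k _ _; exact: exp_coeff_ge0.
have := nondecreasing_cvgn_le nd (is_cvg_series_exp_coeff x) n.
by rewrite /series /= big_mkord.
Qed.

Let tm_le z n t : 0 <= z ->
  `|tm z n t| <= expR ((1 - m) * t - cos (a * phi) * expR t + z * expR (a * t)).
Proof.
move=> z0; have x0 : 0 <= z * expR (a * t) by rewrite mulr_ge0// expR_ge0.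
rewrite normrM ger0_norm ?expR_ge0// expRD ler_wpM2l ?expR_ge0// normrM.
have p0 : 0 <= (z * expR (a * t)) ^+ n / n`!%:R by rewrite divr_ge0 ?exprn_ge0.
rewrite (ger0_norm p0) -[leRHS]mulr1 ler_pM// ?sin_max//.
apply: le_trans (exp_sum_le n.+1 x0).
rewrite big_ord_recr /= lerDr sumr_ge0// => k _.
by rewrite divr_ge0 ?exprn_ge0.
Qed.

Let integrable_tm z n : 0 <= z -> mu.-integrable setT (EFin \o tm z n).
Proof.
move=> z0; apply: (@integrable_expR_double R _ (1 - m) (cos (a * phi)) z a) => //.
- by rewrite subr_gt0.
- exact: ltW.
- by apply: continuous_measurable_fun; exact: continuous_tm.
- by move=> t; exact: tm_le.
Qed.

Let wright_term z n : 0 <= z ->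
  (- z) ^+ n * n`!%:R^-1 * (Gamma (- a * n%:R + m))^-1 = pi^-1 * \int[mu]_t tm z n t.
Proof.
move=> z0; pose s := 1 - m + a * n%:R.
have s0 : 0 < s by rewrite ltr_wpDr ?subr_gt0// mulr_ge0// ltW.
rewrite (_ : - a * n%:R + m = 1 - s); last by rewrite /s; ring.
rewrite Gamma_inv//.
have := Gamma_pos_rotated (s * phi) s0 (ltW mul_wright_angle_gt0) mul_wright_angle_lt.
rewrite -mulrDr wright_angle_add => E.
rewrite (mulrC pi s) (mulrC (sin _)) -E.
have tmE t : tm z n t = (- z) ^+ n / n`!%:R *
    (expR (s * t - cos (a * phi) * expR t) * sin (s * phi + sin (a * phi) * expR t)).
  rewrite /tm /W /B.
  have sinE k (y : R) : sin (y + k%:R * pi) = (-1) ^+ k * sin y.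
    elim: k => [|k IH]; first by rewrite mul0r addr0 mul1r.
    by rewrite -natr1 mulrDl mul1r addrA sinDpi IH exprS mulN1r mulNr.
  rewrite (_ : _ + n%:R * g = s * phi + sin (a * phi) * expR t + n%:R * pi); last first.
    by rewrite /g /s; ring.
  rewrite sinE exprMn -expRM_natl (_ : expR (s * t - _) =
    expR ((1 - m) * t - cos (a * phi) * expR t) * expR (n%:R * (a * t))).
    by rewrite [(- z) ^+ n]exprNn; ring.
  by rewrite -expRD; congr expR; rewrite /s; ring.
have i : mu.-integrable setT (EFin \o (fun t =>
    expR (s * t - cos (a * phi) * expR t) * sin (s * phi + sin (a * phi) * expR t))).
  apply: (@integrable_expR_double R _ s (cos (a * phi)) 0 0) => //.
    apply: continuous_measurable_fun => t.
    set c := cos _; set d := sin (a * phi); set b := s * phi.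
    by eapply isd_continuous; isd_rules.
  move=> t; rewrite normrM ger0_norm ?expR_ge0// mul0r addr0.
  by rewrite ler_piMr ?expR_ge0// sin_max.
under [in RHS]eq_Rintegral do rewrite tmE.
by rewrite RintegralZl//; ring.
Qed.

(** Expanded in powers of [z], the integrand yields rotated Gamma integrals,
    which are the coefficients 1 / Gamma (m - a n) by [Gamma_inv].  Sum and
    integral may be exchanged since exp (z exp (a t)) is dominated, [a] being
    less than 1. *)
Lemma wright_integralE z : 0 <= z ->
  wright (- a) m (- z) = pi^-1 * \int[mu]_t wright_integrand z t.
Proof.
move=> z0; rewrite /wright.
pose f N t := \sum_(n < N) tm z n t.
have intf N : mu.-integrable setT (EFin \o f N).
  elim: N => [|N IH].
    rewrite (_ : EFin \o f 0%N = cst 0%E); first exact: integrable0.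
    by apply/funext => t; rewrite /f /= big_ord0.
  have := integrableD measurableT IH (integrable_tm N z0).
  by apply: eq_integrable => // t _; rewrite /f /= big_ord_recr.
have sE N : series (fun n : nat => (- z) ^+ n * n`!%:R^-1 * (Gamma (- a * n%:R + m))^-1) N =
    pi^-1 * \int[mu]_t f N t.
  elim: N => [|N IH].
    rewrite /series/= big_geq// (_ : f 0%N = cst 0); first by rewrite Rintegral_cst// mul0r mulr0.
    by apply/funext => t; rewrite /f /= big_ord0.
  rewrite /series/= big_nat_recr//= -/(series _ N) [X in X + _]IH wright_term// -mulrDr -RintegralD//.
    by congr (_ * _); apply: eq_Rintegral => t _; rewrite /f big_ord_recr.
  exact: integrable_tm.
apply/cvg_lim => //.
rewrite (_ : series _ = fun N => pi^-1 * \int[mu]_t f N t); last exact/funext/sE.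
apply: cvgMl_tmp.
have dom : mu.-integrable setT (EFin \o (fun t => expR ((1 - m) * t - cos (a * phi) * expR t + z * expR (a * t)))).
  apply: (@integrable_expR_double R _ (1 - m) (cos (a * phi)) z a) => //.
  - by rewrite subr_gt0.
  - exact: ltW.
  - apply: continuous_measurable_fun => t.
    by set c := cos _; eapply isd_continuous; isd_rules.
  - by move=> t; rewrite ger0_norm ?expR_ge0.
apply: (@dominated_cvg_Rintegral _ _ _ mu set0 f (wright_integrand z) _ _ _ _ _ _ dom) => //.
- by move=> N; have := measurable_int mu (intf N) => /measurable_EFinP.
- by apply: continuous_measurable_fun; exact: continuous_wright_integrand.
- move=> t _; set x := z * expR (a * t).
  have x0 : 0 <= x by rewrite mulr_ge0// expR_ge0.
  have H N := expR_sin_taylor g N x0 (B t).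
  have fE N : f N t = W t * \sum_(k < N) x ^+ k / k`!%:R * sin (B t + k%:R * g).
    by rewrite /f mulr_sumr.
  have wE : wright_integrand z t = W t * (expR (x * cos g) * sin (B t + x * sin g)).
    by rewrite /wright_integrand -/x /W /B /g cosDpi sinDpi !mulrN mulrA -expRD.
  apply/subr_cvg0; apply: norm_cvg0.
  apply: (squeeze_cvgr (f := cst 0) (h := fun N => W t * expR x * exp_coeff x N)).
  + near=> N; rewrite normr_ge0/= fE wE -mulrBr normrM ger0_norm ?expR_ge0//.
    by rewrite -mulrA ler_wpM2l ?expR_ge0// distrC; exact: H.
  + exact: cvg_cst.
  + by rewrite -[X in _ --> X](mulr0 (W t * expR x)); apply: cvgMl_tmp; exact: cvg_exp_coeff.
- move=> N t; have x0 : 0 <= z * expR (a * t) by rewrite mulr_ge0// expR_ge0.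
  rewrite /f; apply: le_trans (ler_norm_sum _ _ _) _.
  rewrite expRD; apply: (@le_trans _ _ (\sum_(k < N) W t * ((z * expR (a * t)) ^+ k / k`!%:R))).
    apply: ler_sum => k _.
    rewrite normrM ger0_norm ?expR_ge0// ler_wpM2l ?expR_ge0// normrM.
    have p0 : 0 <= (z * expR (a * t)) ^+ k / k`!%:R by rewrite divr_ge0 ?exprn_ge0.
    by rewrite (ger0_norm p0) ler_piMr// sin_max.
  by rewrite -mulr_sumr ler_wpM2l ?expR_ge0// exp_sum_le.
Unshelve. all: end_near. Qed.

End wright_repr.

(** * The Laplace identity for the Wright function *)

Section dexp_mul_cexp_half.
Context {R : realType}.

Lemma dexp_mul_cexp_half (k a x t p : R) :
  dexp k a x (pt t p) * cexp ((2^-1)%:C * pt t p) =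
  (expR ((k + 2^-1) * t - x * (expR (a * t) * cos (a * p))) *
     cos ((k + 2^-1) * p - x * (expR (a * t) * sin (a * p)))) +i*
  (expR ((k + 2^-1) * t - x * (expR (a * t) * cos (a * p))) *
     sin ((k + 2^-1) * p - x * (expR (a * t) * sin (a * p)))).
Proof.
rewrite /dexp -cexpD (_ : _ + _ = 
  ((k + 2^-1) * t - x * (expR (a * t) * cos (a * p))) +i*
  ((k + 2^-1) * p - x * (expR (a * t) * sin (a * p)))) //.
by apply: complex_eq; rewrite !cE /=; ring.
Qed.

End dexp_mul_cexp_half.

Section laplace_wright.
Context {R : realType}.
Local Notation C := R[i].
Local Notation Im := (@complex.Im R).
Notation mu := (@lebesgue_measure R).
Variables (a m x : R).
Hypotheses (a_gt0 : 0 < a) (a_lt1 : a < 1) (m_gt0 : 0 < m) (m_lt1 : m < 1) (x_ge0 : 0 <= x).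
Implicit Types s t : R.
Local Notation phi := (wright_angle a).
Local Notation c := (cos (a * phi)).
Local Notation d := (sin (a * phi)).

Let c_gt0 : 0 < c. Proof. exact: cos_wright_angle_gt0. Qed.

Let A t := 1 + c * expR t.
Let B t := (1 - m) * phi - x * expR (a * t) * d.
Let D t := d * expR t.
Let w t := expR ((1 - m) * t - x * expR (a * t) * c).
Let kf s t := expR (s - A t * expR s) * sin (B t + D t * expR s).

Let A_gt0 t : 0 < A t.
Proof. by rewrite addr_gt0// mulr_gt0// expR_gt0. Qed.

(** On the line of height [phi], 1 - exp w is A - i D; so the Laplace integral
    of the sine is, up to the sign and the weight [w], the imaginary part of the
    quotient evaluated by [residue_integral]. *)
Lemma Im_dexp_sinh_angle t :
  w t * ((A t * sin (B t) + D t * cos (B t)) / (A t ^+ 2 + D t ^+ 2)) =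
  - Im (dexp_sinh (2^-1 - m) a x (pt t phi)).
Proof.
set N := A t ^+ 2 + D t ^+ 2.
have N0 : 0 < N by rewrite ltr_pwDl ?sqr_ge0// exprn_gt0.
have pE : phi = - (a * phi) + pi.
  by have := wright_angle_add a_gt0; lra.
have cphi : cos phi = - c by rewrite [in LHS]pE cosDpi cosN.
have sphi : sin phi = d by rewrite [in LHS]pE sinDpi sinN opprK.
have SE : (twosinh (pt t phi))^-1 =
    - (cexp ((2^-1)%:C * pt t phi) * ((A t / N) +i* (D t / N))).
  have h : 1 - cexp (pt t phi) = A t -i* D t.
    apply: complex_eq; rewrite !cE ?cphi ?sphi /A /D /=; ring.
  have h2 : twosinh (pt t phi) = - (cexp (- ((2^-1)%:C * pt t phi)) * (A t -i* D t)).
    rewrite -h mulrBr mulr1 -cexpD opprB /twosinh; congr (cexp _ - _).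
    by apply: complex_eq; rewrite !cE; field.
  rewrite h2 invrN invfM -cexpN opprK; congr (- (_ * _)).
  by apply: complex_eq; rewrite /= sqrrN// mulNr opprK.
rewrite /dexp_sinh SE mulrN ImN opprK [in RHS]mulrA.
rewrite dexp_mul_cexp_half (_ : 2^-1 - m + 2^-1 = 1 - m); last by field.
rewrite ImM /=.
move: (A t) (D t) N^-1 => A0 D0 N'.
rewrite /w /B !(mulrA x); move: (expR _) (cos _) (sin _) => w0 c0 s0.
by ring.
Qed.

Let measurable_kf : measurable_fun setT (fun p : R * R => kf p.1 p.2 * w p.2).
Proof.
have mw : measurable_fun setT (fun p : R * R => w p.2).
  apply: (@measurableT_comp _ _ _ _ _ _ w) => //.
  apply: continuous_measurable_fun => t; rewrite /w; set e := cos _.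
  by eapply isd_continuous; isd_rules.
have mA : measurable_fun setT (fun p : R * R => A p.2).
  apply: (@measurableT_comp _ _ _ _ _ _ A) => //.
  apply: continuous_measurable_fun => t; rewrite /A; set e := cos _.
  by eapply isd_continuous; isd_rules.
have mB : measurable_fun setT (fun p : R * R => B p.2).
  apply: (@measurableT_comp _ _ _ _ _ _ B) => //.
  apply: continuous_measurable_fun => t; rewrite /B; set e := sin _; set p := wright_angle _.
  by eapply isd_continuous; isd_rules.
have mD : measurable_fun setT (fun p : R * R => D p.2).
  apply: (@measurableT_comp _ _ _ _ _ _ D) => //.
  apply: continuous_measurable_fun => t; rewrite /D; set e := sin _.
  by eapply isd_continuous; isd_rules.
have mE : measurable_fun setT (fun p : R * R => expR p.1) by exact: measurableT_comp.
have mexp (f : R * R -> R) : measurable_fun setT f -> measurable_fun setT (fun p => expR (f p)).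
  by move=> mf; exact: measurableT_comp.
have msin (f : R * R -> R) : measurable_fun setT f -> measurable_fun setT (fun p => sin (f p)).
  move=> mf; apply: (@measurableT_comp _ _ _ _ _ _ (@sin R)) => //.
  by apply: continuous_measurable_fun; exact: continuous_sin.
apply: measurable_funM => //; apply: measurable_funM.
  apply: mexp; apply: measurable_funB => //; exact: measurable_funM.
apply: msin; apply: measurable_funD => //; exact: measurable_funM.
Qed.

Let F (p : R * R) : \bar R := (kf p.1 p.2 * w p.2)%:E.

Let measurable_F : measurable_fun setT F.
Proof. by apply/measurable_EFinP; exact: measurable_kf. Qed.

Let integrable_F : (mu \x mu)%E.-integrable setT F.
Proof.
apply/integrable21ltyP => //.
have bnd t : (\int[mu]_s `|F (s, t)| <= (w t / A t)%:E)%E.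
  apply: (@le_trans _ _ (\int[mu]_s ((w t)%:E * (expR (s - A t * expR s))%:E))%E).
    apply: ge0_le_integral => //.
    - apply/measurable_EFinP; apply: measurableT_comp => //.
      exact: (measurableT_comp measurable_kf (measurable_pair2 t)).
    - under eq_fun do rewrite -EFinM.
      apply/measurable_EFinP; apply: continuous_measurable_fun => s.
      set e := w t; set f := A t; by eapply isd_continuous; isd_rules.
    - move=> s _; rewrite -EFinM lee_fin /= normrM mulrC (ger0_norm (expR_ge0 _)).
      by rewrite ler_wpM2l ?expR_ge0// normrM ger0_norm ?expR_ge0// ler_piMr ?expR_ge0// sin_max.
  rewrite ge0_integralZl//; first by rewrite laplace_exp.
    apply/measurable_EFinP; apply: continuous_measurable_fun => s.
    set f := A t; by eapply isd_continuous; isd_rules.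
  by rewrite lee_fin expR_ge0.
(* the numerator w t is at most exp ((1 - m) t), and A t at least c and
   c exp t *)
have wA t : w t / A t <= c^-1 * expR (- (Num.min m (1 - m) * `|t|)).
  have c1 : c <= 1 by exact: cos_le1.
  have A1 : c <= A t by rewrite ler_wpDr// mulr_ge0// ?expR_ge0// ltW.
  have A2 : c * expR t <= A t by rewrite lerDr.
  have W : w t <= expR ((1 - m) * t).
    by rewrite ler_expR gerDl oppr_le0 !mulr_ge0 ?expR_ge0// ltW.
  rewrite ler_pdivrMr// -mulrA ler_pdivlMl// mulrC.
  have [t0|t0] := leP 0 t.
    apply: (@le_trans _ _ (expR (- (m * t)) * (c * expR t))).
      rewrite [leRHS]mulrCA -expRD [leLHS]mulrC ler_wpM2l//; first exact: ltW.
      by apply: le_trans W _; rewrite ler_expR mulrBl mul1r addrC.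
    apply: ler_pM => //; rewrite ?expR_ge0// ?mulr_ge0 ?expR_ge0//; first exact: ltW.
    by rewrite ler_expR lerN2 ger0_norm// ler_wpM2r// ge_min lexx.
  apply: (@le_trans _ _ (expR (- ((1 - m) * `|t|)) * c)).
    rewrite ler_wpM2r//; first exact: ltW.
    by apply: le_trans W _; rewrite ler0_norm ?(ltW t0)// mulrN opprK.
  apply: ler_pM => //; rewrite ?expR_ge0//; first exact: ltW.
  by rewrite ler_expR lerN2 ler_wpM2r// ge_min lexx orbT.
have cw : continuous w.
  move=> t; rewrite /w; set e := cos _; by eapply isd_continuous; isd_rules.
have cA : continuous A.
  move=> t; rewrite /A; set e := cos _; by eapply isd_continuous; isd_rules.
have mwA : measurable_fun setT (fun t => w t / A t).
  apply: continuous_measurable_fun => t.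
  by apply: continuousM; [exact: cw|apply: continuousV; [rewrite gt_eqF|exact: cA]].
have iwA : mu.-integrable setT (EFin \o (fun t => w t / A t)).
  apply: (@integrable_le_expR _ _ (c^-1) (Num.min m (1 - m))) => //.
    by rewrite lt_min m_gt0 subr_gt0.
  by move=> t; rewrite ger0_norm ?wA// divr_ge0 ?expR_ge0// ltW.
have : (\int[mu]_t \int[mu]_s `|F (s, t)| <= \int[mu]_t (w t / A t)%:E)%E.
  apply: ge0_le_integral => //.
  - by move=> t _; apply: integral_ge0 => s _.
  - apply: (@measurable_fun_fubini_tonelli_G _ _ _ _ R mu (abse \o F)) => //.
      exact: measurableT_comp.
    by move=> p; exact: abse_ge0.
  - exact: (measurable_int _ iwA).
move=> /le_lt_trans; apply.
exact: integrable_lty iwA.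
Qed.

Let h s := expR (m * s - expR s) * wright (- a) m (- (x * expR (- (a * s)))).

Let integrandE s t : expR (m * s - expR s) *
  wright_integrand a m (x * expR (- (a * s))) (t + s) = kf s t * w t.
Proof.
have ex : x * expR (- (a * s)) * expR (a * (t + s)) = x * expR (a * t).
  by rewrite -mulrA -expRD; congr (_ * expR _); ring.
rewrite /wright_integrand ex /kf [RHS]mulrAC mulrA -!expRD (expRD t s) /A /B /D /w.
by congr (expR _ * sin _); ring.
Qed.

Let x_exp_ge0 s : 0 <= x * expR (- (a * s)).
Proof. by rewrite mulr_ge0 ?expR_ge0. Qed.

Let integrable_slice s : mu.-integrable setT (fun t => F (s, t)).
Proof.
have mi z : measurable_fun setT (fun t => wright_integrand a m z t).
  by apply: continuous_measurable_fun; exact: continuous_wright_integrand.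
have ms z : measurable_fun setT (fun t => wright_integrand a m z (t + s)).
  apply: continuous_measurable_fun => t.
  apply: (@continuous_comp _ _ _ (fun t => t + s) (wright_integrand a m z)).
    by eapply isd_continuous; isd_rules.
  exact: continuous_wright_integrand.
have : mu.-integrable setT (EFin \o (fun t => wright_integrand a m (x * expR (- (a * s))) (t + s))).
  apply/integrableP; split; first by apply/measurable_EFinP; exact: ms.
  have /integrableP[_] := integrable_wright_integrand a_gt0 a_lt1 m_lt1 (x_exp_ge0 s).
  rewrite (@ge0_integral_shift _ s)//.
  by apply/measurable_EFinP; apply: measurableT_comp => //; exact: mi.
move=> /(integrableZl measurableT (expR (m * s - expR s))).
apply: eq_integrable => // t _.
by rewrite /= -EFinM integrandE.
Qed.

Let hE s : (h s)%:E = ((pi^-1)%:E * fubini_F mu F s)%E.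
Proof.
rewrite /h wright_integralE//.
rewrite (@integral_shift _ s); last first.
  by apply: continuous_measurable_fun; exact: continuous_wright_integrand.
rewrite mulrCA EFinM; congr (_ * _)%E.
have i := integrable_slice s.
have is_ : mu.-integrable setT (EFin \o (fun t => wright_integrand a m (x * expR (- (a * s))) (t + s))).
  have := integrableZl measurableT (expR (m * s - expR s))^-1 i.
  apply: eq_integrable => // t _.
  rewrite /F /= -EFinM -integrandE mulKf//.
  by rewrite gt_eqF// expR_gt0.
rewrite -RintegralZl// /Rintegral.
rewrite fineK; last first.
  apply: integrable_fin_num => //.
  by apply: eq_integrable i => // t _; rewrite /F /= integrandE.
by apply: eq_integral => t _; rewrite /F /= integrandE.
Qed.

Lemma integrable_laplace_wright : mu.-integrable setT (EFin \o h).
Proof.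
have := integrableZl measurableT (pi^-1) (integrable_fubini_F integrable_F).
by apply: eq_integrable => // s _; rewrite /= hE.
Qed.

(** In the variable y = exp s this is the integral over the half line of
    y^(m - 1) exp (- y) W(- x y^(- a)).  Once the integral representation of W
    is inserted and translated by [s], the integral over [s] is that of
    [laplace_sin], and the remaining one is [residue_integral]. *)
Lemma laplace_wright : (\int[mu]_s (h s)%:E = (expR (- x))%:E)%E.
Proof.
under eq_integral do rewrite hE.
rewrite integralZl//; last exact: integrable_fubini_F.
rewrite (integral12_prod_meas1 integrable_F) -(integral21_prod_meas1 integrable_F).
have k2 : `|2^-1 - m| < 2^-1.
  by rewrite ltr_norml ltrBrDl gtrDl oppr_lt0 m_gt0 andbT; move: m_lt1; lra.
have ap := mul_wright_angle_lt a_gt0 a_lt1.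
have p0 := wright_angle_gt0 a_gt0.
have ir := integrable_residue k2 (ltW a_gt0) x_ge0 p0 (wright_angle_le_pi a_gt0) ap.
have rv := residue_integral k2 (ltW a_gt0) x_ge0 p0 (wright_angle_le_pi a_gt0) ap.
have -> : (\int[mu]_t fubini_G mu F t = \int[mu]_t (- (Im (dexp_sinh (2^-1 - m) a x (pt t phi)))%:E))%E.
  apply: eq_integral => t _.
  rewrite -EFinN -Im_dexp_sinh_angle /fubini_G /F /=.
  have [i E] := laplace_sin (B t) (D t) (A_gt0 t).
  rewrite -E EFinM /Rintegral fineK; last exact: integrable_fin_num.
  rewrite -integralZl//; apply: eq_integral => s _.
  by rewrite -EFinM mulrC.
rewrite integralN//; last by rewrite integrable_add_def.
have E : (\int[mu]_t (Im (dexp_sinh (2^-1 - m) a x (pt t phi)))%:E = (- (pi * expR (- x)))%:E)%E.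
  by rewrite -rv /Rintegral fineK//; exact: integrable_fin_num ir.
rewrite E -EFinN -EFinM opprK mulKf// gt_eqF// pi_gt0//.
Qed.

End laplace_wright.

(** * Uniqueness of the law of V when V and a V + Y have the same law *)

Section contraction.
Context {R : realType}.
Implicit Types (g : R -> R) (k : R).

(** Test functions: the bounds make them integrable for every probability, and
    [k] controls how far they are from being constant. *)
Definition lipschitz01 k g :=
  [/\ 0 <= k, forall v, 0 <= g v <= 1 & forall u v, `|g u - g v| <= k * `|u - v|].

Lemma lipschitz01_measurable k g : lipschitz01 k g -> measurable_fun setT g.
Proof.
move=> [k0 _ gk]; apply: continuous_measurable_fun => x.
have k1 : 0 < k + 1 by rewrite ltr_wpDl.
apply/cvgrPdist_le => e e0; near=> y.
apply: le_trans (gk _ _) _; apply: (@le_trans _ _ ((k + 1) * `|x - y|)).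
  by rewrite ler_wpM2r// lerDl.
rewrite mulrC -ler_pdivlMr//; near: y.
have : id @ x --> x by exact: cvg_id.
by move=> /cvgrPdist_le; apply; rewrite divr_gt0.
Unshelve. all: end_near. Qed.

Section integrable01.
Context d (T : measurableType d) (P : probability T R).

Lemma integrable01 (f : T -> R) : measurable_fun setT f ->
  (forall w, 0 <= f w <= 1) -> P.-integrable setT (EFin \o f).
Proof.
move=> mf f01; apply: measurable_bounded_integrable => //.
  exact: fin_num_fun_lty.
exists 1; split => // y y1 w _ /=; have /andP[f0 f1] := f01 w.
by rewrite ger0_norm//; apply: le_trans f1 (ltW y1).
Qed.

Lemma Rintegral_cst_probability (r : R) : \int[P]_w (r : R) = r.
Proof.
rewrite Rintegral_cst//.
rewrite -[RHS]mulr1; congr (_ * _).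
exact: (congr1 fine (probability_setT P)).
Qed.

Lemma lipschitz01_integrable k g (V : T -> R) : lipschitz01 k g ->
  measurable_fun setT V -> P.-integrable setT (EFin \o (g \o V)).
Proof.
move=> gk mV; apply: integrable01; last by move=> w; have [_ h _] := gk; exact: h.
by apply: measurableT_comp => //; exact: lipschitz01_measurable gk.
Qed.

(** As its Lipschitz constant tends to 0, [g_ n] flattens, so that its mean is
    asymptotically its value at 0. *)
Lemma cvg_lipschitz01 (V : T -> R) (g_ : nat -> R -> R) k a (I : R) :
  measurable_fun setT V -> 0 <= a -> a < 1 ->
  (forall n, lipschitz01 (k * a ^+ n) (g_ n)) ->
  (forall n, \int[P]_w g_ n (V w) = I) -> g_ ^~ 0 @ \oo --> I.
Proof.
move=> mV a0 a1 gk gI.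
have mg n : measurable_fun setT (fun w => g_ n (V w)).
  by apply: measurableT_comp => //; exact: lipschitz01_measurable (gk n).
have L : (fun n => \int[P]_w (g_ n (V w) - g_ n 0)) @ \oo --> \int[P]_w (0 : R).
  apply: (@dominated_cvg_Rintegral _ _ _ P set0 _ _ (cst 1)) => //.
  - by move=> n; apply: measurable_funB.
  - move=> w _; apply: norm_cvg0.
    have h : (fun n => k * a ^+ n * `|V w|) @ \oo --> (0 : R).
      rewrite -(mul0r `|V w|); apply: cvgMl; rewrite -(mulr0 k); apply: cvgMr.
      by apply: cvg_expr; rewrite ger0_norm.
    apply: (squeeze_cvgr _ (cvg_cst 0) h); apply: nearW => n /=.
    have [_ _ gl] := gk n; rewrite normr_ge0 /=.
    by apply: le_trans (gl _ _) _; rewrite subr0.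
  - exact: finite_measure_integrable_cst.
  - move=> n w; have [_ g01 _] := gk n.
    have /andP[? ?] := g01 (V w); have /andP[? ?] := g01 0.
    by rewrite ler_norml /=; lra.
have E n : \int[P]_w (g_ n (V w) - g_ n 0) = I - g_ n 0.
  rewrite RintegralB//; last exact: finite_measure_integrable_cst.
    by rewrite gI Rintegral_cst_probability.
  exact: lipschitz01_integrable (gk n) mV.
move: L; under eq_fun do rewrite E; rewrite Rintegral_cst// mul0r => L.
have : (fun n => I - (I - g_ n 0)) @ \oo --> I - 0.
  by apply: cvgB => //; exact: cvg_cst.
by rewrite subr0; under eq_fun do rewrite subKr.
Qed.

End integrable01.
Section affine_step.
Context d0 (T0 : measurableType d0) (Q : probability T0 R) (Y : T0 -> R) (a : R).
Hypotheses (mY : measurable_fun setT Y) (a0 : 0 <= a) (a1 : a < 1).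

(** The conditional expectation of g (a V + Y) given V = v, for V independent of
    Y. *)
Definition affine_step g v := \int[Q]_w g (a * v + Y w).

Let step_integrable k g v : lipschitz01 k g ->
  Q.-integrable setT (EFin \o (fun w => g (a * v + Y w))).
Proof.
move=> gk; apply: (lipschitz01_integrable Q (V := fun w => a * v + Y w) gk).
exact: measurable_funD.
Qed.

Lemma lipschitz01_affine_step k g :
  lipschitz01 k g -> lipschitz01 (k * a) (affine_step g).
Proof.
move=> gk; have [k0 g01 gl] := gk; split.
- exact: mulr_ge0.
- move=> v; rewrite Rintegral_ge0 /=; last by move=> w _; have /andP[] := g01 (a * v + Y w).
  rewrite -[leRHS](_ : \int[Q]_w 1 = 1); last first.
    by rewrite Rintegral_cst_probability.
  apply: le_Rintegral => //; first exact: step_integrable gk.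
    exact: finite_measure_integrable_cst.
  by move=> w _; have /andP[] := g01 (a * v + Y w).
- move=> u v; rewrite /affine_step -RintegralB//; try exact: step_integrable gk.
  have i := integrableB measurableT (step_integrable u gk) (step_integrable v gk).
  apply: le_trans (le_normr_Rintegral measurableT _) _; first exact: i.
  rewrite -[leRHS](_ : \int[Q]_w (k * a * `|u - v|) = _); last first.
    by rewrite Rintegral_cst_probability.
  apply: le_Rintegral => //; first exact: (integrable_norm i).
    exact: finite_measure_integrable_cst.
  move=> w _; apply: le_trans (gl _ _) _.
  rewrite (_ : _ - _ = a * (u - v)); last by ring.
  by rewrite normrM (ger0_norm a0) mulrA.
Qed.

(** Iterating the step preserves the integrals of [g] along [V1] and [V2] and
    multiplies its Lipschitz constant by [a] each time; hence both integrals are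
    the limit of the same sequence of values at 0. *)
Theorem affine_step_unique d1 (T1 : measurableType d1) (P1 : probability T1 R)
    d2 (T2 : measurableType d2) (P2 : probability T2 R) (V1 : T1 -> R) (V2 : T2 -> R) :
  measurable_fun setT V1 -> measurable_fun setT V2 ->
  (forall k g, lipschitz01 k g -> \int[P1]_w g (V1 w) = \int[P1]_w affine_step g (V1 w)) ->
  (forall k g, lipschitz01 k g -> \int[P2]_w g (V2 w) = \int[P2]_w affine_step g (V2 w)) ->
  forall k g, lipschitz01 k g -> \int[P1]_w g (V1 w) = \int[P2]_w g (V2 w).
Proof.
move=> mV1 mV2 h1 h2 k g gk.
pose g_ n := iter n affine_step g.
have gk_ n : lipschitz01 (k * a ^+ n) (g_ n).
  elim: n => [|n IH]; first by rewrite expr0 mulr1.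
  by rewrite exprSr mulrA; exact: lipschitz01_affine_step.
have c1 : g_ ^~ 0 @ \oo --> \int[P1]_w g (V1 w).
  apply: (cvg_lipschitz01 mV1 a0 a1 gk_).
  by elim=> [//|n IH]; rewrite /= -(h1 _ _ (gk_ n)).
have c2 : g_ ^~ 0 @ \oo --> \int[P2]_w g (V2 w).
  apply: (cvg_lipschitz01 mV2 a0 a1 gk_).
  by elim=> [//|n IH]; rewrite /= -(h2 _ _ (gk_ n)).
exact: (cvg_unique _ c1 c2).
Qed.

End affine_step.
End contraction.

(** * Lipschitz functions determine laws *)

Section lipschitz_determining.
Context {R : realType}.

(** For large [k], a Lipschitz approximation of the indicator of the half line
    beyond [x]. *)
Definition ramp (k x v : R) := Num.max 0 (Num.min 1 (k * (v - x))).

Lemma lipschitz01_ramp k x : 0 <= k -> lipschitz01 k (ramp k x).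
Proof.
move=> k0; split=> // [v|u v]; rewrite /ramp /Num.max /Num.min.
  by do 2 case: ifPn; rewrite -?leNgt => *; apply/andP; split; lra.
have : `|k * (u - x) - k * (v - x)| = k * `|u - v|.
  by rewrite -mulrBr normrM ger0_norm//; congr (_ * `|_|); ring.
move: (k * (u - x)) (k * (v - x)) (k * `|u - v|) => p q e <-.
have := ler_norm (p - q); have := ler_norm (- (p - q)); rewrite normrN.
move: `|p - q| => f h1 h2.
by do 4 case: ifPn; rewrite -?leNgt => *; rewrite ler_norml; apply/andP; split; lra.
Qed.

Lemma cvg_ramp x v : (fun n : nat => ramp n.+1%:R x v) @ \oo --> (\1_(`]x, +oo[%classic) v : R).
Proof.
have [xv|vx] := ltP x v.
  rewrite indicE mem_set/= ?in_itv/= ?xv//; apply: cvg_near_cst; near=> n.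
  rewrite /ramp min_l ?max_r// -ler_pdivrMr ?subr_gt0// mul1r.
  near: n; exists (Num.truncn (v - x)^-1) => // n /= h.
  by rewrite (le_trans (ltW (truncnS_gt _)))// ler_nat.
rewrite indicE memNset/=; last by rewrite in_itv/= andbT; apply/negP; rewrite -leNgt.
apply: cvg_near_cst; apply: nearW => n.
have h : n.+1%:R * (v - x) <= 0 by rewrite mulr_ge0_le0// subr_le0.
by rewrite /ramp min_r ?max_l// (le_trans h).
Unshelve. all: end_near. Qed.

Section halfline.
Context d (T : measurableType d) (P : probability T R) (V : T -> R).
Hypothesis mV : measurable_fun setT V.

Lemma cvg_Rintegral_ramp x : (fun n : nat => \int[P]_w ramp n.+1%:R x (V w)) @ \oo -->
  fine (P (V @^-1` `]x, +oo[)).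
Proof.
have mI : measurable (V @^-1` `]x, +oo[) by rewrite -[X in measurable X]setTI; exact: mV.
have -> : fine (P (V @^-1` `]x, +oo[)) = \int[P]_w (\1_(`]x, +oo[%classic) (V w) : R).
  rewrite /Rintegral; congr fine.
  have := integral_indic P measurableT mI; rewrite setIT => <-.
  by apply: eq_integral => w _.
have mr n : measurable_fun setT (fun w => ramp n.+1%:R x (V w)).
  apply: measurableT_comp => //.
  by apply: (@lipschitz01_measurable _ n.+1%:R); exact: lipschitz01_ramp.
apply: (@dominated_cvg_Rintegral _ _ _ P set0 _ _ (cst 1)) => //.
- by apply: measurableT_comp => //; exact: measurable_indic.
- by move=> w _; exact: cvg_ramp.
- exact: finite_measure_integrable_cst.
- move=> n w; have [_ h _] := lipschitz01_ramp x (ler0n R n.+1).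
  by have /andP[h0 h1] := h (V w); rewrite ger0_norm.
Qed.
End halfline.

Lemma lipschitz01_determining d1 (T1 : measurableType d1) (P1 : probability T1 R)
    d2 (T2 : measurableType d2) (P2 : probability T2 R) (V1 : T1 -> R) (V2 : T2 -> R) :
  measurable_fun setT V1 -> measurable_fun setT V2 ->
  (forall k g, lipschitz01 k g -> \int[P1]_w g (V1 w) = \int[P2]_w g (V2 w)) ->
  forall B, measurable B -> P1 (V1 @^-1` B) = P2 (V2 @^-1` B).
Proof.
move=> mV1 mV2 h B mB.
have half x : P1 (V1 @^-1` `]x, +oo[) = P2 (V2 @^-1` `]x, +oo[).
  have c1 := @cvg_Rintegral_ramp _ _ P1 _ mV1 x; have c2 := @cvg_Rintegral_ramp _ _ P2 _ mV2 x.
  have e : fine (P1 (V1 @^-1` `]x, +oo[)) = fine (P2 (V2 @^-1` `]x, +oo[)).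
    apply: (cvg_unique _ _ c2) => //; move: c1.
    by under eq_fun do rewrite (h _ _ (lipschitz01_ramp x (ler0n R _))).
  rewrite -[LHS]fineK ?e ?fineK//; apply: fin_num_measure.
    by rewrite -[X in measurable X]setTI; exact: mV2.
  by rewrite -[X in measurable X]setTI; exact: mV1.
have fin1 (n : nat) : (P1 (V1 @^-1` `](- n%:R)%R, +oo[%classic) < +oo)%E.
  rewrite -ge0_fin_numE//; apply: fin_num_measure.
  by rewrite -[X in measurable X]setTI; exact: mV1.
pose m1 := measure_function_pushforward__canonical__measure_function_Measure P1 mV1.
pose m2 := measure_function_pushforward__canonical__measure_function_Measure P2 mV2.
have := @measure_unique _ R R (@RGenOInfty.G R) (fun n => `]- n%:R, +oo[%classic)
  (@RGenOInfty.measurableE R).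
move=> /(_ _ _ _ m1 m2 _ _ B mB); apply.
- move=> _ _ [x ->] [y ->]; exists (Num.max x y).
  by apply/seteqP; split => z /=; rewrite !in_itv/= !andbT gt_max => /andP.
- by move=> n; exists (- n%:R).
- apply/seteqP; split => // z _; exists (Num.truncn `|z|).+1 => //=.
  rewrite in_itv/= andbT ltrNl; apply: le_lt_trans (truncnS_gt `|z|).
  by rewrite -normrN ler_norm.
- by move=> _ [x ->]; exact: half.
- exact: fin1.
Qed.

End lipschitz_determining.

(** * The logarithm of the absolute value of a normal variable *)

Section fold.
Context {R : realType}.
Notation mu := (@lebesgue_measure R).
Local Open Scope ereal_scope.

Lemma measurable_oppr_fun (f : R -> \bar R) : measurable_fun setT f ->
  measurable_fun setT (fun x : R => f (- x)%R).
Proof. by move=> mf; exact: measurableT_comp. Qed.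

Lemma ge0_integral_fold (f : R -> \bar R) :
  measurable_fun setT f -> (forall x, 0 <= f x) ->
  \int[mu]_x f x = \int[mu]_(x in `]0%R, +oo[) (f x + f (- x)%R).
Proof.
move=> mf f0; have mfN := measurable_oppr_fun mf.
have E : [set: R] = `]-oo, 0%R] `|` `]0%R, +oo[.
  apply/seteqP; split => // x _ /=; rewrite !in_itv/= andbT.
  by have [|] := leP x 0%R; [left|right].
rewrite {1}E ge0_integral_setU//; last 2 first.
  - by rewrite -E.
  - apply/disj_setPS => x /=; rewrite !in_itv/= andbT => -[x0 x1].
    by move: (lt_le_trans x1 x0); rewrite ltxx.
rewrite ge0_integralD//; last 2 first.
  - exact: measurable_funTS.
  - exact: measurable_funTS.
rewrite addeC; congr (_ + _).
rewrite integral_itv_obnd_cbnd; last exact: measurable_funTS.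
rewrite ge0_integration_by_substitution0//.
by apply: eq_integral => x _; rewrite opprK.
Qed.

End fold.

Section ln_abs_normal.
Context {R : realType}.
Notation mu := (@lebesgue_measure R).
Notation pdf := (normal_pdf (0 : R) 1).
Implicit Types t : R.

Definition ln_abs (x : R) := ln `|x|.

Lemma measurable_ln_abs : measurable_fun setT ln_abs.
Proof. by apply: measurableT_comp => //; exact: measurable_ln. Qed.

(** The density of ln |N| for a standard normal variable N. *)
Definition ln_abs_normal_pdf t : R := 2 * pdf (expR t) * expR t.

Lemma normal_pdfN x : pdf (- x) = pdf x.
Proof. by rewrite !normal_pdfE ?oner_neq0// /normal_fun !subr0 sqrrN. Qed.

Lemma ln_abs_normal_pdf_ge0 t : 0 <= ln_abs_normal_pdf t.
Proof. by rewrite !mulr_ge0 ?expR_ge0 ?normal_pdf_ge0. Qed.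

Lemma ln_abs_normal_pdfE t : ln_abs_normal_pdf t = 2 * normal_peak 1 * expR (t - expR (2 * t) / 2).
Proof.
rewrite /ln_abs_normal_pdf normal_pdfE ?oner_neq0// /normal_fun subr0 expr1n -mulrA -mulrA -mulrA -expRD.
by rewrite -expRM_natl mulNr [(- _ + t)%R]addrC.
Qed.

Lemma measurable_ln_abs_normal_pdf : measurable_fun setT ln_abs_normal_pdf.
Proof.
apply: measurable_funM => //; apply: measurable_funM => //.
apply: measurableT_comp => //; exact: measurable_normal_pdf.
Qed.

Lemma ge0_integral_normal (f : R -> \bar R) :
  measurable_fun setT f -> (forall x, 0 <= f x)%E ->
  (\int[normal_prob (0 : R) 1]_x f x =
   \int[mu]_t ((f (expR t) + f (- expR t)%R) * (2^-1 * ln_abs_normal_pdf t)%:E))%E.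
Proof.
move=> mf f0.
have mp : measurable_fun setT (EFin \o pdf).
  by apply/measurable_EFinP; exact: measurable_normal_pdf.
have p0 x : (0 <= (pdf x)%:E)%E by rewrite lee_fin normal_pdf_ge0.
rewrite (@ge0_integral_density _ (measurableTypeR R) R mu (normal_prob 0 1) pdf
  (measurable_normal_pdf 0 1) (normal_pdf_ge0 0 1) (fun A _ => erefl) f)//.
have mfp : measurable_fun setT (fun x => f x * (pdf x)%:E)%E by exact: emeasurable_funM.
have fp0 x : (0 <= f x * (pdf x)%:E)%E by rewrite mule_ge0.
rewrite [LHS](ge0_integral_fold mfp fp0) ge0_integral_expR//; last 2 first.
  - by apply: emeasurable_funD => //; exact: measurable_oppr_fun mfp.
  - by move=> x; rewrite adde_ge0.
apply: eq_integral => t _.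
rewrite normal_pdfN -ge0_muleDl// -muleA -EFinM /ln_abs_normal_pdf; congr (_ * _%:E)%E; by field.
Qed.

Lemma ge0_integral_ln_abs_normal (f : R -> \bar R) :
  measurable_fun setT f -> (forall x, 0 <= f x)%E ->
  (\int[normal_prob (0 : R) 1]_x f (ln_abs x) = \int[mu]_t (f t * (ln_abs_normal_pdf t)%:E))%E.
Proof.
move=> mf f0; rewrite (@ge0_integral_normal (fun x => f (ln_abs x)))//; last first.
  by apply: measurableT_comp => //; exact: measurable_ln_abs.
apply: eq_integral => t _.
rewrite /ln_abs normrN ger0_norm ?expR_ge0// expRK.
have h0 : (0 <= (2^-1 * ln_abs_normal_pdf t)%:E)%E by rewrite lee_fin mulr_ge0// ln_abs_normal_pdf_ge0.
rewrite ge0_muleDl// -ge0_muleDr//; rewrite -EFinD; congr (_ * _%:E)%E; by field.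
Qed.

End ln_abs_normal.

(** * The normal law solves the equation *)

Section ln_density.
Context {R : realType}.
Notation mu := (@lebesgue_measure R).
Variable alpha : R.
Hypotheses (alpha_gt0 : 0 < alpha) (alpha_lt1 : alpha < 1)
  (mrho : measurable_fun setT (rhoX alpha)) (rho0 : forall x, 0 <= rhoX alpha x).
Implicit Types t v : R.

(** The density of ln X. *)
Definition ln_X_pdf t := rhoX alpha (expR t) * expR t.

Lemma ln_X_pdf_ge0 t : 0 <= ln_X_pdf t.
Proof. by rewrite mulr_ge0 ?expR_ge0. Qed.

Lemma measurable_ln_X_pdf : measurable_fun setT ln_X_pdf.
Proof. by apply: measurable_funM => //; exact: measurableT_comp. Qed.

Let two_powR (y : R) : 2 `^ y = expR (y * ln 2).
Proof. by rewrite /powR pnatr_eq0. Qed.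

Let half_expR : 2^-1 = expR (- ln 2) :> R.
Proof. by rewrite expRN lnK// posrE. Qed.

Let measurable_prod t : measurable_fun setT (fun v => ln_X_pdf (t - alpha * v) * ln_abs_normal_pdf v).
Proof.
apply: measurable_funM; last exact: measurable_ln_abs_normal_pdf.
apply: measurableT_comp; first exact: measurable_ln_X_pdf.
by apply: measurable_funB => //; exact: measurable_funM.
Qed.

Let prodE t s : let v := 2^-1 * s + 2^-1 * ln 2 in
  ln_X_pdf (t - alpha * v) * ln_abs_normal_pdf v * 2^-1 =
  2 * normal_peak 1 * expR t *
  (expR ((1 - alpha) / 2 * s - expR s) *
   wright (- alpha) ((1 - alpha) / 2) (- (expR (2 * t) / 2 * expR (- (alpha * s))))).
Proof.
move=> v; rewrite /ln_X_pdf /rhoX expR_gt0 ln_abs_normal_pdfE.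
have -> : expR (2 * v) / 2 = expR s.
  by rewrite half_expR -expRD; congr expR; rewrite /v; field.
have -> : 2 `^ (alpha - 1) * expR (t - alpha * v) ^+ 2 = expR (2 * t) / 2 * expR (- (alpha * s)).
  by rewrite two_powR half_expR -expRM_natl -!expRD; congr expR; rewrite /v; field.
move: (wright _ _ _) => W; rewrite -[RHS]mulrA.
have -> : expR t * (expR ((1 - alpha) / 2 * s - expR s) * W) =
    expR ((1 + alpha) / 2 * ln 2) * expR (t - alpha * v) * expR (v - expR s) * expR (- ln 2) * W.
  by rewrite mulrA -!expRD; congr (expR _ * _); rewrite /v; field.
rewrite two_powR half_expR; ring.
Qed.

(** The densities of ln |N| and alpha ln |N| + ln X agree.  With the variable
    s = 2 v - ln 2 this is [laplace_wright] for m = (1 - alpha) / 2 and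
    x = exp (2 t) / 2. *)
Lemma ln_abs_normal_pdf_fixed t :
  (\int[mu]_v (ln_X_pdf (t - alpha * v) * ln_abs_normal_pdf v)%:E = (ln_abs_normal_pdf t)%:E)%E.
Proof.
have m0 : 0 < (1 - alpha) / 2 by rewrite divr_gt0// subr_gt0.
have m1 : (1 - alpha) / 2 < 1 by move: alpha_gt0; lra.
have x0 : 0 <= expR (2 * t) / 2 by rewrite divr_ge0 ?expR_ge0.
rewrite (@ge0_integral_affine _ (2^-1) (2^-1 * ln 2))//; last 2 first.
- by apply/measurable_EFinP; exact: measurable_prod.
- by move=> v; rewrite lee_fin mulr_ge0 ?ln_X_pdf_ge0 ?ln_abs_normal_pdf_ge0.
have i := integrable_laplace_wright alpha_gt0 alpha_lt1 m0 m1 x0.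
have := integralZl measurableT i (2 * normal_peak 1 * expR t).
have E : 2 * normal_peak 1 * expR t * expR (- (expR (2 * t) / 2)) = ln_abs_normal_pdf t.
  by rewrite -mulrA -expRD ln_abs_normal_pdfE.
rewrite /comp /= laplace_wright// -EFinM E => <-.
by apply: eq_integral => s _; rewrite -!EFinM; congr EFin; exact: prodE.
Qed.


Section fixed_point.
Context d0 (T0 : measurableType d0) (Q : probability T0 R) (Y : T0 -> R).
Hypotheses (mY : measurable_fun setT Y)
  (lawY : forall f : R -> \bar R, measurable_fun setT f -> (forall x, 0 <= f x)%E ->
    (\int[Q]_w f (Y w) = \int[mu]_t (f t * (ln_X_pdf t)%:E))%E).

Lemma affine_stepE k g v : lipschitz01 k g ->
  (affine_step Q Y alpha g v)%:E = (\int[mu]_t (g t * ln_X_pdf (t - alpha * v))%:E)%E.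
Proof.
move=> gk; have mg := lipschitz01_measurable gk; have [_ g01 _] := gk.
rewrite /affine_step /Rintegral fineK; last first.
  apply: integrable_fin_num => //.
  apply: (lipschitz01_integrable Q (V := fun w => alpha * v + Y w) gk).
  exact: measurable_funD.
rewrite (lawY (f := fun y => (g (alpha * v + y))%:E)); last 2 first.
- by apply/measurable_EFinP; apply: measurableT_comp => //; exact: measurable_funD.
- by move=> y; rewrite lee_fin; have /andP[] := g01 (alpha * v + y).
rewrite [RHS](@ge0_integral_shift _ (alpha * v)); last 2 first.
- apply/measurable_EFinP; apply: measurable_funM => //.
  by apply: measurableT_comp; [exact: measurable_ln_X_pdf|exact: measurable_funB].
- by move=> t; rewrite lee_fin mulr_ge0 ?ln_X_pdf_ge0//; have /andP[] := g01 t.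
by apply: eq_integral => t _; rewrite -EFinM addrK addrC.
Qed.

(** By Tonelli, averaging the test function amounts to convolving the
    densities, which [ln_abs_normal_pdf_fixed] evaluates. *)
Lemma ln_abs_normal_step k g : lipschitz01 k g ->
  \int[normal_prob 0 1]_x g (ln_abs x) =
  \int[normal_prob 0 1]_x affine_step Q Y alpha g (ln_abs x).
Proof.
move=> gk; have mg := lipschitz01_measurable gk; have [_ g01 _] := gk.
have g0 t : 0 <= g t by have /andP[] := g01 t.
have gk' := lipschitz01_affine_step Q mY (ltW alpha_gt0) gk.
have mg' := lipschitz01_measurable gk'; have [_ g01' _] := gk'.
rewrite /Rintegral; congr fine.
rewrite (@ge0_integral_ln_abs_normal _ (EFin \o g)); last 2 first.
- exact/measurable_EFinP.
- by move=> x; rewrite lee_fin.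
rewrite (@ge0_integral_ln_abs_normal _ (EFin \o affine_step Q Y alpha g)); last 2 first.
- exact/measurable_EFinP.
- by move=> x; rewrite lee_fin; have /andP[] := g01' x.
pose F (p : R * R) := (g p.2 * ln_X_pdf (p.2 - alpha * p.1) * ln_abs_normal_pdf p.1)%:E.
have F0 p : (0 <= F p)%E by rewrite lee_fin mulr_ge0 ?ln_abs_normal_pdf_ge0// mulr_ge0 ?ln_X_pdf_ge0.
have mF : measurable_fun setT F.
  apply/measurable_EFinP; apply: measurable_funM.
    apply: measurable_funM; first exact: measurableT_comp.
    apply: measurableT_comp; first exact: measurable_ln_X_pdf.
    by apply: measurable_funB => //; exact: measurable_funM.
  by apply: measurableT_comp => //; exact: measurable_ln_abs_normal_pdf.
transitivity (\int[mu]_t \int[mu]_v F (v, t))%E.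
  apply: eq_integral => t _; rewrite -ln_abs_normal_pdf_fixed.
  rewrite -ge0_integralZl//.
  - apply: eq_integral => v _. by rewrite -EFinM mulrA.
  - by apply/measurable_EFinP; exact: measurable_prod.
  - by move=> v _; rewrite lee_fin mulr_ge0 ?ln_X_pdf_ge0 ?ln_abs_normal_pdf_ge0.
  - by rewrite lee_fin.
transitivity (\int[mu]_v \int[mu]_t F (v, t))%E.
  exact/esym/(@fubini_tonelli _ _ _ _ _ mu mu F mF F0).
apply: eq_integral => v _.
rewrite /= (affine_stepE v gk) muleC -ge0_integralZl//.
- by apply: eq_integral => t _; rewrite -EFinM mulrC.
- apply/measurable_EFinP; apply: measurable_funM => //.
  by apply: measurableT_comp; [exact: measurable_ln_X_pdf|exact: measurable_funB].
- by move=> t _; rewrite lee_fin mulr_ge0 ?ln_X_pdf_ge0.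
- by rewrite lee_fin ln_abs_normal_pdf_ge0.
Qed.

End fixed_point.
End ln_density.

(** * Laws, densities and independence *)

Section law.
Context {R : realType} d (T : measurableType d) (P : probability T R).
Notation mu := (@lebesgue_measure R).
Local Open Scope ereal_scope.

Lemma eq_law_integral (V W : T -> R) (f : R -> \bar R) :
  measurable_fun setT V -> measurable_fun setT W ->
  eq_law (pushforward P V) (pushforward P W) ->
  measurable_fun setT f -> (forall x, 0 <= f x) ->
  \int[P]_w f (V w) = \int[P]_w f (W w).
Proof.
move=> mV mW VW mf f0.
have := @ge0_integral_pushforward _ _ T R R V mV P setT f measurableT mf (fun x _ => f0 x).
have := @ge0_integral_pushforward _ _ T R R W mW P setT f measurableT mf (fun x _ => f0 x).
rewrite !preimage_setT => <- <-.
by apply: eq_measure_integral => A mA _; exact: VW.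
Qed.

Lemma density_integral (X : {RV P >-> R}) rho (f : R -> \bar R) :
  has_density X rho -> measurable_fun setT f -> (forall x, 0 <= f x) ->
  \int[P]_w f (X w) = \int[mu]_x (f x * (rho x)%:E).
Proof.
move=> [mrho rho0 law] mf f0.
have mX : measurable_fun setT (X : T -> measurableTypeR R).
  by have h : measurable_fun setT X by []; exact: h.
have := @ge0_integral_pushforward _ _ T (measurableTypeR R) R X mX P setT f measurableT mf (fun x _ => f0 x).
rewrite preimage_setT => <-.
exact: (@ge0_integral_density _ (measurableTypeR R) R mu
  (measure_function_pushforward__canonical__measure_function_Measure P mX) rho mrho rho0 law f mf f0).
Qed.

Lemma density_null (X : {RV P >-> R}) rho r :
  has_density X rho -> P (X @^-1` [set r]) = 0.
Proof.
by move=> [_ _ law]; rewrite -/(pushforward P X [set r]) law// integral_set1.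
Qed.

(** The joint law of [U] and [X] is the product of their laws, to which Tonelli
    applies. *)
Lemma independent_integral (U X : {RV P >-> R}) (f : R * R -> \bar R) :
  independent_rv U X -> measurable_fun setT f -> (forall x, 0 <= f x) ->
  \int[P]_w f (U w, X w) = \int[P]_w \int[P]_v f (U w, X v).
Proof.
move=> ind mf f0.
have mU : measurable_fun setT U by [].
have mX : measurable_fun setT X by [].
have mUX : measurable_fun setT (fun w => (U w, X w)) by exact: measurable_fun_pair.
have := @ge0_integral_pushforward _ _ T (R * R)%type R (fun w => (U w, X w)) mUX
  P setT f measurableT mf (fun x _ => f0 x).
rewrite preimage_setT /comp => <-.
transitivity (\int[distribution P U \x distribution P X]_p f p).
  apply: eq_measure_integral => A mA _; apply/esym.
  apply: (@product_measure_unique _ _ _ _ R (distribution P U) (distribution P X)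
    (measure_function_pushforward__canonical__measure_function_Measure P mUX)) => //.
rewrite (fubini_tonelli1 f)// ge0_integral_distribution//.
- apply: eq_integral => w _; rewrite /= /fubini_F ge0_integral_distribution//.
  exact: measurableT_comp.
- exact: measurable_fun_fubini_tonelli_F.
- by move=> x; exact: integral_ge0.
Qed.

End law.

(** * Symmetric laws *)

Section symmetric_law.
Context {R : realType} d (T : measurableType d) (P : probability T R) (V : T -> R).
Hypotheses (mV : measurable_fun setT V)
  (symV : forall B : set R, measurable B -> P (V @^-1` B) = P ((fun w => - V w) @^-1` B))
  (V0 : P (V @^-1` [set 0]) = 0%E).
Local Open Scope ereal_scope.

Let measurable_preimage (W : T -> R) (B : set R) :
  measurable_fun setT W -> measurable B -> measurable (W @^-1` B).
Proof. by move=> mW mB; rewrite -[X in measurable X]setTI; exact: mW. Qed.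

Let pos : set R := [set x | (0 < x)%R].
Let neg : set R := [set x | (x < 0)%R].

Let mpos : measurable pos. Proof. by rewrite /pos -set_itvoy. Qed.
Let mneg : measurable neg. Proof. by rewrite /neg -set_itvNyo. Qed.
Let measurable_V (B : set R) : measurable B -> measurable (V @^-1` B).
Proof. exact: measurable_preimage. Qed.

Let split_sign (E : set T) : measurable E ->
  P E = P (E `&` V @^-1` pos) + P (E `&` V @^-1` neg).
Proof.
move=> mE.
have mp : measurable (E `&` V @^-1` pos) by apply: measurableI => //; exact: measurable_V.
have mn : measurable (E `&` V @^-1` neg) by apply: measurableI => //; exact: measurable_V.
have mz : measurable (E `&` V @^-1` [set 0%R]).
  by apply: measurableI => //; exact: measurable_V.
rewrite -measureU//; last first.
  apply/seteqP; split => // w [[_ /= h1] [_ h2]].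
  by move: (lt_trans h1 h2); rewrite ltxx.
apply/eqP; rewrite eq_le; apply/andP; split; last first.
  by rewrite -setIUr; apply: le_measure; rewrite ?inE ?setIUr//; [exact: measurableU|rewrite -setIUr; exact: subIsetl].
have z0 : P (E `&` V @^-1` [set 0%R]) = 0.
  apply/eqP; rewrite -measure_le0 -V0; apply: le_measure; rewrite ?inE//.
  exact: measurable_V.
rewrite -[leRHS]adde0 -z0; apply: (le_trans _ (measureU2 _ _ _)) => //; last exact: measurableU.
apply: le_measure; rewrite ?inE//; first by apply: measurableU => //; exact: measurableU.
move=> w Ew; have [h|h|h] := ltgtP (V w) 0%R.
- by left; right.
- by left; left.
- by right.
Qed.

(** By symmetry [V] and [- V] have the same mass on either half line, and 0 has
    none: the sign of [V] is a fair coin independent of [|V|]. *)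
Lemma symmetric_ln_abs (B : set R) : measurable B ->
  P (V @^-1` B) + P (V @^-1` B) =
  P ((ln_abs \o V) @^-1` (expR @^-1` B)) +
  P ((ln_abs \o V) @^-1` ((fun t => - expR t)%R @^-1` B)).
Proof.
move=> mB.
have mln : measurable_fun setT (ln_abs \o V).
  by apply: measurableT_comp => //; exact: measurable_ln_abs.
have mE : measurable_fun setT (fun w => expR (ln_abs (V w))) by exact: measurableT_comp.
have mNE : measurable_fun setT (fun w => - expR (ln_abs (V w)))%R by exact: measurableT_comp.
have m1 : measurable ((ln_abs \o V) @^-1` (expR @^-1` B)) by exact: (measurable_preimage mE mB).
have m2 : measurable ((ln_abs \o V) @^-1` ((fun t => - expR t)%R @^-1` B)).
  exact: (measurable_preimage mNE mB).
rewrite (split_sign m1) (split_sign m2) (split_sign (measurable_preimage mV mB)).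
have abs_pos w : (0 < V w)%R -> expR (ln_abs (V w)) = V w.
  by move=> h; rewrite /ln_abs lnK ?gtr0_norm.
have abs_neg w : (V w < 0)%R -> expR (ln_abs (V w)) = (- V w)%R.
  by move=> h; rewrite /ln_abs lnK ?ltr0_norm// posrE oppr_gt0.
have pp : (ln_abs \o V) @^-1` (expR @^-1` B) `&` V @^-1` pos = V @^-1` B `&` V @^-1` pos.
  by apply/seteqP; split => w /= [h p]; move: h; rewrite abs_pos.
have nn : (ln_abs \o V) @^-1` ((fun t => - expR t)%R @^-1` B) `&` V @^-1` neg =
    V @^-1` B `&` V @^-1` neg.
  by apply/seteqP; split => w /= [h p]; move: h; rewrite abs_neg ?opprK.
have pn : P ((ln_abs \o V) @^-1` (expR @^-1` B) `&` V @^-1` neg) = P (V @^-1` B `&` V @^-1` pos).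
  rewrite -[in RHS]preimage_setI symV; last by apply: measurableI.
  congr (P _); apply/seteqP; split => w /= [h].
    by move=> p; move: h; rewrite abs_neg// => h; split => //; rewrite /pos/= oppr_gt0.
  by rewrite /pos/= oppr_gt0 => p; rewrite abs_neg.
have np : P ((ln_abs \o V) @^-1` ((fun t => - expR t)%R @^-1` B) `&` V @^-1` pos) =
    P (V @^-1` B `&` V @^-1` neg).
  rewrite -[in RHS]preimage_setI symV; last by apply: measurableI.
  congr (P _); apply/seteqP; split => w /= [h].
    by move=> p; move: h; rewrite abs_pos// => h; split => //; rewrite /neg/= oppr_lt0.
  by rewrite /neg/= oppr_lt0 => p; rewrite abs_pos.
rewrite pp nn pn np; move: (P (V @^-1` B `&` V @^-1` pos)) (P (V @^-1` B `&` V @^-1` neg)) => p n.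
by rewrite addeACA.
Qed.

End symmetric_law.

(** * The characterization *)

Section normal_symmetric.
Context {R : realType}.
Notation N := (normal_prob (0 : R) 1).

Lemma normal_prob_symmetric (B : set R) : measurable B -> N B = N ((fun x => - x) @^-1` B).
Proof.
move=> mB.
have mB' : measurable ((fun x : R => - x) @^-1` B).
  have m : measurable_fun setT (fun x : R => - x).
    by apply: continuous_measurable_fun; exact: opp_continuous.
  by rewrite -[X in measurable X]setTI; exact: m.
have E (A : set R) : measurable A -> (N A =
    \int[lebesgue_measure]_t (((\1_A (expR t) : R)%:E + (\1_A (- expR t) : R)%:E) * (2^-1 * ln_abs_normal_pdf t)%:E))%E.
  move=> mA; rewrite -(@ge0_integral_normal _ (fun x => (\1_A x)%:E)).
  - by rewrite integral_indic// setIT.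
  - by apply/measurable_EFinP; exact: measurable_indic.
  - by move=> x; rewrite lee_fin.
rewrite (E _ mB) (E _ mB').
apply: eq_integral => t _; rewrite [in LHS]addeC; congr (_ * _)%E.
by rewrite !indicE -{2}(opprK (expR t)).
Qed.

Lemma normal_prob_set1 (r : R) : N [set r] = 0%E.
Proof. by rewrite /normal_prob integral_set1. Qed.

End normal_symmetric.

Section logarithmic_equation.
Context {R : realType} d (T : measurableType d) (P : probability T R).
Variables (U X : {RV P >-> R}) (alpha : R).
Notation mu := (@lebesgue_measure R).

Lemma ln_density_law :
  {ae P, forall w, 0 < X w} -> has_density X (rhoX alpha) ->
  forall f : R -> \bar R, measurable_fun setT f -> (forall x, 0 <= f x)%E ->
    (\int[P]_w f (ln (X w)) = \int[mu]_t (f t * (ln_X_pdf alpha t)%:E))%E.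
Proof.
move=> X0 dX f mf f0; have [mrho rho0 _] := dX.
have mfl : measurable_fun setT (fun x => f (ln x)).
  by apply: measurableT_comp => //; exact: measurable_ln.
rewrite (density_integral (f := fun x => f (ln x)) dX)//.
transitivity (\int[mu]_(x in `]0%R, +oo[) (f (ln x) * (rhoX alpha x)%:E))%E.
  rewrite [RHS]integral_mkcond; apply: eq_integral => x _; rewrite patchE.
  case: ifPn => // /negP; rewrite inE/= in_itv/= andbT => /negP x0.
  by rewrite /rhoX (negbTE x0) mule0.
rewrite (@ge0_integral_expR _ (fun x => f (ln x) * (rhoX alpha x)%:E)%E); last 2 first.
- by apply: emeasurable_funM => //; apply/measurable_EFinP.
- by move=> x; rewrite mule_ge0// lee_fin.
by apply: eq_integral => t _; rewrite expRK -muleA.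
Qed.

(** Where [U] is nonzero and [X] positive, the logarithm of [|U| `^ alpha * X]
    is [alpha * ln |U| + ln X]; independence then gives the conditional
    expectation. *)
Lemma ln_abs_step k g : 0 < alpha -> {ae P, forall w, 0 < X w} -> independent_rv U X ->
  P (U @^-1` [set 0]) = 0%E ->
  eq_law (pushforward P (fun w => `|U w|)) (pushforward P (fun w => `|U w| `^ alpha * X w)) ->
  lipschitz01 k g ->
  \int[P]_w g (ln_abs (U w)) =
  \int[P]_w affine_step P (@ln R \o X) alpha g (ln_abs (U w)).
Proof.
move=> a0 X0 ind U0 law gk; have mg := lipschitz01_measurable gk; have [_ g01 _] := gk.
have g0 t : 0 <= g t by have /andP[] := g01 t.
have mU : measurable_fun setT U by [].
have mX : measurable_fun setT X by [].
have mlX : measurable_fun setT (@ln R \o X).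
  by apply: measurableT_comp => //; exact: measurable_ln.
have mlU : measurable_fun setT (ln_abs \o U).
  by apply: measurableT_comp => //; exact: measurable_ln_abs.
have mgE : measurable_fun setT (EFin \o g) by exact/measurable_EFinP.
have mabs : measurable_fun setT (fun w => `|U w|) by exact: measurableT_comp.
have mpow : measurable_fun setT (fun w => `|U w| `^ alpha * X w).
  apply: measurable_funM => //.
  by apply: (measurableT_comp (@measurable_powR R alpha)).
have mgl : measurable_fun setT (fun x => (g (ln x))%:E).
  by apply: (measurableT_comp mgE); exact: measurable_ln.
have mstep : measurable_fun setT (fun w => (g (alpha * ln_abs (U w) + ln (X w)))%:E).
  apply: (measurableT_comp mgE); apply: measurable_funD => //.
  exact: measurable_funM.
have mF : measurable_fun setT (fun p : R * R => (g (alpha * ln_abs p.1 + ln p.2))%:E).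
  apply: (measurableT_comp mgE); apply: measurable_funD.
    by apply: measurable_funM => //; apply: measurableT_comp => //; exact: measurable_ln_abs.
  by apply: measurableT_comp => //; exact: measurable_ln.
have gE0 x : (0 <= (g x)%:E)%E by rewrite lee_fin.
have mU0 : measurable (U @^-1` [set 0]).
  by rewrite -[Y in measurable Y]setTI; exact: mU.
rewrite /Rintegral; congr fine.
rewrite (eq_law_integral (f := fun x => (g (ln x))%:E) mabs mpow law mgl (fun x => gE0 _)).
transitivity (\int[P]_w (g (alpha * ln_abs (U w) + ln (X w)))%:E)%E.
  apply: ge0_ae_eq_integral => //.
  - exact: (measurableT_comp mgl mpow).
  - have [A [mA A0 hA]] := X0.
    exists (A `|` U @^-1` [set 0]); split.
    + exact: measurableU.
    + apply/eqP; rewrite -measure_le0.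
      have e : (P A + P (U @^-1` [set 0%R]) = 0)%E by rewrite A0 U0 adde0.
      by rewrite -e; exact: measureU2.
    + move=> w /= h; apply: contrapT => /not_orP[h1 h2]; apply: h => _.
      have Xw : 0 < X w by apply: contrapT => h3; apply: h1; exact: hA.
      have Uw : 0 < `|U w| by rewrite normr_gt0; apply/eqP.
      by rewrite lnM ?posrE ?powR_gt0// ln_powR.
rewrite (independent_integral (f := fun p => (g (alpha * ln_abs p.1 + ln p.2))%:E) ind mF (fun x => gE0 _)).
apply: eq_integral => w _; rewrite /affine_step /Rintegral fineK//=.
apply: integrable_fin_num => //.
apply: (lipschitz01_integrable P (V := fun v => alpha * ln_abs (U w) + ln (X v)) gk).
exact: measurable_funD.
Qed.

End logarithmic_equation.

Theorem proposition4p2 (R : realType) (d : measure_display)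
    (T : measurableType d) (P : probability T R) (U X : {RV P >-> R})
    (rhoU : R -> R) (a b alpha : R)
    (U_sym : symmetric_rv U)
    (rhoU_cont : continuous rhoU)
    (U_density : has_density U rhoU)
    (a_gt0 : 0 < a) (a_lt1 : a < 1) (b_gt1 : 1 < b)
    (rhoU_mellin : forall z : R[i], a < complex.Re z -> complex.Re z < b ->
      cintegrable `[0, +oo[ (fun x => cpower x (z - 1) * (rhoU x)%:C%C))
    (alpha_gt0 : 0 < alpha) (alpha_lt1 : alpha < 1)
    (X_gt0 : {ae P, forall w, 0 < X w})
    (UX_indep : independent_rv U X)
    (X_density : has_density X (rhoX alpha))
    (U_eq : eq_law (pushforward P (fun w => `|U w|))
                   (pushforward P (fun w => `|U w| `^ alpha * X w))) :
  eq_law (pushforward P U) (normal_prob 0 1).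
Proof.
have mU : measurable_fun setT U by [].
have mX : measurable_fun setT X by [].
have mlX : measurable_fun setT (@ln R \o X).
  by apply: measurableT_comp => //; exact: measurable_ln.
have mlU : measurable_fun setT (ln_abs \o U).
  by apply: measurableT_comp => //; exact: measurable_ln_abs.
have U0 := density_null 0 U_density.
have [mrho rho0 _] := X_density.
have lawX := ln_density_law X_gt0 X_density.
have step1 := fun k g => @ln_abs_step R d T P U X alpha k g alpha_gt0 X_gt0 UX_indep U0 U_eq.
have step2 := fun k g => @ln_abs_normal_step R alpha alpha_gt0 alpha_lt1 mrho rho0 _ _ P _ mlX lawX k g.
have same := @affine_step_unique R _ _ P _ alpha mlX (ltW alpha_gt0) alpha_lt1 _ _ P
  _ (measurableTypeR R) (normal_prob 0 1) _ _ mlU (@measurable_ln_abs R) step1 step2.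
have law := @lipschitz01_determining R _ _ P _ (measurableTypeR R) (normal_prob 0 1)
  _ _ mlU (@measurable_ln_abs R) same.
move=> B mB.
have sU := symmetric_ln_abs mU (fun B mB => U_sym B mB) U0 mB.
have sN := @symmetric_ln_abs R _ (measurableTypeR R) (normal_prob 0 1) id (@measurable_id _ R setT)
  (@normal_prob_symmetric R) (normal_prob_set1 0) B mB.
have mexp : measurable (expR @^-1` B).
  by rewrite -[X in measurable X]setTI; exact: measurable_expR.
have mNexp : measurable ((fun t : R => - expR t) @^-1` B).
  have m : measurable_fun setT (fun t : R => - expR t) by exact: measurableT_comp.
  by rewrite -[X in measurable X]setTI; exact: m.
have : (P (U @^-1` B) + P (U @^-1` B) = normal_prob 0 1 B + normal_prob 0 1 B)%E.
  by rewrite sU (law _ mexp) (law _ mNexp) sN.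
have f1 : P (U @^-1` B) \is a fin_num.
  by apply: fin_num_measure; rewrite -[X in measurable X]setTI; exact: mU.
have f2 : normal_prob 0 1 B \is a fin_num by exact: fin_num_measure.
rewrite /pushforward -(fineK f1) -(fineK f2) -!EFinD => -[h]; congr EFin; lra.
Qed.
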